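(* Let $N=m+n\to\infty$ with $m/N\to r\in(0,1)$, and let $G=G_N$ be a simple undirected graph on the nodes $\{1,\dots,N\}$ for each $N$. Suppose that, as $N\to\infty$, (1) $\sum_{i=1}^N |G_i|^2=o(|G|^{1.5})$ and $N_{sq}=o(|G|^2)$; (2) $\sum_{i=1}^N|\tilde d_i|^3=o(V_G^{1.5})$, $\sum_{i=1}^N\tilde d_i^{\,3}=o(V_G\sqrt{|G|})$, and $\sum_{i=1}^N\ \sum_{j,k\in \mathrm{node}_{G_i},\, j\neq k}\tilde d_j\tilde d_k=o(|G|V_G)$. Then, under the permutation null distribution, the generalized edge-count statistic $S$ converges in distribution to $\chi^2_2$, the chi-squared distribution with two degrees of freedom.
   Context: Graph notation. $G$ denotes both the graph on nodes $\{1,\dots,N\}$ (simple: no duplicate edges, no loops; undirected) and its edge set; $|\cdot|$ is cardinality, so $|G|$ is the number of edges. $G_i$ is the set of edges having node $i$ as an endpoint (so $|G_i|$ is the degree of $i$), and $\mathrm{node}_{G_i}$ is the set of neighbours of $i$ (excluding $i$). $\tilde d_i=|G_i|-2|G|/N$ is the centered degree, $V_G=\sum_{i=1}^N\tilde d_i^{\,2}=\sum_{i=1}^N|G_i|^2-4|G|^2/N$. $N_{sq}$ is the number of squares (4-cycles) in $G$. $a_N=o(b_N)$ means $\lim_{N\to\infty}a_N/b_N=0$. Permutation null distribution. The graph is fixed; the labels $(g_1,\dots,g_N)\in\{1,2\}^N$ are random: each choice of $m$ of the $N$ nodes to receive label $1$ (sample X), the remaining $n=N-m$ nodes receiving label $2$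 (sample Y), has probability $1/\binom{N}{m}$. $\mathsf E_P$, $\mathsf{Var}_P$ denote expectation and variance (covariance matrix for vectors) under this distribution. Statistic. For $j=1,2$, $R_j$ is the number of edges of $G$ both of whose endpoints have label $j$. With $\Sigma_R=\mathsf{Var}_P\big((R_1,R_2)^T\big)$, $$S=\begin{pmatrix}R_1-\mathsf E_P(R_1)& R_2-\mathsf E_P(R_2)\end{pmatrix}\Sigma_R^{-1}\begin{pmatrix}R_1-\mathsf E_P(R_1)\\ R_2-\mathsf E_P(R_2)\end{pmatrix}.$$ *)

(* Defs.v *)
From HB Require Import structures.
From mathcomp Require Import all_boot all_order all_algebra.
From mathcomp Require Import all_classical all_reals all_analysis.

Set Implicit Arguments.
Unset Strict Implicit.
Unset Printing Implicit Defensive.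

Import Order.TTheory GRing.Theory Num.Theory.
Import numFieldNormedType.Exports.

Local Open Scope ring_scope.

Record sgraph (N : nat) := SGraph {
  adj :> rel 'I_N;
  adj_sym : symmetric adj;
  adj_irrefl : irreflexive adj }.

Section Graph.
Local Open Scope set_scope.
Variables (N : nat) (G : sgraph N).

Definition edges : {set {set 'I_N}} :=
  [set [set p.1; p.2] | p : 'I_N * 'I_N & G p.1 p.2].

Definition edges_at (i : 'I_N) : {set {set 'I_N}} :=
  [set e in edges | i \in e].

Definition neighbours (i : 'I_N) : {set 'I_N} := [set j | G i j].

(* Squares are counted as (not necessarily induced) subgraphs: each one is
   identified with its set of four edges, hence counted once. *)
Definition squares : {set {set {set 'I_N}}} :=
  [set C : {set {set 'I_N}} | (C \subset edges) &&
    [exists a : 'I_N, exists b : 'I_N, exists c : 'I_N, exists d : 'I_N,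
      uniq [:: a; b; c; d] &&
      (C == [set [set a; b]; [set b; c]; [set c; d]; [set d; a]])]].

Variable R : realType.

Definition cdeg (i : 'I_N) : R :=
  #|edges_at i|%:R - 2 * #|edges|%:R / N%:R.

Definition VG : R := \sum_(i < N) cdeg i ^+ 2.

End Graph.

(* The condition on [b] expresses that the quotients in lim a_N / b_N = 0 are
   defined for all large N (division by zero is total here); it is not implied
   by the limit. *)
Definition is_littleo (R : realType) (a b : nat -> R) : Prop :=
  (\forall N \near \oo, b N != 0)%classic /\
  (a N / b N @[N --> \oo] --> (0 : R))%classic.

Section Permutation.
Variables (R : realType) (N m : nat).

(* A labelling is given by the set of the nodes receiving label 1. *)
Definition perm_expect (f : {set 'I_N} -> R) : R :=
  \sum_(A : {set 'I_N} | #|A| == m) f A / ('C(N, m))%:R.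

Definition perm_prob (E : pred {set 'I_N}) : R :=
  perm_expect (fun A => (E A)%:R).

(* Index 0 stands for label 1 (sample X) and index 1 for label 2 (sample Y). *)
Definition sample (A : {set 'I_N}) (j : 'I_2) : {set 'I_N} :=
  if j == ord0 then A else (~: A)%SET.

Variable G : sgraph N.

Definition edge_count (j : 'I_2) (A : {set 'I_N}) : R :=
  #|[set e in edges G | e \subset sample A j]%SET|%:R.

Definition centered_count (j : 'I_2) (A : {set 'I_N}) : R :=
  edge_count j A - perm_expect (edge_count j).

Definition SigmaR : 'M[R]_2 := \matrix_(i, j)
  perm_expect (fun A => centered_count i A * centered_count j A).

(* [invmx SigmaR] is the inverse only when [SigmaR] is invertible. *)
Definition Sstat (A : {set 'I_N}) : R :=
  let v : 'rV[R]_2 := \row_j centered_count j A in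
  (v *m invmx SigmaR *m v^T) 0 0.

Definition Sstat_cdf (x : R) : R := perm_prob (fun A => Sstat A <= x).

End Permutation.

(* The law of the sum of the squares of two independent standard normal
   variables. *)
Definition chi2_2 (R : realType) : set R -> \bar R :=
  pushforward (normal_prob (0 : R) 1 \x normal_prob (0 : R) 1)%E
    (fun z : R * R => z.1 ^+ 2 + z.2 ^+ 2).

(* Convergence in distribution of a sequence of random variables, given by their
   cumulative distribution functions, to a probability measure on the line:
   convergence at every continuity point of the limit. *)
Definition cvg_in_law (R : realType) (F : nat -> R -> R)
    (mu : set R -> \bar R) : Prop :=
  let Fmu := fun x : R => fine (mu `]-oo, x]%classic) in
  forall x : R, {for x, continuous Fmu} ->
    (F N x @[N --> \oo] --> Fmu x)%classic.

(* Main.v *)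
Require Import Defs.
From mathcomp Require Import all_boot all_order all_algebra.
From mathcomp Require Import all_classical all_reals all_analysis.
From mathcomp Require Import measurable_realfun.
From mathcomp Require Import perm ring lra.

Set Implicit Arguments.
Unset Strict Implicit.
Unset Printing Implicit Defensive.

Import Order.TTheory GRing.Theory Num.Theory.
Import numFieldNormedType.Exports.

Local Open Scope ring_scope.

(** Let [p] be the proportion of nodes with label 1 and let [x_i] be the
    indicator of label 1 at [i] minus [p]. Put [Q], the sum of [x_i * x_j] over
    the edges, and [L], the sum of the [x_i] weighted by the centred degrees.
    When exactly [m] nodes carry label 1, both edge counts are affine functions
    of [Q] and [L] ([edge_count0], [edge_count1]). As [S] does not change under
    invertible affine maps of the two counts, it is the quadratic form of the
    inverse covariance matrix of [Q] and [L] ([Sstat_forms]). Exchangeability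
    gives the moments of the [x_i] up to order four ([exchange_moment]); with
    them the covariance matrix of the standardised vector [W = (Wq, Wl)] is seen
    to be close to the identity, and [S] to [|W|^2] ([Sstat_close]).

    The limit law is identified through [exp (- S / 2)], which takes values in
    the unit interval: the law of chi-squared with two degrees of freedom is the
    one for which this variable is uniform. It therefore suffices to show that
    the expectation of [exp (- k * S / 2)] tends to [1 / (1 + k)] for every
    natural number [k]; the passage from these moments to the distribution
    functions is by Bernstein polynomials ([laplace_cvg_in_law]).

    The Laplace transform is computed first for independent labels with success
    probability [p]. Products of distinct [x_i] are then orthogonal, so that the
    second moments of multilinear forms are bounded by their coefficients
    ([multilinear_sq]). Stein's method, in the form of an integration by parts
    in each label, shows that the expectation of
    [((1 + a) * |W|^2 - 2) * exp (- a * |W|^2 / 2)] is small ([stein_bound]).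
    Up to the factor -1/2 this is the derivative in [a] of [1 + a] times the
    Laplace transform, which is 1 at [a = 0]; hence the Laplace transform is
    close to [1 / (1 + a)] ([bern_laplace]). The conditions on the graph enter
    here: the error consists of Taylor remainders ([stein_remainder]) and of the
    fluctuations of three conditional covariances, which are controlled by the
    squared degrees and the number of squares ([T11_sq]), by the sums of the
    centred degrees over neighbourhoods ([T21_sq]), and by the third absolute
    moments of the centred degrees ([T22_sq]). The conditions on the cubes and on
    the pairs of neighbours together bound the neighbourhood sums ([nbr_sum]).

    It remains to replace independent labels by labels with exactly [m] ones. Given
    the number of ones, independent labels are uniform; and to increase this
    number by one is to add a uniform node to the set of ones. The expectation
    of [exp (- a * |W|^2 / 2)] changes little in such a step, because the
    exponential absorbs the drift of [W] ([step_unif]). By Chebyshev's inequality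
    the number of ones is within a large multiple of the square root of [N]
    of [m], and the changes over that many steps still add up to little
    ([transfer]). *)

(** * Finite expectations *)

(** Laws on a finite type are given by their weights, so that the independent
    labels and the labels with a fixed number of ones are two laws on the same
    type of sets of nodes. *)
Definition fexp (R : realType) (T : finType) (w f : T -> R) : R :=
  \sum_(x : T) w x * f x.

Section FiniteExpectation.
Variables (R : realType) (T : finType) (w : T -> R).
Implicit Types f g : T -> R.

Lemma eq_fexp f g : f =1 g -> fexp w f = fexp w g.
Proof. by move=> fg; apply: eq_bigr => x _; rewrite fg. Qed.

Lemma fexpD f g : fexp w (fun x => f x + g x) = fexp w f + fexp w g.
Proof. by rewrite /fexp -big_split; apply: eq_bigr => x _; rewrite mulrDr. Qed.

Lemma fexpZ c f : fexp w (fun x => c * f x) = c * fexp w f.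
Proof. by rewrite /fexp mulr_sumr; apply: eq_bigr => x _; rewrite mulrCA. Qed.

Lemma fexpB f g : fexp w (fun x => f x - g x) = fexp w f - fexp w g.
Proof. by rewrite /fexp -sumrB; apply: eq_bigr => x _; rewrite mulrBr. Qed.

Lemma fexp_sum (I : finType) (P : pred I) (F : I -> T -> R) :
  fexp w (fun x => \sum_(i | P i) F i x) = \sum_(i | P i) fexp w (F i).
Proof.
rewrite /fexp exchange_big /=; apply: eq_bigr => x _.
by rewrite mulr_sumr.
Qed.

Hypothesis w_ge0 : forall x, 0 <= w x.

Lemma ler_fexp f g : (forall x, f x <= g x) -> fexp w f <= fexp w g.
Proof. by move=> fg; apply: ler_sum => x _; apply: ler_wpM2l. Qed.

Lemma fexp_ge0 f : (forall x, 0 <= f x) -> 0 <= fexp w f.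
Proof. by move=> f0; apply: sumr_ge0 => x _; apply: mulr_ge0. Qed.

Lemma ler_norm_fexp f : `|fexp w f| <= fexp w (fun x => `|f x|).
Proof.
apply: (le_trans (ler_norm_sum _ _ _)); apply: ler_sum => x _.
by rewrite normrM (ger0_norm (w_ge0 x)).
Qed.

Hypothesis w_sum1 : \sum_x w x = 1.

Lemma fexp_cst c : fexp w (fun=> c) = c.
Proof. by rewrite /fexp -mulr_suml w_sum1 mul1r. Qed.

(** A first absolute moment is controlled by a second moment at any scale
    [eta]; this replaces Cauchy-Schwarz and avoids square roots. *)
Lemma fexp_norm_le_sq f eta K :
  0 < eta -> fexp w (fun x => f x ^+ 2) <= K * eta ^+ 2 ->
  fexp w (fun x => `|f x|) <= (1 + K) / 2 * eta.
Proof.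
move=> eta0 fK.
have h x : `|f x| <= eta / 2 + (eta^-1 / 2) * f x ^+ 2.
  rewrite -(@ler_pM2l _ (2 * eta)) ?mulr_gt0//.
  have -> : 2 * eta * (eta / 2 + eta^-1 / 2 * f x ^+ 2) =
     eta ^+ 2 + f x ^+ 2.
    by field; rewrite gt_eqF.
  have := sqr_ge0 (eta - `|f x|); rewrite sqrrB real_normK ?num_real//.
  by lra.
apply: (le_trans (ler_fexp h)).
rewrite fexpD fexp_cst fexpZ.
have -> : (1 + K) / 2 * eta = eta / 2 + eta^-1 / 2 * (K * eta ^+ 2).
  by field; rewrite gt_eqF.
by rewrite lerD2l ler_wpM2l// divr_ge0// invr_ge0 ltW.
Qed.

End FiniteExpectation.

(** * Independent labels *)

Section Bernoulli.
Variables (R : realType) (N : nat) (p : R).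
Implicit Types (A : {set 'I_N}) (i j : 'I_N) (f g : {set 'I_N} -> R).

Definition bweight A : R := p ^+ #|A| * (1 - p) ^+ (N - #|A|).

Definition bexp f : R := fexp bweight f.

Definition xi i A : R := (i \in A)%:R - p.

(** The label of [i] is then independent of [f]: this is how leave-one-out
    quantities are recognised, without conditional expectations. *)
Definition free_of i f := forall A, f (i |: A) = f (A :\ i).

Lemma bweight_ge0 A : 0 <= p <= 1 -> 0 <= bweight A.
Proof.
by case/andP=> p0 p1; rewrite mulr_ge0// exprn_ge0// subr_ge0.
Qed.

Lemma sum_bweight : \sum_A bweight A = 1.
Proof.
rewrite (partition_big (fun A => inord #|A| : 'I_N.+1) xpredT)//=.
have cardN (A : {set 'I_N}) : (#|A| < N.+1)%N.
  by rewrite ltnS -[X in (_ <= X)%N](card_ord N) max_card.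
rewrite -[RHS](expr1n _ N) -[X in _ = X ^+ _](subrK p 1) exprDn; apply: eq_bigr => k _.
under eq_bigl => A do rewrite -(inj_eq val_inj) /= inordK//.
transitivity (\sum_(A : {set 'I_N} | #|A| == k) p ^+ k * (1 - p) ^+ (N - k)).
  by apply: eq_bigr => A /eqP Ak; rewrite /bweight Ak.
have -> : \sum_(A : {set 'I_N} | #|A| == k) p ^+ k * (1 - p) ^+ (N - k) =
  \sum_(A in [set A : {set 'I_N} | #|A| == k]) p ^+ k * (1 - p) ^+ (N - k).
  by apply: eq_bigl => A; rewrite inE.
by rewrite sumr_const card_draws card_ord mulrC.
Qed.

(** A label takes two values, hence every polynomial in it is affine; this
    turns all the polynomials below into multilinear ones. *)
Lemma xi_sq i A : xi i A ^+ 2 = p * (1 - p) + (1 - 2 * p) * xi i A.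
Proof. by rewrite /xi; case: (i \in A) => /=; ring. Qed.

Lemma free_of_xi i j : i != j -> free_of i (xi j).
Proof.
by move=> ij A; rewrite /xi !inE eq_sym (negbTE ij).
Qed.

Lemma free_of_comp2 i f g (h : R -> R -> R) :
  free_of i f -> free_of i g -> free_of i (fun A => h (f A) (g A)).
Proof. by move=> fi gi A; rewrite fi gi. Qed.

Lemma free_of_prod i (I : finType) (P : pred I) (F : I -> {set 'I_N} -> R) :
  (forall k, P k -> free_of i (F k)) ->
  free_of i (fun A => \prod_(k | P k) F k A).
Proof. by move=> h A; apply: eq_bigr => k Pk; rewrite h. Qed.

(** Pairing each set without [i] with the same set with [i] averages over the
    label of [i] alone, whose centred value has mean zero. *)
Lemma bexp_xi0 i g : free_of i g -> bexp (fun A => xi i A * g A) = 0.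
Proof.
move=> gi; rewrite /bexp /fexp (bigID (fun A => i \in A)) /=.
rewrite (reindex_onto (fun A => i |: A) (fun A => A :\ i)) /=; last first.
  by move=> A iA; rewrite finset.setD1K.
under eq_bigl => A do rewrite finset.setU11 /=.
have e A : ((i |: A) :\ i == A) = (i \notin A).
  apply/eqP/idP => [<-|iA]; first by rewrite !inE eqxx.
  by rewrite finset.setU1K.
under eq_bigl do rewrite e.
rewrite -big_split /= big1// => A iA.
have -> : g (i |: A) = g A.
  by rewrite gi; congr g; apply/finset.setDidPl; rewrite disjoint_sym disjoints1.
rewrite /xi finset.setU11 (negbTE iA) /bweight cardsU1 iA /= add1n.
have AN : (#|A| < N)%N.
  have : (#|i |: A| <= N)%N by rewrite -[X in (_ <= X)%N](card_ord N) max_card.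
  by rewrite cardsU1 iA.
rewrite -(subnSK AN) !exprS.
by ring.
Qed.

Hypothesis p01 : 0 <= p <= 1.

Lemma xi_norm i A : `|xi i A| <= 1.
Proof.
case/andP: p01 => p0 p1; rewrite /xi ler_norml; case: (i \in A) => /=.
  by apply/andP; split; lra.
by apply/andP; split; lra.
Qed.

Definition xiS (S : {set 'I_N}) A : R := \prod_(i in S) xi i A.

Lemma xiS_norm S A : `|xiS S A| <= 1.
Proof.
rewrite /xiS normr_prod; apply: prodr_ile1 => i _.
by rewrite normr_ge0 xi_norm.
Qed.

Lemma xiS_ortho S T : S != T -> bexp (fun A => xiS S A * xiS T A) = 0.
Proof.
have h (S' T' : {set 'I_N}) i : i \in S' -> i \notin T' ->
    bexp (fun A => xiS S' A * xiS T' A) = 0.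
  move=> iS iT.
  rewrite -(@bexp_xi0 i (fun A => (\prod_(j in S' :\ i) xi j A) * xiS T' A)).
    by apply: eq_fexp => A; rewrite {1}/xiS (big_setD1 i) //= mulrA.
  apply: (@free_of_comp2 _ _ _ *%R); apply: free_of_prod => j.
    by rewrite !inE => /andP[ji _]; apply: free_of_xi; rewrite eq_sym.
  by move=> jT; apply: free_of_xi; apply: contraNneq iT => ->.
move=> ST.
have [STs|/subsetPn[i iS iT]] := boolP (S \subset T); last exact: (h _ _ i).
have /subsetPn[i iT iS] : ~~ (T \subset S).
  by apply: contra ST => TS; rewrite finset.eqEsubset STs.
rewrite -(h _ _ _ iT iS); apply: eq_fexp => A; exact: mulrC.
Qed.

(** Distinct products of centred labels are orthogonal, so the second moment
    of a multilinear form is at most the number of times a monomial may be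
    repeated times the squared norm of the coefficients. *)
Lemma multilinear_sq (I : finType) (P : pred I) (c : I -> R)
    (S : I -> {set 'I_N}) (mu : nat) :
  (forall a, P a -> (#|[pred b | P b & S b == S a]| <= mu)%N) ->
  bexp (fun A => (\sum_(a | P a) c a * xiS (S a) A) ^+ 2)
    <= mu%:R * \sum_(a | P a) c a ^+ 2.
Proof.
move=> hmu.
have -> : bexp (fun A => (\sum_(a | P a) c a * xiS (S a) A) ^+ 2) =
  \sum_(a | P a) \sum_(b | P b)
    c a * c b * bexp (fun A => xiS (S a) A * xiS (S b) A).
  transitivity (bexp (fun A => \sum_(a | P a) \sum_(b | P b)
      c a * c b * (xiS (S a) A * xiS (S b) A))).
    apply: eq_fexp => A; rewrite expr2 mulr_suml; apply: eq_bigr => a _.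
    by rewrite mulr_sumr; apply: eq_bigr => b _; ring.
  rewrite /bexp fexp_sum; apply: eq_bigr => a _; rewrite fexp_sum.
  by apply: eq_bigr => b _; rewrite fexpZ.
have bnd a b : c a * c b * bexp (fun A => xiS (S a) A * xiS (S b) A) <=
   (S b == S a)%:R * ((c a ^+ 2 + c b ^+ 2) / 2).
  have [ab|ab] := eqVneq (S b) (S a); last first.
    by rewrite xiS_ortho 1?eq_sym// mulr0 mul0r.
  rewrite mul1r ab.
  have e0 : 0 <= bexp (fun A => xiS (S a) A * xiS (S a) A).
    by apply: fexp_ge0 => A; [exact: bweight_ge0|rewrite -expr2 sqr_ge0].
  have e1 : bexp (fun A => xiS (S a) A * xiS (S a) A) <= 1.
    rewrite -[leRHS](fexp_cst sum_bweight 1); apply: ler_fexp => A.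
      exact: bweight_ge0.
    rewrite -expr2 -real_normK ?num_real//.
    by rewrite expr_le1// xiS_norm.
  have h1 := sqr_ge0 (c a - c b); have h2 := sqr_ge0 (c a + c b).
  nra.
apply: (@le_trans _ _ (\sum_(a | P a) \sum_(b | P b)
   ((S b == S a)%:R * (c a ^+ 2 / 2) + (S b == S a)%:R * (c b ^+ 2 / 2)))).
  apply: ler_sum => a _; apply: ler_sum => b _.
  by rewrite -mulrDr -mulrDl.
have -> : \sum_(a | P a) \sum_(b | P b)
   ((S b == S a)%:R * (c a ^+ 2 / 2) + (S b == S a)%:R * (c b ^+ 2 / 2)) =
  \sum_(a | P a) \sum_(b | P b) (S b == S a)%:R * c a ^+ 2.
  under eq_bigr do rewrite big_split /=.
  rewrite big_split /= [X in _ + X]exchange_big /= -big_split /=.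
  apply: eq_bigr => a _; rewrite -big_split /=; apply: eq_bigr => b _.
  by rewrite eq_sym; field.
rewrite mulr_sumr; apply: ler_sum => a Pa.
rewrite -mulr_suml; apply: ler_wpM2r; first exact: sqr_ge0.
rewrite -natr_sum ler_nat (leq_trans _ (hmu a Pa))//.
rewrite -sum1_card big_mkcondr /=.
by apply: leq_sum => b _; case: eqP.
Qed.

Lemma linear_sq (b : 'I_N -> R) :
  bexp (fun A => (\sum_i b i * xi i A) ^+ 2) <= \sum_i b i ^+ 2.
Proof.
have e A : \sum_i b i * xi i A = \sum_i b i * xiS [set i]%SET A.
  by apply: eq_bigr => i _; rewrite /xiS big_set1.
rewrite /bexp; under eq_fexp => A do rewrite e.
rewrite -[leRHS]mul1r.
apply: (@multilinear_sq _ xpredT b (fun i => [set i]%SET) 1) => a _.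
rewrite -(card1 a); apply/subset_leq_card/fintype.subsetP => k.
by rewrite !inE => /eqP/finset.set1_inj ->.
Qed.

Lemma quadratic_sq (c : 'I_N -> 'I_N -> R) : (forall i, c i i = 0) ->
  bexp (fun A => (\sum_i \sum_j c i j * (xi i A * xi j A)) ^+ 2)
    <= 4 * \sum_i \sum_j c i j ^+ 2.
Proof.
move=> c0.
have e A : \sum_i \sum_j c i j * (xi i A * xi j A) =
    \sum_a c a.1 a.2 * xiS [set a.1; a.2]%SET A.
  rewrite pair_bigA /=; apply: eq_bigr => -[i j] _ /=.
  have [->|ij] := eqVneq i j; first by rewrite c0 !mul0r.
  by rewrite /xiS big_setU1 ?inE//= big_set1.
rewrite /bexp; under eq_fexp => A do rewrite e.
rewrite pair_bigA.
apply: (@multilinear_sq _ xpredT (fun a => c a.1 a.2)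
  (fun a => [set a.1; a.2]%SET) 4) => -[a b] _ /=.
apply: (@leq_trans #|finset.setX [set a; b]%SET [set a; b]%SET|).
  apply/subset_leq_card/fintype.subsetP => -[i j].
  by rewrite inE /= => /eqP <-; rewrite !inE !eqxx orbT.
(* the two indices of a monomial lie in its two-element support *)
rewrite cardsX (@leq_mul _ _ 2 2)// cards2; by case: eqP.
Qed.

Lemma cubic_sq (P : pred ('I_N * 'I_N * 'I_N)) :
  (forall t, P t -> [&& t.1.1 != t.1.2, t.1.1 != t.2 & t.1.2 != t.2]) ->
  bexp (fun A => (\sum_(t | P t) xi t.1.1 A * (xi t.1.2 A * xi t.2 A)) ^+ 2)
    <= 27 * #|P|%:R.
Proof.
move=> Pu.
have e A : \sum_(t | P t) xi t.1.1 A * (xi t.1.2 A * xi t.2 A) =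
    \sum_(t | P t) 1 * xiS [set t.1.1; t.1.2; t.2]%SET A.
  apply: eq_bigr => -[[i j] k] /Pu /= /and3P[ij ik jk]; rewrite mul1r.
  rewrite /xiS -finset.setUA big_setU1 ?inE ?negb_or ?ij//=.
  by rewrite big_setU1 ?inE//= big_set1.
rewrite /bexp; under eq_fexp => A do rewrite e.
have -> : #|P|%:R = \sum_(t | P t) (1 : R) ^+ 2.
  by under eq_bigr do rewrite expr1n; rewrite -sum1_card natr_sum.
apply: (@multilinear_sq _ P (fun=> 1)
  (fun t => [set t.1.1; t.1.2; t.2]%SET) 27) => -[[a b] c] _ /=.
set S := [set a; b; c]%SET.
apply: (@leq_trans #|finset.setX (finset.setX S S) S|).
  apply/subset_leq_card/fintype.subsetP => -[[i j] k].
  by rewrite inE /= => /andP[_ /eqP <-]; rewrite !inE !eqxx ?orbT.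
have S3 : (#|S| <= 3)%N.
  by rewrite /S finset.setUC cardsU1 cards2; case: (_ \notin _); case: (_ != _).
by rewrite !cardsX (@leq_mul _ _ 9 3)// (@leq_mul _ _ 3 3).
Qed.

End Bernoulli.

(** * Real functions of one variable *)

Section OneVariable.
Variable R : realType.
Implicit Types (f g : R -> R) (t x : R).

Lemma is_derive_fmul f g t (df dg : R) :
  is_derive t 1 f df -> is_derive t 1 g dg ->
  is_derive t 1 (fun s => f s * g s) (df * g t + f t * dg).
Proof.
move=> hf hg; apply: is_derive_eq (is_deriveM hf hg) _.
by rewrite addrC /GRing.scale /= mulrC.
Qed.

Lemma is_derive_fadd f g t (df dg : R) :
  is_derive t 1 f df -> is_derive t 1 g dg ->
  is_derive t 1 (fun s => f s + g s) (df + dg).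
Proof. by move=> hf hg; exact: is_deriveD hf hg. Qed.

Lemma is_derive_fopp f t (df : R) : is_derive t 1 f df ->
  is_derive t 1 (fun s => - f s) (- df).
Proof. by move=> hf; exact: is_deriveN hf. Qed.

Lemma is_derive_fcst (c t : R) : is_derive t 1 (fun=> c : R) (0 : R).
Proof. exact: is_derive_cst. Qed.

Lemma is_derive_aff (a b t : R) : is_derive t 1 (fun s => a + s * b) b.
Proof.
by apply: is_derive_eq; rewrite /GRing.scale /=; ring.
Qed.

Lemma is_derive_fexp f t (df : R) : is_derive t 1 f df ->
  is_derive t 1 (fun s => expR (f s)) (expR (f t) * df).
Proof. by move=> hf; exact: is_derive1_comp. Qed.

Lemma MVT_everywhere g g' (a b : R) : a <= b ->
  (forall t, is_derive t 1 g (g' t)) ->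
  exists2 c, a <= c <= b & g b - g a = g' c * (b - a).
Proof.
move=> ab dg; have [|c] := @MVT_segment R g g' a b ab (fun t _ => dg t).
  apply: continuous_subspaceT => t.
  by apply/differentiable_continuous/derivable1_diffP; have [] := dg t.
rewrite in_itv /= => cab e; by exists c.
Qed.

(** The mean value theorem applied twice, hence [C] instead of the sharp
    [C / 2]. *)
Lemma taylor2_le g g1 g2 (C : R) :
  (forall t, is_derive t 1 g (g1 t)) -> (forall t, is_derive t 1 g1 (g2 t)) ->
  (forall t, `|g2 t| <= C) -> `|g 1 - g 0 - g1 0| <= C.
Proof.
move=> d1 d2 hC.
have [c /andP[c0 c1]] := MVT_everywhere ler01 d1.
rewrite subr0 mulr1 => ->.
have [c' _ ->] := MVT_everywhere c0 d2.
rewrite subr0 normrM (ger0_norm c0).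
by apply: le_trans (hC c'); rewrite ler_piMr.
Qed.

(** Both bounds come from [y * expR (- y) <= 1], at half and at a quarter
    of [z]. *)
Lemma expR_decay (z : R) : 0 <= z ->
  z * expR (- (1/2) * z) <= 2 /\ z ^+ 2 * expR (- (1/2) * z) <= 16.
Proof.
move=> z0.
have h (y : R) : 0 <= y -> y * expR (- y) <= 1.
  move=> y0; rewrite expRN ler_pdivrMr ?expR_gt0// mul1r.
  by apply: le_trans (expR_ge1Dx y); lra.
split.
  have := h (z / 2) ltac:(lra).
  rewrite (_ : - (z / 2) = - (1/2) * z); last by lra.
  by lra.
have h4 := h (z / 4) ltac:(lra).
rewrite (_ : - (1/2) * z = - (z/4) + - (z/4)); last by lra.
rewrite expRD.
have := expR_ge0 (- (z / 4)).
move: h4; set e := expR _ => h4 e0.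
have -> : z ^+ 2 * (e * e) = 16 * (z / 4 * e) ^+ 2 by field.
have : (z / 4 * e) ^+ 2 <= 1 by rewrite expr_le1// mulr_ge0//; lra.
by lra.
Qed.

End OneVariable.

(** * The test functions *)

Section Gaussian.
Variables (R : realType) (a : R).
Hypothesis a0 : 0 <= a.
Implicit Types x y d t : R.

(** Its expectation is the Laplace transform of a squared Euclidean norm. The
    parameter [a] is kept because the argument differentiates in it. *)
Definition gauss x y : R := expR (- (1/2) * (a * (x ^+ 2 + y ^+ 2))).

Lemma gauss_gt0 x y : 0 < gauss x y. Proof. exact: expR_gt0. Qed.

Lemma gauss_le1 x y : gauss x y <= 1.
Proof.
rewrite /gauss -expR0 ler_expR mulNr oppr_le0.
by rewrite !mulr_ge0// addr_ge0// sqr_ge0.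
Qed.

Lemma gaussC x y : gauss x y = gauss y x.
Proof. by rewrite /gauss [x ^+ 2 + _]addrC. Qed.

Lemma gauss_decay x y :
  a * (x ^+ 2 + y ^+ 2) * gauss x y <= 2 /\
  (a * (x ^+ 2 + y ^+ 2)) ^+ 2 * gauss x y <= 16.
Proof.
by apply: expR_decay; rewrite mulr_ge0// addr_ge0// sqr_ge0.
Qed.

Lemma is_derive_gauss x y d1 d2 t :
  is_derive t 1 (fun s : R => gauss (x + s * d1) (y + s * d2))
   (- a * ((x + t * d1) * d1 + (y + t * d2) * d2) *
     gauss (x + t * d1) (y + t * d2)).
Proof.
have dx := is_derive_aff x d1 t; have dy := is_derive_aff y d2 t.
have dq := is_derive_fadd (is_derive_fmul dx dx) (is_derive_fmul dy dy).
have dl := is_derive_fmul (is_derive_fcst (- (1/2)) t)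
  (is_derive_fmul (is_derive_fcst a t) dq).
by apply: is_derive_eq (is_derive_fexp dl) _; rewrite /= /gauss !expr2; field.
Qed.

(** The second derivatives are bounded because the exponential absorbs the
    factor [a * (x ^+ 2 + y ^+ 2)] that they produce. *)
Lemma gauss_taylor x y d1 d2 :
  `|gauss (x + d1) (y + d2) - gauss x y + a * (x * d1 + y * d2) * gauss x y|
    <= 3 * a * (d1 ^+ 2 + d2 ^+ 2).
Proof.
pose u (t : R) := x + t * d1; pose v (t : R) := y + t * d2.
pose g1 t := - a * (u t * d1 + v t * d2) * gauss (u t) (v t).
pose g2 t := (a ^+ 2 * (u t * d1 + v t * d2) ^+ 2 - a * (d1 ^+ 2 + d2 ^+ 2))
   * gauss (u t) (v t).
have := @taylor2_le R (fun t => gauss (u t) (v t)) g1 g2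
  (3 * a * (d1 ^+ 2 + d2 ^+ 2)).
rewrite /g1 /u /v !mul1r !mul0r !addr0 => h.
rewrite (_ : _ - _ + _ = gauss (x + d1) (y + d2) - gauss x y -
  - a * (x * d1 + y * d2) * gauss x y); last by ring.
apply: h => t.
- exact: is_derive_gauss.
- have dx := is_derive_aff x d1 t; have dy := is_derive_aff y d2 t.
  have dl := is_derive_fadd (is_derive_fmul dx (is_derive_fcst d1 t))
     (is_derive_fmul dy (is_derive_fcst d2 t)).
  have dm := is_derive_fmul (is_derive_fmul (is_derive_fcst (- a) t) dl)
    (is_derive_gauss x y d1 d2 t).
  by apply: is_derive_eq dm _; rewrite /g2 /u /v /=; ring.
- rewrite /g2; have [h1 _] := gauss_decay (u t) (v t).
  have g0 := gauss_gt0 (u t) (v t); have g1' := gauss_le1 (u t) (v t).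
  move: h1 g0 g1'; set G := gauss _ _; move: (u t) (v t) => U V h1 G0 G1.
  have cs : (U * d1 + V * d2) ^+ 2 <= (U ^+ 2 + V ^+ 2) * (d1 ^+ 2 + d2 ^+ 2).
    by have := sqr_ge0 (U * d2 - V * d1); nra.
  have D0 : 0 <= d1 ^+ 2 + d2 ^+ 2 by rewrite addr_ge0// sqr_ge0.
  clearbody G; clear g1 g2 u v.
  have aG : 0 <= a * G by rewrite mulr_ge0// ltW.
  have aaG : 0 <= a * (a * G) by rewrite mulr_ge0.
  have h2 := ler_wpM2l aaG cs.
  have h3 := sqr_ge0 (U * d1 + V * d2).
  have h4 := ler_wpM2r (mulr_ge0 a0 D0) h1.
  have h5 := mulr_ge0 aaG h3.
  have h6 := ler_wpM2l (mulr_ge0 a0 D0) G1.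
  have h7 := mulr_ge0 (mulr_ge0 a0 D0) (ltW G0).
  rewrite ler_norml; apply/andP; split; nra.
Qed.

(** The same for the function to which integration by parts is applied; here
    the second derivative is of degree three in the variables. *)
Lemma gauss_mul_taylor x y d1 d2 :
  `|(x + d1) * gauss (x + d1) (y + d2) - x * gauss x y
    - (d1 * ((1 - a * x ^+ 2) * gauss x y) - d2 * (a * x * y * gauss x y))|
    <= (11 + 3 * a) * (d1 ^+ 2 + d2 ^+ 2).
Proof.
pose u (t : R) := x + t * d1; pose v (t : R) := y + t * d2.
pose w t := u t * d1 + v t * d2.
pose D := d1 ^+ 2 + d2 ^+ 2.
pose g1 t := (d1 - a * u t * w t) * gauss (u t) (v t).
pose g2 t := (a * (a * u t * w t ^+ 2 - 2 * d1 * w t - u t * D))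
   * gauss (u t) (v t).
have := @taylor2_le R (fun t => u t * gauss (u t) (v t)) g1 g2
  ((11 + 3 * a) * D).
rewrite /g1 /w /u /v !mul1r !mul0r !addr0 => h.
rewrite (_ : _ - _ - _ = (x + d1) * gauss (x + d1) (y + d2) - x * gauss x y -
  (d1 - a * x * (x * d1 + y * d2)) * gauss x y); last by ring.
apply: h => t.
- have dg := is_derive_fmul (is_derive_aff x d1 t) (is_derive_gauss x y d1 d2 t).
  by apply: is_derive_eq dg _; rewrite /=; ring.
- have dx := is_derive_aff x d1 t; have dy := is_derive_aff y d2 t.
  have dl := is_derive_fadd (is_derive_fmul dx (is_derive_fcst d1 t))
     (is_derive_fmul dy (is_derive_fcst d2 t)).
  have dm := is_derive_fmul (is_derive_fadd (is_derive_fcst d1 t)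
      (is_derive_fopp (is_derive_fmul (is_derive_fmul (is_derive_fcst a t) dx) dl)))
    (is_derive_gauss x y d1 d2 t).
  by apply: is_derive_eq dm _; rewrite /g2 /w /u /v /D /=; ring.
- rewrite /g2 /w.
  have [h1 h2] := gauss_decay (u t) (v t).
  have g0 := gauss_gt0 (u t) (v t); have g1' := gauss_le1 (u t) (v t).
  move: h1 h2 g0 g1'; set G := gauss _ _; move: (u t) (v t) => U V h1 h2 G0 G1.
  clearbody G; clear g1 g2 u v w.
  have D0 : 0 <= D by rewrite addr_ge0// sqr_ge0.
  set W := U * d1 + V * d2.
  have cs : W ^+ 2 <= (U ^+ 2 + V ^+ 2) * D.
    by rewrite /W /D; have := sqr_ge0 (U * d2 - V * d1); nra.
  clearbody W; pose r := U ^+ 2 + V ^+ 2.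
  rewrite -/r in cs h1 h2.
  have r0 : 0 <= r by rewrite addr_ge0// sqr_ge0.
  have U1 : `|U| <= (1 + r) / 2.
    have := sqr_ge0 (1 - `|U|); rewrite sqrrB real_normK ?num_real//.
    by have := sqr_ge0 V; rewrite /r; lra.
  have aG : 0 <= a * G by rewrite mulr_ge0// ltW.
  (* each of the three terms is at most D times (1 + r) up to a constant *)
  have b1 : `|a * U * W ^+ 2| <= a * ((1 + r) / 2 * (r * D)).
    rewrite -mulrA normrM (ger0_norm a0) ler_wpM2l// normrM.
    by rewrite ler_pM// (ger0_norm (sqr_ge0 _)).
  have b2 : `|2 * d1 * W| <= 2 * ((1 + r) / 2 * D).
    have : `|d1 * W| <= (1 + r) / 2 * D.
      have dD : d1 ^+ 2 <= D by rewrite /D lerDl sqr_ge0.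
      have := sqr_ge0 (d1 + W); have := sqr_ge0 (d1 - W).
      rewrite sqrrB sqrrD ler_norml.
      move=> h3 h4; apply/andP; split; lra.
    move/(ler_wpM2l (ler0n R 2)).
    by rewrite -[2 * d1 * W]mulrA [`|2 * _|]normrM (ger0_norm (ler0n R 2)).
  have b3 : `|U * D| <= (1 + r) / 2 * D.
    by rewrite normrM (ger0_norm D0) ler_wpM2r.
  rewrite normrM (ger0_norm (ltW G0)) normrM (ger0_norm a0).
  have b4 : `|a * U * W ^+ 2 - 2 * d1 * W - U * D| <=
     a * ((1 + r) / 2 * (r * D)) + 3 * ((1 + r) / 2 * D).
    apply: le_trans (ler_normB _ _) _; apply: le_trans (lerD (ler_normB _ _) b3) _.
    by lra.
  rewrite -mulrAC; apply: le_trans (ler_wpM2l aG b4) _.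
  rewrite (_ : a * G * _ = D * (1/2 * (a * (a * r * G)) + 1/2 * ((a * r) ^+ 2 * G)
    + 3/2 * (a * G) + 3/2 * (a * r * G))); last by field.
  rewrite [leRHS]mulrC; apply: ler_wpM2l => //.
  have := ler_wpM2l a0 h1; have := ler_wpM2l a0 G1.
  by lra.
Qed.
End Gaussian.

(** * Counting in a graph *)

Section GraphCounting.
Variables (R : realType) (N : nat) (G : sgraph N).
Implicit Types (i j k l : 'I_N) (A : {set 'I_N}).

Definition adjR i j : R := (G i j)%:R.
Definition degR i : R := \sum_j adjR i j.
Definition codeg j k : R := \sum_i adjR i j * adjR i k.
Definition nedges : R := #|edges G|%:R.

Lemma adjRC i j : adjR i j = adjR j i.
Proof. by rewrite /adjR adj_sym. Qed.

Lemma adjRii i : adjR i i = 0.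
Proof. by rewrite /adjR adj_irrefl. Qed.

Lemma adjR_ge0 i j : 0 <= adjR i j. Proof. exact: ler0n. Qed.

Lemma adjR_sq i j : adjR i j ^+ 2 = adjR i j.
Proof. by rewrite /adjR; case: (G i j); rewrite ?expr1n ?expr0n. Qed.

Lemma degR_ge0 i : 0 <= degR i.
Proof. by apply: sumr_ge0 => j _; exact: adjR_ge0. Qed.

(** An edge is an unordered pair and the double sum meets it in both
    orders. *)
Lemma sum_edges (h : {set 'I_N} -> R) :
  \sum_i \sum_j adjR i j * h [set i; j]%SET = 2 * \sum_(e in edges G) h e.
Proof.
rewrite pair_bigA /=.
transitivity (\sum_(a | G a.1 a.2) h [set a.1; a.2]%SET).
  rewrite [RHS]big_mkcond; apply: eq_bigr => -[i j] _ /=.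
  by rewrite /adjR; case: (G i j); rewrite ?mul1r ?mul0r.
rewrite (partition_big (fun a => [set a.1; a.2]%SET) (mem (edges G))) /=; last first.
  by move=> a Ga; apply/imsetP; exists a; rewrite ?inE.
rewrite mulr_sumr; apply: eq_bigr => e /imsetP[[i j]]; rewrite inE /= => Gij ->.
transitivity (\sum_(a in [set (i, j); (j, i)]%SET) h [set i; j]%SET).
  apply: eq_big => [[a b]|[a b] /andP[_ /eqP ->]//].
  rewrite !inE /= !xpair_eqE; apply/idP/idP.
    case/andP=> Gab /eqP ab.
    have : a \in [set i; j]%SET by rewrite -ab !inE eqxx.
    have : b \in [set i; j]%SET by rewrite -ab !inE eqxx orbT.
    have nab : a != b by apply: contraTneq Gab => ->; rewrite adj_irrefl.
    rewrite !inE => /orP[]/eqP ? /orP[]/eqP ?; subst; rewrite ?eqxx ?orbT//;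
      by rewrite eqxx in nab.
  case/orP=> /andP[/eqP-> /eqP->]; first by rewrite Gij eqxx.
  by rewrite adj_sym Gij /= finset.setUC.
have nij : i != j by apply: contraTneq Gij => ->; rewrite adj_irrefl.
by rewrite sumr_const cards2 xpair_eqE (negbTE nij) mulr_natl.
Qed.

Lemma sum_degR : \sum_i degR i = 2 * nedges.
Proof.
rewrite /nedges -sum1_card natr_sum -(sum_edges (fun=> 1)).
by apply: eq_bigr => i _; apply: eq_bigr => j _; rewrite mulr1.
Qed.

Lemma card_edges (P : pred {set 'I_N}) :
  2 * #|[set e in edges G | P e]|%:R =
  \sum_i \sum_j adjR i j * (P [set i; j]%SET)%:R.
Proof.
rewrite (sum_edges (fun e => (P e)%:R)) -sum1_card natr_sum; congr (_ * _).
under eq_bigl do rewrite inE.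
by rewrite big_mkcondr; apply: eq_bigr => e _; case: (P e).
Qed.

Lemma edges_atE i : #|edges_at G i|%:R = degR i.
Proof.
have := card_edges (fun e => i \in e).
have -> : \sum_j \sum_k adjR j k * (i \in [set j; k]%SET)%:R = 2 * degR i.
  transitivity (\sum_j \sum_k ((j == i)%:R * adjR i k + (k == i)%:R * adjR i j)).
    apply: eq_bigr => j _; apply: eq_bigr => k _; rewrite !inE ![i == _]eq_sym.
    have [->|ji] := eqVneq j i; have [->|ki] := eqVneq k i;
      rewrite ?adjRii /= ?mul0r ?mulr0 ?mulr1 ?mul1r ?addr0 ?add0r//.
    by rewrite adjRC.
  under eq_bigr do rewrite big_split /=.
  rewrite big_split /=.
  have e1 : \sum_j \sum_k (j == i)%:R * adjR i k = degR i.
    rewrite (bigD1 i)//= [X in _ + X]big1 ?addr0; last first.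
      by move=> j /negbTE ji; apply: big1 => k _; rewrite ji mul0r.
    by apply: eq_bigr => k _; rewrite eqxx mul1r.
  rewrite e1 [X in _ + X](_ : _ = degR i); first by ring.
  by rewrite -[RHS]e1 exchange_big.
by move=> h; apply: (@mulfI R 2); rewrite ?pnatr_eq0// -h.
Qed.

Lemma edge_countE (j : 'I_2) A :
  2 * edge_count R G j A = \sum_i \sum_k adjR i k *
     ((i \in sample A j)%:R * (k \in sample A j)%:R).
Proof.
rewrite card_edges; apply: eq_bigr => i _; apply: eq_bigr => k _.
by rewrite finset.subUset !finset.sub1set -natrM mulnb.
Qed.

(** The four nodes of a closed walk belong to the square that it runs through,
    so a square comes from at most [4 ^ 4] walks. *)
Lemma card_square_tuples :
  (#|[pred t : 'I_N * 'I_N * ('I_N * 'I_N) |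
     [&& uniq [:: t.1.1; t.1.2; t.2.1; t.2.2], G t.1.1 t.1.2, G t.1.2 t.2.1,
      G t.2.1 t.2.2 & G t.2.2 t.1.1]]| <= 256 * #|squares G|)%N.
Proof.
set T := [pred t | _].
pose C (t : 'I_N * 'I_N * ('I_N * 'I_N)) : {set {set 'I_N}} :=
  [set [set t.1.1; t.1.2]; [set t.1.2; t.2.1];
       [set t.2.1; t.2.2]; [set t.2.2; t.1.1]]%SET.
rewrite -[X in (X <= _)%N]sum1_card (partition_big C (mem (squares G))) /=; last first.
  move=> [[a b] [c d]] /and5P[/= u ab bc cd da]; rewrite inE; apply/andP; split.
    apply/fintype.subsetP => e; rewrite !inE.
    by case/orP=> [/orP[/orP[]|]|] /eqP ->; apply/imsetP;
      [exists (a, b)|exists (b, c)|exists (c, d)|exists (d, a)]; rewrite ?inE.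
  do 4![apply/existsP; eexists]; apply/andP; split; first exact: u.
  by [].
rewrite mulnC -sum_nat_const; apply: leq_sum => D.
rewrite inE => /andP[_ /existsP[a /existsP[b /existsP[c /existsP[d /andP[_ /eqP eD]]]]]].
rewrite sum1_card.
pose S := [set a; b; c; d]%SET.
apply: (@leq_trans #|finset.setX (finset.setX S S) (finset.setX S S)|).
  apply/subset_leq_card/fintype.subsetP => -[[a' b'] [c' d']].
  rewrite inE /= => /andP[_ /eqP eC].
  have covS e i : e \in D -> i \in e -> i \in S.
    rewrite eD !inE => /orP[/orP[/orP[]|]|] /eqP ->; rewrite !inE;
    by case/orP => /eqP->; rewrite eqxx ?orbT.
  have h1 : [set a'; b']%SET \in D by rewrite -eC !inE eqxx.
  have h2 : [set c'; d']%SET \in D by rewrite -eC !inE eqxx ?orbT.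
  have ha : a' \in S by apply: covS h1 _; rewrite !inE eqxx.
  have hb : b' \in S by apply: covS h1 _; rewrite !inE eqxx orbT.
  have hc : c' \in S by apply: covS h2 _; rewrite !inE eqxx.
  have hd : d' \in S by apply: covS h2 _; rewrite !inE eqxx orbT.
  by rewrite !finset.in_setX /= ha hb hc hd.
have S4 : (#|S| <= 4)%N.
  have U1 (B : {set 'I_N}) (x : 'I_N) n :
      (#|B| <= n -> #|B :|: [set x]%SET| <= n.+1)%N.
    move=> Bn; apply: leq_trans (leq_of_leqif (leq_card_setU _ _)) _.
    by rewrite cards1 addn1.
  by rewrite /S !U1// cards1.
by rewrite !cardsX (@leq_mul _ _ 16 16)// (@leq_mul _ _ 4 4).
Qed.

(** A squared codegree counts pairs of common neighbours. Two distinct common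
    neighbours close up to a square; a repeated one gives a path of length two
    through it, and such paths are counted by the squared degrees. *)
Lemma sum_codeg_sq :
  \sum_j \sum_(k | k != j) codeg j k ^+ 2 <=
  256 * #|squares G|%:R + \sum_i degR i ^+ 2.
Proof.
have -> : \sum_j \sum_(k | k != j) codeg j k ^+ 2 =
  \sum_j \sum_(k | k != j) \sum_i \sum_l
    (adjR i j * adjR i k) * (adjR l j * adjR l k).
  apply: eq_bigr => j _; apply: eq_bigr => k _.
  by rewrite expr2 mulr_suml; apply: eq_bigr => i _; rewrite mulr_sumr.
apply: (@le_trans _ _ (\sum_j \sum_k \sum_i \sum_l
   (([&& uniq [:: i; j; l; k], G i j, G j l, G l k & G k i])%:R +
    (i == l)%:R * (adjR i j * adjR i k)))).
  apply: ler_sum => j _; rewrite big_mkcond; apply: ler_sum => k _ /=.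
  have pos : 0 <= \sum_i \sum_l (([&& uniq [:: i; j; l; k], G i j, G j l, G l k & G k i])%:R +
    (i == l)%:R * (adjR i j * adjR i k)).
    apply: sumr_ge0 => i _; apply: sumr_ge0 => l _.
    by rewrite addr_ge0 ?mulr_ge0 ?ler0n ?adjR_ge0.
  case: ifPn => // kj; apply: ler_sum => i _; apply: ler_sum => l _.
  have [<-|il] := eqVneq i l.
    rewrite mul1r -[leLHS]expr2 exprMn !adjR_sq lerDr ler0n //.
  rewrite mul0r addr0 /adjR (adj_sym G j l) (adj_sym G k i).
  case Gij : (G i j); rewrite ?mul0r ?ler0n//.
  case Gik : (G i k); rewrite ?mul0r ?mulr0 ?mul0r ?ler0n//.
  case Glj : (G l j); rewrite ?mul0r ?mulr0 ?mul0r ?ler0n//.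
  case Glk : (G l k); rewrite ?mul0r ?mulr0 ?mul0r ?ler0n//.
  have neq x y : G x y -> x != y.
    by move=> Gxy; apply: contraTneq Gxy => ->; rewrite adj_irrefl.
  rewrite !mulr1 /= !inE !negb_or il (neq _ _ Gij) (neq _ _ Gik) (neq _ _ Glk).
  by rewrite eq_sym (neq _ _ Glj) eq_sym kj.
under eq_bigr do under eq_bigr do under eq_bigr do rewrite big_split /=.
under eq_bigr do under eq_bigr do rewrite big_split /=.
under eq_bigr do rewrite big_split /=.
rewrite big_split /=; apply: lerD; last first.
  rewrite (_ : \sum_j _ = \sum_i \sum_j \sum_k adjR i j * adjR i k).
    apply: ler_sum => i _; rewrite expr2 mulr_suml; apply: ler_sum => j _.
    by rewrite mulr_sumr.
  rewrite exchange_big /=.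
  transitivity (\sum_k \sum_i \sum_j adjR i j * adjR i k).
    apply: eq_bigr => k _; rewrite exchange_big /=; apply: eq_bigr => i _.
    apply: eq_bigr => j _; rewrite -mulr_suml (bigD1 i)//= [X in _ + X]big1 ?addr0 ?eqxx ?mul1r//.
    by move=> l li; rewrite eq_sym (negbTE li).
  rewrite exchange_big; apply: eq_bigr => i _; exact: exchange_big.
rewrite -natrM; apply: le_trans (_ : _ <= _) (_ : (#|_|)%:R <= _); last first.
  by rewrite ler_nat; exact: card_square_tuples.
rewrite -sum1_card natr_sum [leRHS]big_mkcond /=.
rewrite -(pair_bigA _ (fun ij lk => if [&& uniq [:: ij.1; ij.2; lk.1; lk.2],
  G ij.1 ij.2, G ij.2 lk.1, G lk.1 lk.2 & G lk.2 ij.1] then 1 else 0)) /=.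
rewrite -(pair_bigA _ (fun i j => \sum_lk if [&& uniq [:: i; j; lk.1; lk.2],
  G i j, G j lk.1, G lk.1 lk.2 & G lk.2 i] then 1 else 0)) /=.
rewrite [leRHS]exchange_big /=; apply: ler_sum => j _.
rewrite exchange_big /=; apply: ler_sum => i _.
rewrite -(pair_bigA _ (fun l k => if [&& uniq [:: i; j; l; k],
  G i j, G j l, G l k & G k i] then 1 else 0)) /=.
rewrite exchange_big /=; apply: ler_sum => l _; apply: ler_sum => k _.
by case: ifP.
Qed.

End GraphCounting.

(** * The quadratic and the linear form of the centred labels *)

Section Forms.
Variables (R : realType) (N : nat) (G : sgraph N) (p : R) (z : 'I_N -> R).
Implicit Types (i j k : 'I_N) (A : {set 'I_N}).
Local Notation g := (adjR R G).
Local Notation x := (xi p).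

(** Among the label sets of a given size the two edge counts are affine
    functions of the forms [Qform] and [Lform]; see [edge_count0] and
    [edge_count1]. The factor 1/2 makes [Qform] a sum over unoriented
    edges. *)
Definition Xnb i A : R := \sum_j g i j * x j A.
Definition Qform A : R := 1/2 * \sum_i x i A * Xnb i A.
Definition Lform A : R := \sum_i z i * x i A.

(** The parts of the two forms that do not involve the label of [i]. *)
Definition Qrest i A : R :=
  1/2 * \sum_(j | j != i) x j A * \sum_(k | k != i) g j k * x k A.
Definition Lrest i A : R := \sum_(j | j != i) z j * x j A.

Lemma Qform_split i A : Qform A = Qrest i A + x i A * Xnb i A.
Proof.
rewrite /Qform /Qrest (bigD1 i)//= [in RHS](_ : \sum_(j | _) _ =
  \sum_(j | j != i) x j A * Xnb j A - x i A * Xnb i A).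
  by field.
rewrite [in RHS]/Xnb [\sum_j g i j * _](bigD1 i)//= adjRii mul0r add0r.
rewrite mulr_sumr -sumrB; apply: eq_bigr => j ji.
by rewrite /Xnb [in RHS](bigD1 i)//= adjRC; ring.
Qed.

Lemma Lform_split i A : Lform A = Lrest i A + x i A * z i.
Proof. by rewrite /Lform (bigD1 i)//= addrC [x i A * _]mulrC. Qed.

Lemma free_Xnb i : free_of i (Xnb i).
Proof.
move=> A; apply: eq_bigr => j _.
have [<-|ij] := eqVneq i j; first by rewrite adjRii !mul0r.
by rewrite free_of_xi.
Qed.

Lemma free_Qrest i : free_of i (Qrest i).
Proof.
move=> A; rewrite /Qrest; congr (_ * _); apply: eq_bigr => j ji.
rewrite free_of_xi 1?eq_sym//; congr (_ * _); apply: eq_bigr => k ki.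
by rewrite free_of_xi 1?eq_sym.
Qed.

Lemma free_Lrest i : free_of i (Lrest i).
Proof. by move=> A; apply: eq_bigr => j ji; rewrite free_of_xi 1?eq_sym. Qed.

Lemma xiU1 i A : i \notin A -> x i (i |: A) = x i A + 1.
Proof. by move=> iA; rewrite /xi finset.setU11 (negbTE iA) /=; ring. Qed.

Lemma free_ofU1 i (f : {set 'I_N} -> R) A :
  free_of i f -> i \notin A -> f (i |: A) = f A.
Proof.
move=> fi iA; rewrite fi; congr f; apply/finset.setDidPl.
by rewrite disjoint_sym disjoints1.
Qed.

Lemma QformU1 i A : i \notin A -> Qform (i |: A) = Qform A + Xnb i A.
Proof.
move=> iA; rewrite !(Qform_split i) xiU1// (free_ofU1 (@free_Qrest i))//.
by rewrite (free_ofU1 (@free_Xnb i))//; ring.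
Qed.

Lemma LformU1 i A : i \notin A -> Lform (i |: A) = Lform A + z i.
Proof.
move=> iA; rewrite !(Lform_split i) xiU1// (free_ofU1 (@free_Lrest i))//.
by ring.
Qed.

(** These sums and those of the squares are the conditional covariances of
    Stein's method. Removing the squares of labels leaves multilinear forms,
    whose second moments are read off their coefficients. *)
Lemma sum_zX A : \sum_i z i * (x i A ^+ 2 * Xnb i A) =
  p * (1 - p) * (\sum_j (\sum_i g j i * z i) * x j A)
  + (1 - 2 * p) * \sum_i \sum_j z i * g i j * (x i A * x j A).
Proof.
have -> : \sum_j (\sum_i g j i * z i) * x j A = \sum_i z i * Xnb i A.
  transitivity (\sum_j \sum_i g j i * z i * x j A).
    by apply: eq_bigr => j _; rewrite mulr_suml.
  rewrite exchange_big /=; apply: eq_bigr => i _; rewrite mulr_sumr.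
  by apply: eq_bigr => j _; rewrite adjRC; ring.
rewrite !mulr_sumr -big_split /=; apply: eq_bigr => i _.
rewrite xi_sq (_ : \sum_j _ = z i * x i A * Xnb i A); first by ring.
by rewrite mulr_sumr; apply: eq_bigr => j _; ring.
Qed.

Definition cherries : pred ('I_N * 'I_N * 'I_N) :=
  [pred t | [&& G t.1.1 t.1.2, G t.1.1 t.2 & t.1.2 != t.2]].

Lemma cherries_sum (f : 'I_N -> 'I_N -> 'I_N -> R) :
  \sum_(t | cherries t) f t.1.1 t.1.2 t.2 =
  \sum_i \sum_j \sum_(k | k != j) g i j * g i k * f i j k.
Proof.
rewrite big_mkcond pair_bigA /=.
rewrite -(pair_bigA _ (fun ij k => if cherries (ij, k)
  then f ij.1 ij.2 k else 0)) /=.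
apply: eq_bigr => -[i j] _ /=; rewrite [RHS]big_mkcond.
apply: eq_bigr => k _; rewrite /cherries /= /adjR [k == j]eq_sym.
case: (G i j); case: (G i k); case: (_ != _) => //=;
  by rewrite ?mul1r ?mul0r ?mulr0.
Qed.

(** The square of [Xnb i] splits into a diagonal part, which is linear, and an
    off-diagonal part, whose coefficients are the codegrees; multiplying by the
    remaining [xi i] produces the cubic form over the paths of length two. *)
Lemma sum_x2X2 A : \sum_i x i A ^+ 2 * Xnb i A ^+ 2 =
  (p * (1 - p)) ^+ 2 * \sum_i degR R G i
  + 2 * (p * (1 - p)) * (1 - 2 * p) * (\sum_i degR R G i * x i A)
  + p * (1 - p) * (\sum_j \sum_k (k != j)%:R * codeg R G j k * (x j A * x k A))
  + (1 - 2 * p) ^+ 2 * (\sum_i \sum_j g i j * (x i A * x j A))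
  + (1 - 2 * p) * \sum_(t | cherries t) x t.1.1 A * (x t.1.2 A * x t.2 A).
Proof.
pose T i : R := \sum_j g i j * x j A ^+ 2.
pose O i : R := \sum_j \sum_(k | k != j) g i j * g i k * (x j A * x k A).
have X2 i : Xnb i A ^+ 2 = T i + O i.
  rewrite expr2 mulr_suml -big_split /=; apply: eq_bigr => j _.
  rewrite mulr_sumr (bigD1 j)//=; congr (_ + _).
    by rewrite -{3}(adjR_sq R G i j); ring.
  by apply: eq_bigr => k _; ring.
have Ti i : T i = p * (1 - p) * degR R G i + (1 - 2 * p) * Xnb i A.
  rewrite /T /degR !mulr_sumr -big_split /=; apply: eq_bigr => j _.
  by rewrite xi_sq; ring.
have sT : \sum_i T i = p * (1 - p) * (\sum_i degR R G i) +
    (1 - 2 * p) * (\sum_i degR R G i * x i A).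
  under eq_bigr do rewrite Ti; rewrite big_split /= -!mulr_sumr.
  congr (_ + _ * _); rewrite exchange_big /=; apply: eq_bigr => j _.
  by rewrite -mulr_suml; congr (_ * _); apply: eq_bigr => i _; exact: adjRC.
have sO : \sum_i O i =
    \sum_j \sum_k (k != j)%:R * codeg R G j k * (x j A * x k A).
  rewrite exchange_big /=; apply: eq_bigr => j _; rewrite exchange_big /=.
  rewrite big_mkcond; apply: eq_bigr => k _; case: (_ != _) => /=.
    rewrite mul1r mulr_suml; apply: eq_bigr => i _.
    by rewrite (adjRC R G i j) (adjRC R G i k) ![g _ i]adjRC; ring.
  by rewrite !mul0r.
have sxT : \sum_i x i A * T i = p * (1 - p) * (\sum_i degR R G i * x i A)
    + (1 - 2 * p) * (\sum_i \sum_j g i j * (x i A * x j A)).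
  rewrite !mulr_sumr -big_split /=; apply: eq_bigr => i _.
  rewrite Ti (_ : \sum_j _ = x i A * Xnb i A); first by ring.
  by rewrite mulr_sumr; apply: eq_bigr => j _; ring.
have sxO : \sum_i x i A * O i =
    \sum_(t | cherries t) x t.1.1 A * (x t.1.2 A * x t.2 A).
  rewrite (cherries_sum (fun i j k => x i A * (x j A * x k A))).
  apply: eq_bigr => i _; rewrite mulr_sumr; apply: eq_bigr => j _.
  by rewrite mulr_sumr; apply: eq_bigr => k _; ring.
transitivity (p * (1 - p) * (\sum_i T i + \sum_i O i)
   + (1 - 2 * p) * (\sum_i x i A * T i + \sum_i x i A * O i)).
  rewrite -!big_split /= !mulr_sumr -big_split /=; apply: eq_bigr => i _.
  by rewrite xi_sq X2; ring.
by rewrite sT sO sxT sxO; ring.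
Qed.

Lemma card_cherries : (#|cherries|)%:R <= \sum_i degR R G i ^+ 2 :> R.
Proof.
rewrite -sum1_card natr_sum (cherries_sum (fun _ _ _ => 1)).
apply: ler_sum => i _; rewrite expr2 mulr_suml; apply: ler_sum => j _.
rewrite mulr_sumr big_mkcond; apply: ler_sum => k _.
by case: ifP => _; rewrite ?mulr1// mulr_ge0 ?adjR_ge0.
Qed.

End Forms.

(** * Consequences of the conditions on the graph *)

(** The hypotheses on the graph at one fixed size. Here [s], [v] and [tau] are
    the square roots of the number of edges, of the variance of the degrees and
    of [p * (1 - p)]; [eta] is the small parameter that the little-o conditions
    provide, and [B] stays fixed. The errors below are bounded by
    a power of [B] times [eta]. *)
Record balanced (R : realType) (N : nat) (G : sgraph N) (p : R)
    (z : 'I_N -> R) (s v tau B eta : R) : Prop := Balanced {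
  bal_p : 0 <= p <= 1;
  bal_s : 0 < s;
  bal_v : 0 < v;
  bal_tau : 0 < tau;
  bal_B : tau^-1 <= B;
  bal_eta : 0 < eta <= 1;
  bal_tau2 : tau ^+ 2 = p * (1 - p);
  bal_s2 : s ^+ 2 = nedges R G;
  bal_z : forall i, z i = degR R G i - 2 * s ^+ 2 / N%:R;
  bal_v2 : v ^+ 2 = \sum_i z i ^+ 2;
  bal_deg : \sum_i degR R G i ^+ 2 <= eta ^+ 2 * s ^+ 3;
  bal_sq : #|squares G|%:R <= eta ^+ 2 * s ^+ 4;
  bal_cube : \sum_i `|z i| ^+ 3 <= eta ^+ 2 * v ^+ 3;
  bal_nbr : \sum_j (\sum_i adjR R G j i * z i) ^+ 2 <=
            eta ^+ 2 * s ^+ 2 * v ^+ 2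
}.

Section Balanced.
Variables (R : realType) (N : nat) (G : sgraph N) (p : R) (z : 'I_N -> R).
Variables (s v tau B eta : R).
Hypothesis bal : balanced G p z s v tau B eta.
Implicit Types (i j k : 'I_N) (A : {set 'I_N}).
Local Notation d := (degR R G).

Let p01 := bal_p bal.
Let s0 := bal_s bal.
Let v0 := bal_v bal.
Let tau0 := bal_tau bal.
Let eta0 : 0 < eta. Proof. by case/andP: (bal_eta bal). Qed.
Let eta1 : eta <= 1. Proof. by case/andP: (bal_eta bal). Qed.

Lemma degR_le_sq i : d i <= d i ^+ 2.
Proof.
rewrite -edges_atE -natrX ler_nat.
by case: #|_| => // n; rewrite expnS expn1 leq_pmulr.
Qed.

(** Degrees are integers, so that their sum is at most the sum of their
    squares. *)
Lemma bal_sbig : 2 <= eta ^+ 2 * s.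
Proof.
rewrite -(ler_pM2r (exprn_gt0 2 s0)) -mulrA -exprS.
apply: le_trans (bal_deg bal).
rewrite (bal_s2 bal) -sum_degR; apply: ler_sum => i _; exact: degR_le_sq.
Qed.

Lemma bal_s2le : 2 <= s.
Proof.
have := bal_sbig; have : eta ^+ 2 <= 1 by rewrite expr_le1// ltW.
by move=> e1; have := s0; nra.
Qed.

Lemma bal_N0 : 0 < N%:R :> R.
Proof.
rewrite ltr0n lt0n; apply/negP => /eqP N0.
suff : s ^+ 2 = 0 by apply/eqP; rewrite gt_eqF// exprn_gt0.
rewrite (bal_s2 bal); apply/eqP; rewrite -(mulrI_eq0 _ (mulfI (_ : 2 != 0 :> R))) ?pnatr_eq0//.
rewrite -sum_degR; apply/eqP; apply: big1 => i _.
by have := ltn_ord i; rewrite [X in (_ < X)%N]N0.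
Qed.

Lemma sum_z : \sum_i z i = 0.
Proof.
under eq_bigr do rewrite (bal_z bal).
rewrite sumrB sum_degR -(bal_s2 bal) sumr_const card_ord -[_ *+ N]mulr_natr.
by rewrite divfK ?subrr// gt_eqF// bal_N0.
Qed.

Lemma sum_deg_z : \sum_i d i * z i = v ^+ 2.
Proof.
rewrite (bal_v2 bal).
transitivity (\sum_i (z i ^+ 2 + 2 * s ^+ 2 / N%:R * z i)).
  by apply: eq_bigr => i _; rewrite (bal_z bal); ring.
by rewrite big_split /= -mulr_sumr sum_z mulr0 addr0.
Qed.

Lemma sum_deg_sq : \sum_i d i ^+ 2 = v ^+ 2 + 4 * s ^+ 4 / N%:R.
Proof.
transitivity (\sum_i (d i * z i + 2 * s ^+ 2 / N%:R * d i)).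
  by apply: eq_bigr => i _; rewrite (bal_z bal); ring.
rewrite big_split /= -mulr_sumr sum_deg_z sum_degR -(bal_s2 bal).
by field; rewrite gt_eqF// bal_N0.
Qed.

(** The squared degrees dominate the square of their mean, which forces the
    graph to be sparse. *)
Lemma bal_sN : 4 * s <= eta ^+ 2 * N%:R.
Proof.
rewrite -(ler_pM2r (exprn_gt0 3 s0)) -mulrA -exprS [leRHS]mulrAC.
rewrite -ler_pdivrMr ?bal_N0//.
apply: le_trans (bal_deg bal).
by rewrite sum_deg_sq lerDr sqr_ge0.
Qed.

Lemma bal_N8 : 8 <= N%:R :> R.
Proof.
have := bal_sN; have := bal_s2le.
have e2 : eta ^+ 2 <= 1 by rewrite expr_le1// ltW.
by have := ler_wpM2r (ler0n R N) e2; lra.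
Qed.

Lemma bal_v2le : v ^+ 2 <= eta ^+ 2 * s ^+ 3.
Proof.
apply: le_trans (bal_deg bal); rewrite sum_deg_sq lerDl.
by rewrite divr_ge0 ?ler0n// mulr_ge0// exprn_ge0// ltW.
Qed.

Lemma bal_degle i : d i <= eta ^+ 2 * s ^+ 2.
Proof.
rewrite -(@ler_pXn2r _ 2)// ?nnegrE ?degR_ge0// ?mulr_ge0 ?(ltW s0) ?(ltW eta0)//.
apply: (@le_trans _ _ (eta ^+ 2 * s ^+ 3)).
  apply: le_trans (bal_deg bal); rewrite (bigD1 i)//= lerDl.
  by apply: sumr_ge0 => j _; exact: sqr_ge0.
have -> : (eta ^+ 2 * s ^+ 2) ^+ 2 = (eta ^+ 2 * s ^+ 3) * (eta ^+ 2 * s) by ring.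
have s0' := ltW s0; have eta0' := ltW eta0.
rewrite ler_peMr ?mulr_ge0 ?sqr_ge0 ?exprn_ge0//.
by have := bal_sbig; lra.
Qed.

Lemma bal_zle i : `|z i| <= v.
Proof.
rewrite -(@ler_pXn2r _ 2)// ?nnegrE ?normr_ge0 ?(ltW v0)//.
rewrite real_normK ?num_real// (bal_v2 bal) (bigD1 i)//= lerDl.
by apply: sumr_ge0 => j _; exact: sqr_ge0.
Qed.

Lemma bal_tauhalf : tau <= 1 / 2.
Proof.
have := bal_tau2 bal; have := sqr_ge0 (p - 1/2); have := tau0; nra.
Qed.

Lemma bal_B2 : 2 <= B.
Proof.
apply: le_trans (bal_B bal).
rewrite -(ler_pM2r tau0) mulVf ?gt_eqF//; have := bal_tauhalf; lra.
Qed.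

Lemma sqr_sum4 (a b e f : R) :
  (a + b + e + f) ^+ 2 <= 4 * (a ^+ 2 + b ^+ 2 + e ^+ 2 + f ^+ 2).
Proof.
rewrite -subr_ge0 (_ : _ - _ = (a - b) ^+ 2 + (a - e) ^+ 2 + (a - f) ^+ 2 +
  ((b - e) ^+ 2 + (b - f) ^+ 2 + (e - f) ^+ 2)); last by ring.
by rewrite !addr_ge0// sqr_ge0.
Qed.

(** * Second moments under independent labels *)

Local Notation E := (fexp (bweight p)).
Local Notation x := (xi p).
Local Notation X := (Xnb G p).

Let w0 (A : {set 'I_N}) := @bweight_ge0 R N p A p01.
Let w1 := sum_bweight N p.

Lemma Xnb_norm i A : `|X i A| <= d i.
Proof.
apply: le_trans (ler_norm_sum _ _ _) _; apply: ler_sum => j _.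
rewrite normrM (ger0_norm (adjR_ge0 _ _ _ _)) ler_piMr ?adjR_ge0//.
exact: xi_norm.
Qed.

Lemma Xnb_sq i : E (fun A => X i A ^+ 2) <= d i.
Proof.
apply: le_trans (linear_sq p01 _) _; apply: ler_sum => j _.
by rewrite adjR_sq.
Qed.

Lemma Xnb_abs i : E (fun A => `|X i A|) <= eta * s.
Proof.
have h : E (fun A => X i A ^+ 2) <= 1 * (eta * s) ^+ 2.
  by rewrite mul1r exprMn; apply: le_trans (Xnb_sq i) (bal_degle i).
by have := fexp_norm_le_sq w0 w1 (mulr_gt0 eta0 s0) h; lra.
Qed.

Let c := 1 - 2 * p.
Let c1 : c ^+ 2 <= 1.
Proof. by have /andP[] := p01; rewrite /c => h1 h2; nra. Qed.
Let t1 : tau ^+ 2 <= 1.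
Proof. by have := bal_tauhalf; have := tau0; nra. Qed.

(** In the limit the three conditional covariances are those of a standard
    Gaussian vector: 1 for each of the two forms, and 0 between them. The
    fluctuation of the one of the linear form is again a linear form, controlled
    by the third moments of the centred degrees. *)
Lemma T22_sq : E (fun A =>
   ((tau * v) ^- 2 * (\sum_i z i ^+ 2 * x i A ^+ 2) - 1) ^+ 2)
  <= B ^+ 4 * eta ^+ 2.
Proof.
have e A : (tau * v) ^- 2 * (\sum_i z i ^+ 2 * x i A ^+ 2) - 1 =
   (c / (tau * v) ^+ 2) * \sum_i z i ^+ 2 * x i A.
  have -> : \sum_i z i ^+ 2 * x i A ^+ 2 =
      tau ^+ 2 * v ^+ 2 + c * \sum_i z i ^+ 2 * x i A.
    rewrite (bal_v2 bal) !mulr_sumr -big_split /=; apply: eq_bigr => i _.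
    by rewrite xi_sq -(bal_tau2 bal) -/c; ring.
  by field; rewrite !gt_eqF.
under eq_fexp => A do rewrite e exprMn.
rewrite fexpZ.
have h1 := linear_sq p01 (fun i => z i ^+ 2).
have h2 : \sum_i (z i ^+ 2) ^+ 2 <= eta ^+ 2 * v ^+ 4.
  apply: (@le_trans _ _ (\sum_i v * `|z i| ^+ 3)).
    apply: ler_sum => i _; rewrite -[z i ^+ 2]real_normK ?num_real//.
    rewrite (_ : (`|z i| ^+ 2) ^+ 2 = `|z i| * `|z i| ^+ 3); last by ring.
    by rewrite ler_wpM2r ?exprn_ge0 ?bal_zle.
  rewrite -mulr_sumr (_ : _ * v ^+ 4 = v * (eta ^+ 2 * v ^+ 3)); last by ring.
  by rewrite ler_wpM2l ?(ltW v0)// (bal_cube bal).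
apply: le_trans (ler_wpM2l _ (le_trans h1 h2)) _; first exact: sqr_ge0.
rewrite (_ : _ * (_ * v ^+ 4) = c ^+ 2 * (tau^-1 ^+ 4 * eta ^+ 2)); last first.
  by field; rewrite !gt_eqF.
apply: le_trans (_ : 1 * (tau^-1 ^+ 4 * eta ^+ 2) <= _).
  by rewrite ler_wpM2r// mulr_ge0 ?sqr_ge0// exprn_even_ge0.
rewrite mul1r ler_wpM2r ?sqr_ge0// lerXn2r ?nnegrE ?invr_ge0 ?(ltW tau0)//.
  by apply: le_trans bal_B2; rewrite ler0n.
exact: bal_B bal.
Qed.

Let Bpow n : tau^-1 ^+ n <= B ^+ n.
Proof.
rewrite lerXn2r ?nnegrE ?invr_ge0 ?(ltW tau0)//; last exact: bal_B bal.
by apply: le_trans bal_B2; rewrite ler0n.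
Qed.

Let s1 : 1 <= s. Proof. by apply: le_trans bal_s2le; rewrite ler1n. Qed.

Lemma bal_sumz2deg : \sum_i z i ^+ 2 * d i <= eta ^+ 2 * s ^+ 2 * v ^+ 2.
Proof.
rewrite (bal_v2 bal) mulr_sumr; apply: ler_sum => i _.
by rewrite mulrC ler_wpM2r ?sqr_ge0// bal_degle.
Qed.

(** The linear part is controlled by the sums of centred degrees over
    neighbourhoods, the quadratic part by the largest degree. *)
Lemma T21_sq : E (fun A =>
   ((tau ^+ 3 * s * v)^-1 * (\sum_i z i * (x i A ^+ 2 * X i A))) ^+ 2)
  <= 10 * B ^+ 6 * eta ^+ 2.
Proof.
pose A1 A := \sum_j (\sum_i adjR R G j i * z i) * x j A.
pose A2 A := \sum_i \sum_j z i * adjR R G i j * (x i A * x j A).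
have h1 : E (fun A => A1 A ^+ 2) <= eta ^+ 2 * s ^+ 2 * v ^+ 2.
  exact: le_trans (linear_sq p01 (fun j => \sum_i adjR R G j i * z i)) (bal_nbr bal).
have h2 : E (fun A => A2 A ^+ 2) <= 4 * (eta ^+ 2 * s ^+ 2 * v ^+ 2).
  apply: le_trans (quadratic_sq p01 _) _ => [i|]; first by rewrite adjRii mulr0.
  rewrite ler_wpM2l//; apply: le_trans bal_sumz2deg; apply: ler_sum => i _.
  by rewrite mulr_sumr; apply: ler_sum => j _; rewrite exprMn adjR_sq.
apply: (@le_trans _ _ (E (fun A => (tau ^+ 3 * s * v) ^- 2 *
    (2 * A1 A ^+ 2 + 2 * A2 A ^+ 2)))).
  apply: (ler_fexp w0) => A; rewrite exprMn exprVn ler_wpM2l ?invr_ge0 ?sqr_ge0//.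
  rewrite sum_zX -(bal_tau2 bal) -/c -/(A1 A) -/(A2 A).
  have h3 := sqr_ge0 (tau ^+ 2 * A1 A - c * A2 A).
  have h4 : (tau ^+ 2 * A1 A) ^+ 2 <= A1 A ^+ 2.
    by rewrite exprMn ler_piMl ?sqr_ge0// expr_le1// sqr_ge0.
  have h5 : (c * A2 A) ^+ 2 <= A2 A ^+ 2 by rewrite exprMn ler_piMl ?sqr_ge0.
  by rewrite sqrrB in h3; rewrite sqrrD; lra.
rewrite fexpZ fexpD !fexpZ.
apply: (@le_trans _ _ ((tau ^+ 3 * s * v) ^- 2 * (10 * (eta ^+ 2 * s ^+ 2 * v ^+ 2)))).
  by rewrite ler_wpM2l ?invr_ge0 ?sqr_ge0//; lra.
have -> : (tau ^+ 3 * s * v) ^- 2 * (10 * (eta ^+ 2 * s ^+ 2 * v ^+ 2)) =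
    10 * (eta ^+ 2 * tau^-1 ^+ 6) by field; rewrite !gt_eqF.
by have := ler_wpM2l (sqr_ge0 eta) (Bpow 6); lra.
Qed.

(** The four forms of [sum_x2X2] are controlled by the squared degrees and, for
    the one with the codegrees, by the number of squares. *)
Lemma T11_sq : E (fun A =>
   ((2 * (tau ^+ 2 * s) ^+ 2)^-1 * (\sum_i x i A ^+ 2 * X i A ^+ 2) - 1) ^+ 2)
  <= 1067 * B ^+ 8 * eta ^+ 2.
Proof.
pose A1 A := \sum_i d i * x i A.
pose A2 A := \sum_j \sum_k (k != j)%:R * codeg R G j k * (x j A * x k A).
pose A3 A := \sum_i \sum_j adjR R G i j * (x i A * x j A).
pose A4 A := \sum_(t | cherries G t) x t.1.1 A * (x t.1.2 A * x t.2 A).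
have D4 : \sum_i d i ^+ 2 <= eta ^+ 2 * s ^+ 4.
  apply: le_trans (bal_deg bal) _; rewrite ler_wpM2l ?sqr_ge0//.
  by rewrite [leRHS]exprS ler_peMl ?exprn_ge0 ?(ltW s0).
have h1 : E (fun A => A1 A ^+ 2) <= eta ^+ 2 * s ^+ 4.
  exact: le_trans (linear_sq p01 d) D4.
have h2 : E (fun A => A2 A ^+ 2) <= 4 * (257 * (eta ^+ 2 * s ^+ 4)).
  apply: le_trans (quadratic_sq p01 _) _ => [i|]; first by rewrite eqxx mul0r.
  rewrite ler_wpM2l//.
  have -> : \sum_j \sum_k ((k != j)%:R * codeg R G j k) ^+ 2 =
      \sum_j \sum_(k | k != j) codeg R G j k ^+ 2.
    apply: eq_bigr => j _; rewrite [RHS]big_mkcond; apply: eq_bigr => k _.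
    by case: (k != j); rewrite ?mul1r// mul0r expr0n.
  apply: le_trans (sum_codeg_sq R G) _.
  by have := bal_sq bal; lra.
have h3 : E (fun A => A3 A ^+ 2) <= 8 * (eta ^+ 2 * s ^+ 4).
  apply: le_trans (quadratic_sq p01 _) _ => [i|]; first by rewrite adjRii.
  have -> : \sum_i \sum_j adjR R G i j ^+ 2 = 2 * s ^+ 2.
    rewrite (bal_s2 bal) -sum_degR; apply: eq_bigr => i _; apply: eq_bigr => j _.
    exact: adjR_sq.
  rewrite (_ : eta ^+ 2 * s ^+ 4 = (eta ^+ 2 * s) * s * s ^+ 2); last by ring.
  have : 1 * s ^+ 2 <= (eta ^+ 2 * s) * s * s ^+ 2.
    by rewrite ler_wpM2r ?sqr_ge0// mulr_ege1//; have := bal_sbig; lra.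
  by lra.
have h4 : E (fun A => A4 A ^+ 2) <= 27 * (eta ^+ 2 * s ^+ 4).
  apply: le_trans (cubic_sq p01 _) _.
    move=> t /and3P[t1' t2' ->]; rewrite andbT; apply/andP; split.
      by apply: contraTneq t1' => ->; rewrite adj_irrefl.
    by apply: contraTneq t2' => ->; rewrite adj_irrefl.
  by rewrite ler_wpM2l//; apply: le_trans (card_cherries R G) D4.
pose K := (2 * (tau ^+ 2 * s) ^+ 2) ^- 2.
apply: (@le_trans _ _ (E (fun A => K *
    (16 * A1 A ^+ 2 + 4 * A2 A ^+ 2 + (4 * A3 A ^+ 2 + 4 * A4 A ^+ 2))))).
  apply: (ler_fexp w0) => A.
  rewrite (_ : _ - 1 = (2 * (tau ^+ 2 * s) ^+ 2)^-1 *
    (2 * tau ^+ 2 * c * A1 A + tau ^+ 2 * A2 A + c ^+ 2 * A3 A + c * A4 A)); last first.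
    rewrite sum_x2X2 sum_degR -(bal_s2 bal) -(bal_tau2 bal) -/c.
    rewrite -/(A1 A) -/(A2 A) -/(A3 A) -/(A4 A).
    by field; rewrite !gt_eqF.
  rewrite exprMn exprVn ler_wpM2l ?invr_ge0 ?sqr_ge0//.
  have c0 := sqr_ge0 c; have tt0 := sqr_ge0 tau.
  have b1 : (2 * tau ^+ 2 * c * A1 A) ^+ 2 <= 4 * A1 A ^+ 2.
    rewrite exprMn ler_wpM2r ?sqr_ge0// (_ : (2 * tau ^+ 2 * c) ^+ 2 = 4 * (tau ^+ 2) ^+ 2 * c ^+ 2); last by ring.
    rewrite -[leRHS]mulr1 -mulrA ler_wpM2l// mulr_ile1// ?sqr_ge0//.
    by rewrite expr_le1.
  have b2 : (tau ^+ 2 * A2 A) ^+ 2 <= A2 A ^+ 2.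
    by rewrite exprMn ler_piMl ?sqr_ge0// expr_le1.
  have b3 : (c ^+ 2 * A3 A) ^+ 2 <= A3 A ^+ 2.
    by rewrite exprMn ler_piMl ?sqr_ge0// expr_le1.
  have b4 : (c * A4 A) ^+ 2 <= A4 A ^+ 2.
    by rewrite exprMn ler_piMl ?sqr_ge0.
  by apply: le_trans (sqr_sum4 _ _ _ _) _; lra.
rewrite fexpZ !fexpD !fexpZ.
apply: (@le_trans _ _ (K * (4 * (1067 * (eta ^+ 2 * s ^+ 4))))).
  by rewrite ler_wpM2l ?invr_ge0 ?sqr_ge0//; lra.
have -> : K * (4 * (1067 * (eta ^+ 2 * s ^+ 4))) =
    1067 * (eta ^+ 2 * tau^-1 ^+ 8) by rewrite /K; field; rewrite !gt_eqF.
by have := ler_wpM2l (sqr_ge0 eta) (Bpow 8); lra.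
Qed.

End Balanced.

(** * Stein's method for independent labels *)

(** Integration by parts in one label. The left term would vanish if [P1] and
    [P2] were replaced by their parts free of the label [i]; putting these back
    by a first-order Taylor expansion gives the derivative, multiplied by the
    square of the label. *)
Lemma stein_one (R : realType) (N : nat) (p a : R) (i : 'I_N)
    (P1 P2 y1 y2 u : {set 'I_N} -> R) :
  0 <= p <= 1 -> 0 <= a ->
  free_of i u -> free_of i y1 -> free_of i y2 ->
  free_of i (fun A => P1 A - xi p i A * y1 A) ->
  free_of i (fun A => P2 A - xi p i A * y2 A) ->
  `|bexp p (fun A => xi p i A * u A * (P1 A * gauss a (P1 A) (P2 A)))
    - bexp p (fun A => xi p i A ^+ 2 * u A *
        (y1 A * ((1 - a * P1 A ^+ 2) * gauss a (P1 A) (P2 A))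
         - y2 A * (a * P1 A * P2 A * gauss a (P1 A) (P2 A))))|
  <= (11 + 3 * a) * bexp p (fun A => `|u A| * (y1 A ^+ 2 + y2 A ^+ 2)).
Proof.
move=> p01 a0 fu fy1 fy2 fP1 fP2.
have w0 A := @bweight_ge0 R N p A p01.
pose V1 A := P1 A - xi p i A * y1 A; pose V2 A := P2 A - xi p i A * y2 A.
have z0 : bexp p (fun A => xi p i A * (u A * (V1 A * gauss a (V1 A) (V2 A)))) = 0.
  have f1 : free_of i V1 := fP1; have f2 : free_of i V2 := fP2.
  by apply: bexp_xi0 => A; rewrite fu f1 f2.
rewrite -[X in `|X|]subr0 -z0 -!fexpB -fexpZ.
apply: le_trans (ler_norm_fexp w0 _) _; apply: ler_fexp => // A.
have := gauss_mul_taylor a0 (P1 A) (P2 A) (- (xi p i A * y1 A)) (- (xi p i A * y2 A)).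
rewrite -/(V1 A) -/(V2 A); set T := _ - _ - _ => hT.
rewrite (_ : _ - _ - _ = - (xi p i A * u A * T)); last by rewrite /T; ring.
rewrite normrN normrM normrM -mulrA.
have x1 := xi_norm p01 i A.
apply: (@le_trans _ _ (`|u A| * `|T|)).
  by rewrite ler_piMl// mulr_ge0.
rewrite mulrCA ler_wpM2l//; apply: le_trans hT _.
rewrite ler_wpM2l ?addr_ge0 ?mulr_ge0//.
have xx : xi p i A ^+ 2 <= 1 by rewrite -real_normK ?num_real// expr_le1.
by rewrite !sqrrN !exprMn lerD// ler_piMl ?sqr_ge0.
Qed.

Section Stein.
Variables (R : realType) (N : nat) (G : sgraph N) (p : R) (z : 'I_N -> R).
Variables (s v tau : R).
Implicit Types (i j k : 'I_N) (A : {set 'I_N}).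
Local Notation d := (degR R G).
Local Notation E := (fexp (bweight p)).
Local Notation x := (xi p).

(** The standardised forms and, as [Yq] and [Yl], their increments when the
    node [i] is added to the label set. *)
Definition Wq A := (tau ^+ 2 * s)^-1 * Qform G p A.
Definition Wl A := (tau * v)^-1 * Lform p z A.
Definition Yq i A := (tau ^+ 2 * s)^-1 * Xnb G p i A.
Definition Yl i := (tau * v)^-1 * z i.

Lemma free_cst i (c : R) : free_of i (fun=> c). Proof. by []. Qed.

Lemma free_Yq i : free_of i (Yq i).
Proof. by move=> A; rewrite /Yq free_Xnb. Qed.

Lemma free_Wq i : free_of i (fun A => Wq A - x i A * Yq i A).
Proof.
move=> A; have e B : Wq B - x i B * Yq i B = (tau ^+ 2 * s)^-1 * Qrest G p i B.
  by rewrite /Wq /Yq (Qform_split G p i); ring.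
by rewrite !e free_Qrest.
Qed.

Lemma free_Wl i : free_of i (fun A => Wl A - x i A * Yl i).
Proof.
move=> A; have e B : Wl B - x i B * Yl i = (tau * v)^-1 * Lrest p z i B.
  by rewrite /Wl /Yl (Lform_split p z i); ring.
by rewrite !e free_Lrest.
Qed.

Variables (B eta : R).
Hypothesis bal : balanced G p z s v tau B eta.

Let p01 := bal_p bal.
Let s0 := bal_s bal.
Let v0 := bal_v bal.
Let tau0 := bal_tau bal.
Let eta0 : 0 < eta. Proof. by case/andP: (bal_eta bal). Qed.
Let eta1 : eta <= 1. Proof. by case/andP: (bal_eta bal). Qed.
Let w0 (A : {set 'I_N}) := @bweight_ge0 R N p A p01.
Let w1 := sum_bweight N p.
Let B1 : 1 <= B. Proof. by have := bal_B2 bal; lra. Qed.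
Let Bmono m n : (m <= n)%N -> tau^-1 ^+ m <= B ^+ n.
Proof.
move=> mn; apply: (@le_trans _ _ (B ^+ m)).
  rewrite lerXn2r ?nnegrE ?invr_ge0 ?(ltW tau0)//; last exact: bal_B bal.
  by apply: le_trans B1.
by rewrite ler_weXn2l.
Qed.

(** Of the four products of three increments, the cube of [Yq] is bounded by the
    degrees times the second moments and the cube of [Yl] by the third moments
    of the centred degrees. The mixed ones use the first moments of [Xnb] and,
    for [`|z i| * d i], the inequality between the arithmetic and the geometric
    mean. *)
Lemma stein_remainder :
  \sum_i E (fun A => `|Yq i A| * (Yq i A ^+ 2 + Yl i ^+ 2)) / 2 +
  \sum_i E (fun A => `|Yl i| * (Yq i A ^+ 2 + Yl i ^+ 2)) <= 3 * B ^+ 6 * eta.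
Proof.
have b0 : 0 < tau^-1 by rewrite invr_gt0.
have si0 : 0 < s^-1 by rewrite invr_gt0.
have vi0 : 0 < v^-1 by rewrite invr_gt0.
have e2 : eta ^+ 2 <= eta by rewrite expr2 ler_piMr ?(ltW eta0).
have r1 : \sum_i E (fun A => `|Yq i A| * Yq i A ^+ 2) <= B ^+ 6 * eta.
  apply: (@le_trans _ _ (\sum_i tau^-1 ^+ 6 * s^-1 ^+ 3 * d i ^+ 2)).
    apply: ler_sum => i _.
    apply: (@le_trans _ _ (E (fun A => tau^-1 ^+ 6 * s^-1 ^+ 3 * d i * Xnb G p i A ^+ 2))).
      apply: (ler_fexp w0) => A; rewrite /Yq normrM exprMn gtr0_norm ?invr_gt0 ?mulr_gt0 ?exprn_gt0//.
      rewrite [leLHS](_ : _ = tau^-1 ^+ 6 * s^-1 ^+ 3 * `|Xnb G p i A| * Xnb G p i A ^+ 2); last first.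
        by field; rewrite !gt_eqF.
      rewrite ler_wpM2r ?sqr_ge0// ler_wpM2l ?mulr_ge0 ?exprn_ge0 ?(ltW b0) ?(ltW si0)//.
      exact: Xnb_norm bal _ _.
    rewrite fexpZ [d i ^+ 2]expr2 [leRHS]mulrA ler_wpM2l ?mulr_ge0 ?exprn_ge0 ?(ltW b0) ?(ltW si0) ?degR_ge0//.
    exact: Xnb_sq bal _.
  rewrite -mulr_sumr; apply: (@le_trans _ _ (tau^-1 ^+ 6 * s^-1 ^+ 3 * (eta ^+ 2 * s ^+ 3))).
    by rewrite ler_wpM2l ?mulr_ge0 ?exprn_ge0 ?(ltW b0) ?(ltW si0)// (bal_deg bal).
  rewrite [leLHS](_ : _ = tau^-1 ^+ 6 * eta ^+ 2); last by field; rewrite !gt_eqF.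
  by rewrite ler_pM ?exprn_ge0 ?(ltW b0) ?(ltW eta0) ?Bmono.
have r2 : \sum_i E (fun A => `|Yq i A| * Yl i ^+ 2) <= B ^+ 6 * eta.
  apply: (@le_trans _ _ (\sum_i tau^-1 ^+ 4 * s^-1 * v^-1 ^+ 2 * (eta * s) * z i ^+ 2)).
    apply: ler_sum => i _.
    have -> : E (fun A => `|Yq i A| * Yl i ^+ 2) =
        tau^-1 ^+ 4 * s^-1 * v^-1 ^+ 2 * z i ^+ 2 * E (fun A => `|Xnb G p i A|).
      rewrite -fexpZ; apply: eq_fexp => A; rewrite /Yq /Yl normrM exprMn gtr0_norm ?invr_gt0 ?mulr_gt0 ?exprn_gt0//.
      by field; rewrite !gt_eqF.
    rewrite [leRHS](_ : _ = tau^-1 ^+ 4 * s^-1 * v^-1 ^+ 2 * z i ^+ 2 * (eta * s)); last by ring.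
    apply: ler_wpM2l (Xnb_abs bal i); apply: mulr_ge0 (sqr_ge0 _).
    by rewrite !mulr_ge0 ?exprn_ge0 ?ltW.
  rewrite -mulr_sumr -(bal_v2 bal) [leLHS](_ : _ = tau^-1 ^+ 4 * eta); last first.
    by field; rewrite !gt_eqF.
  by rewrite ler_wpM2r ?(ltW eta0)// Bmono.
have r3 : \sum_i E (fun A => `|Yl i| * Yq i A ^+ 2) <= B ^+ 6 * eta.
  apply: (@le_trans _ _ (\sum_i tau^-1 ^+ 5 * v^-1 * s^-1 ^+ 2 * (`|z i| * d i))).
    apply: ler_sum => i _.
    have -> : E (fun A => `|Yl i| * Yq i A ^+ 2) =
        tau^-1 ^+ 5 * v^-1 * s^-1 ^+ 2 * `|z i| * E (fun A => Xnb G p i A ^+ 2).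
      rewrite -fexpZ; apply: eq_fexp => A; rewrite /Yq /Yl normrM exprMn gtr0_norm ?invr_gt0 ?mulr_gt0 ?exprn_gt0//.
      by field; rewrite !gt_eqF.
    rewrite [leRHS]mulrA ler_wpM2l ?mulr_ge0 ?sqr_ge0 ?exprn_ge0 ?(ltW b0) ?(ltW si0) ?(ltW vi0)//.
    exact: Xnb_sq bal _.
  have zd : \sum_i `|z i| * d i <= eta * v * s ^+ 2.
    apply: (@le_trans _ _ (\sum_i (eta * s ^+ 2 * v^-1 / 2 * z i ^+ 2 +
        v * eta^-1 * s^-1 ^+ 2 / 2 * d i ^+ 2))).
      apply: ler_sum => i _; rewrite -subr_ge0.
      rewrite -[z i ^+ 2]real_normK ?num_real//.
      rewrite (_ : _ - _ = (eta * s ^+ 2 * `|z i| - v * d i) ^+ 2 / (2 * eta * s ^+ 2 * v)); last first.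
        by field; rewrite !gt_eqF.
      by rewrite divr_ge0 ?sqr_ge0// !mulr_ge0 ?exprn_ge0 ?ltW.
    rewrite big_split /= -!mulr_sumr -(bal_v2 bal).
    apply: (@le_trans _ _ (eta * s ^+ 2 * v^-1 / 2 * v ^+ 2 + v * eta^-1 * s^-1 ^+ 2 / 2 * (eta ^+ 2 * s ^+ 3))).
      rewrite lerD2l ler_wpM2l ?(bal_deg bal)// !mulr_ge0 ?invr_ge0 ?exprn_ge0//; by rewrite ltW// ?invr_gt0.
    rewrite [leLHS](_ : _ = eta * v * s * ((s + 1) / 2)); last by field; rewrite !gt_eqF.
    rewrite [leRHS](_ : _ = eta * v * s * s); last by ring.
    rewrite ler_wpM2l ?mulr_ge0 ?ltW//.
    by have := bal_s2le bal; lra.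
  rewrite -mulr_sumr.
  apply: (@le_trans _ _ (tau^-1 ^+ 5 * v^-1 * s^-1 ^+ 2 * (eta * v * s ^+ 2))).
    by rewrite ler_wpM2l ?mulr_ge0 ?sqr_ge0 ?exprn_ge0 ?(ltW b0) ?(ltW si0) ?(ltW vi0).
  rewrite [leLHS](_ : _ = tau^-1 ^+ 5 * eta); last by field; rewrite !gt_eqF.
  by rewrite ler_wpM2r ?(ltW eta0)// Bmono.
have r4 : \sum_i E (fun A => `|Yl i| * Yl i ^+ 2) <= B ^+ 6 * eta.
  have -> : \sum_i E (fun A => `|Yl i| * Yl i ^+ 2) =
     tau^-1 ^+ 3 * v^-1 ^+ 3 * \sum_i `|z i| ^+ 3.
    rewrite mulr_sumr; apply: eq_bigr => i _; rewrite fexp_cst//.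
    rewrite /Yl exprMn normrM gtr0_norm ?invr_gt0 ?mulr_gt0//.
    rewrite -[z i ^+ 2]real_normK ?num_real//.
    by field; rewrite !gt_eqF.
  apply: (@le_trans _ _ (tau^-1 ^+ 3 * v^-1 ^+ 3 * (eta ^+ 2 * v ^+ 3))).
    by rewrite ler_wpM2l ?(bal_cube bal)// ?mulr_ge0 ?exprn_ge0 ?(ltW b0) ?(ltW vi0).
  rewrite [leLHS](_ : _ = tau^-1 ^+ 3 * eta ^+ 2); last by field; rewrite !gt_eqF.
  by rewrite ler_pM ?exprn_ge0 ?(ltW b0) ?(ltW eta0) ?Bmono.
have sp (u : 'I_N -> {set 'I_N} -> R) :
    \sum_i E (fun A => `|u i A| * (Yq i A ^+ 2 + Yl i ^+ 2)) =
    \sum_i E (fun A => `|u i A| * Yq i A ^+ 2) + \sum_i E (fun A => `|u i A| * Yl i ^+ 2).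
  rewrite -big_split /=; apply: eq_bigr => i _; rewrite -fexpD; apply: eq_fexp => A.
  by rewrite mulrDr.
rewrite -mulr_suml (sp Yq) (sp (fun i _ => Yl i)).
by lra.
Qed.

(** Write the squared norm of the two forms as a sum over nodes, weighted 1/2
    for the quadratic form since each of its monomials involves two nodes, and
    integrate by parts in each label. If the conditional covariances were those
    of a standard Gaussian vector, the derivatives would add up to
    [2 - a * (Wq A ^+ 2 + Wl A ^+ 2)] times [gauss]. *)
Lemma stein_bound a : 0 <= a ->
  `|E (fun A => ((1 + a) * (Wq A ^+ 2 + Wl A ^+ 2) - 2) * gauss a (Wq A) (Wl A))|
  <= (1700 + 9 * a) * B ^+ 8 * eta.
Proof.
move=> a0; pose g A := gauss a (Wq A) (Wl A).
pose K1 A := (1 - a * Wq A ^+ 2) * g A.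
pose K2 A := (1 - a * Wl A ^+ 2) * g A.
pose K3 A := a * Wq A * Wl A * g A.
pose T11 A := (2 * (tau ^+ 2 * s) ^+ 2)^-1 * (\sum_i x i A ^+ 2 * Xnb G p i A ^+ 2).
pose T22 A := (tau * v) ^- 2 * (\sum_i z i ^+ 2 * x i A ^+ 2).
pose T21 A := (tau ^+ 3 * s * v)^-1 * (\sum_i z i * (x i A ^+ 2 * Xnb G p i A)).
pose I1 i := E (fun A => x i A * Yq i A * (Wq A * g A)).
pose J1 i := E (fun A => x i A ^+ 2 * Yq i A * (Yq i A * K1 A - Yl i * K3 A)).
pose I2 i := E (fun A => x i A * Yl i * (Wl A * g A)).
pose J2 i := E (fun A => x i A ^+ 2 * Yl i * (Yl i * K2 A - Yq i A * K3 A)).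
have sI1 : \sum_i I1 i = 2 * E (fun A => Wq A ^+ 2 * g A).
  rewrite -fexp_sum -fexpZ; apply: eq_fexp => A; rewrite -mulr_suml.
  have -> : \sum_i x i A * Yq i A = 2 * Wq A.
    rewrite /Wq /Qform !mulr_sumr; apply: eq_bigr => i _; rewrite /Yq.
    by field; rewrite !gt_eqF.
  by ring.
have sI2 : \sum_i I2 i = E (fun A => Wl A ^+ 2 * g A).
  rewrite -fexp_sum; apply: eq_fexp => A; rewrite -mulr_suml.
  have -> : \sum_i x i A * Yl i = Wl A.
    rewrite /Wl /Lform !mulr_sumr; apply: eq_bigr => i _; rewrite /Yl.
    by ring.
  by ring.
have eT11 A : \sum_i x i A ^+ 2 * Yq i A * Yq i A = 2 * T11 A.
  rewrite /T11 !mulr_sumr; apply: eq_bigr => i _; rewrite /Yq.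
  by field; rewrite !gt_eqF.
have eT21 A : \sum_i x i A ^+ 2 * Yq i A * Yl i = T21 A.
  rewrite /T21 !mulr_sumr; apply: eq_bigr => i _; rewrite /Yq /Yl.
  by field; rewrite !gt_eqF.
have eT22 A : \sum_i x i A ^+ 2 * Yl i * Yl i = T22 A.
  rewrite /T22 !mulr_sumr; apply: eq_bigr => i _; rewrite /Yl.
  by field; rewrite !gt_eqF.
have sJ1 : \sum_i J1 i = E (fun A => 2 * T11 A * K1 A - T21 A * K3 A).
  rewrite -fexp_sum; apply: eq_fexp => A; rewrite -eT11 -eT21 !mulr_suml -sumrB.
  by apply: eq_bigr => i _; ring.
have sJ2 : \sum_i J2 i = E (fun A => T22 A * K2 A - T21 A * K3 A).
  rewrite -fexp_sum; apply: eq_fexp => A; rewrite -eT22 -eT21 !mulr_suml -sumrB.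
  by apply: eq_bigr => i _; ring.
pose r1 i := E (fun A => `|Yq i A| * (Yq i A ^+ 2 + Yl i ^+ 2)).
pose r2 i := E (fun A => `|Yl i| * (Yq i A ^+ 2 + Yl i ^+ 2)).
have IJ1 : `|\sum_i I1 i - \sum_i J1 i| <= (11 + 3 * a) * \sum_i r1 i.
  rewrite -sumrB mulr_sumr; apply: le_trans (ler_norm_sum _ _ _) _.
  apply: ler_sum => i _.
  exact: (stein_one p01 a0 (@free_Yq i) (@free_Yq i) (free_cst i (Yl i))
    (@free_Wq i) (@free_Wl i)).
have IJ2 : `|\sum_i I2 i - \sum_i J2 i| <= (11 + 3 * a) * \sum_i r2 i.
  rewrite -sumrB mulr_sumr; apply: le_trans (ler_norm_sum _ _ _) _.
  apply: ler_sum => i _.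
  have := stein_one p01 a0 (free_cst i (Yl i)) (free_cst i (Yl i)) (@free_Yq i)
    (@free_Wl i) (@free_Wq i).
  rewrite /bexp (@eq_fexp _ _ _ (fun A => xi p i A * Yl i * _)
    (fun A => x i A * Yl i * (Wl A * g A))); last by move=> A; rewrite gaussC.
  rewrite (@eq_fexp _ _ _ (fun A => xi p i A ^+ 2 * Yl i * _)
    (fun A => x i A ^+ 2 * Yl i * (Yl i * K2 A - Yq i A * K3 A))); last first.
    by move=> A; rewrite gaussC /K2 /K3 /g; ring.
  rewrite (@eq_fexp _ _ _ (fun A => `|Yl i| * _)
    (fun A => `|Yl i| * (Yq i A ^+ 2 + Yl i ^+ 2)))//.
  by move=> A; rewrite addrC.
have key : E (fun A => ((1 + a) * (Wq A ^+ 2 + Wl A ^+ 2) - 2) * g A) =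
    (\sum_i I1 i - \sum_i J1 i) / 2 + (\sum_i I2 i - \sum_i J2 i) +
    E (fun A => (T11 A - 1) * K1 A + (T22 A - 1) * K2 A - 3 / 2 * T21 A * K3 A).
  rewrite sI1 sI2 sJ1 sJ2.
  have -> : E (fun A => ((1 + a) * (Wq A ^+ 2 + Wl A ^+ 2) - 2) * g A) =
    E (fun A => Wq A ^+ 2 * g A) - (1 / 2) * E (fun A => 2 * T11 A * K1 A - T21 A * K3 A)
    + (E (fun A => Wl A ^+ 2 * g A) - E (fun A => T22 A * K2 A - T21 A * K3 A))
    + E (fun A => (T11 A - 1) * K1 A + (T22 A - 1) * K2 A - 3 / 2 * T21 A * K3 A).
    rewrite -fexpZ -!fexpB -!fexpD; apply: eq_fexp => A.
    by rewrite /K1 /K2; field.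
  by field.
rewrite key.
have bK A : [/\ `|K1 A| <= 3, `|K2 A| <= 3 & `|K3 A| <= 2].
  have [h _] := gauss_decay a0 (Wq A) (Wl A).
  have g0 := gauss_gt0 a (Wq A) (Wl A); have g1 := gauss_le1 a0 (Wq A) (Wl A).
  rewrite -/(g A) in h g0 g1.
  have ag : 0 <= a * g A by rewrite mulr_ge0// ltW.
  have q1 := mulr_ge0 ag (sqr_ge0 (Wq A)); have q2 := mulr_ge0 ag (sqr_ge0 (Wl A)).
  have q3 := mulr_ge0 ag (sqr_ge0 (Wq A - Wl A)).
  have q4 := mulr_ge0 ag (sqr_ge0 (Wq A + Wl A)).
  rewrite sqrrB in q3; rewrite sqrrD in q4.
  by rewrite /K1 /K2 /K3 !ler_norml; split; apply/andP; split; lra.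
have b11 : E (fun A => `|T11 A - 1|) <= _ := fexp_norm_le_sq w0 w1 eta0 (T11_sq bal).
have b22 : E (fun A => `|T22 A - 1|) <= _ := fexp_norm_le_sq w0 w1 eta0 (T22_sq bal).
have b21 : E (fun A => `|T21 A|) <= _ := fexp_norm_le_sq w0 w1 eta0 (T21_sq bal).
clear key eT11 eT22 eT21 sI1 sI2 sJ1 sJ2; clearbody T11 T22 T21 K1 K2 K3.
have bE : `|E (fun A => (T11 A - 1) * K1 A + (T22 A - 1) * K2 A - 3 / 2 * T21 A * K3 A)|
  <= 3 * E (fun A => `|T11 A - 1|) + 3 * E (fun A => `|T22 A - 1|) +
     3 * E (fun A => `|T21 A|).
  apply: le_trans (ler_norm_fexp w0 _) _; rewrite -!fexpZ -!fexpD.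
  apply: (ler_fexp w0) => A; have [k1 k2 k3] := bK A.
  apply: le_trans (ler_normB _ _) _; apply: lerD.
    apply: le_trans (ler_normD _ _) _; rewrite !normrM.
    have := ler_wpM2l (normr_ge0 (T11 A - 1)) k1.
    by have := ler_wpM2l (normr_ge0 (T22 A - 1)) k2; lra.
  have -> : 3 / 2 * T21 A * K3 A = (3 / 2) * (T21 A * K3 A) by ring.
  rewrite normrM [`|T21 A * _|]normrM (ger0_norm (_ : 0 <= 3 / 2)); last by lra.
  have := ler_wpM2l (normr_ge0 (T21 A)) k3; lra.
have rem : (\sum_i r1 i) / 2 + \sum_i r2 i <= 3 * B ^+ 6 * eta.
  by rewrite mulr_suml; exact: stein_remainder.
have B8 : 1 <= B ^+ 8 by rewrite exprn_ege1.
have B48 : B ^+ 4 <= B ^+ 8 by rewrite ler_weXn2l.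
have B68 : B ^+ 6 <= B ^+ 8 by rewrite ler_weXn2l.
have e0 := ltW eta0.
have := ler_wpM2r e0 B8; have := ler_wpM2r e0 B48; have := ler_wpM2r e0 B68.
move=> E6 E4 E1; rewrite mul1r in E1.
apply: le_trans (ler_normD _ _) _; apply: le_trans (lerD (ler_normD _ _) (lexx _)) _.
rewrite normrM (ger0_norm (_ : 0 <= 2^-1)) ?invr_ge0//.
have a11 : 0 <= 11 + 3 * a by lra.
have := ler_wpM2l a11 rem.
have := ler_wpM2l a11 E6.
move=> h1 h2; rewrite mulrDr in h2.
lra.
Qed.

End Stein.

(** * Uniform labels with a fixed number of ones *)

Section Uniform.
Variables (R : realType) (N m : nat).
Implicit Types (i j k l a b : 'I_N) (A T : {set 'I_N}) (f : {set 'I_N} -> R).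

Definition pweight A : R := (#|A| == m)%:R / ('C(N, m))%:R.
Local Notation E := (fexp pweight).

Lemma perm_expectE f : perm_expect m f = E f.
Proof.
rewrite /perm_expect big_mkcond; apply: eq_bigr => A _; rewrite /pweight.
by case: (_ == _); rewrite ?mul1r ?mul0r// mulrC.
Qed.

Lemma pweight_ge0 A : 0 <= pweight A.
Proof. by rewrite mulr_ge0 ?invr_ge0 ?ler0n. Qed.

Lemma eq_pexp f g : (forall A, #|A| = m -> f A = g A) -> E f = E g.
Proof.
move=> fg; apply: eq_bigr => A _; rewrite /pweight.
by case: eqP => [/fg ->//|_]; rewrite !mul0r.
Qed.

Hypothesis mN : (m <= N)%N.

Lemma sum_pweight : \sum_A pweight A = 1.
Proof.
rewrite -mulr_suml -natr_sum -big_mkcond /=.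
have -> : \sum_(A : {set 'I_N} | #|A| == m) 1 = 'C(N, m).
  by rewrite -[in RHS](card_ord N) -card_draws -sum1_card; apply: eq_bigl => A; rewrite inE.
by rewrite divff// pnatr_eq0 -lt0n bin_gt0.
Qed.

Lemma tperm_imsetK a b : involutive (fun A => tperm a b @: A)%SET.
Proof.
move=> A; rewrite -imset_comp (@eq_imset _ _ _ id) ?imset_id// => c /=.
exact: tpermK.
Qed.

Lemma pexp_tperm a b f : E (fun A => f (tperm a b @: A)%SET) = E f.
Proof.
rewrite [RHS](reindex_inj (inv_inj (tperm_imsetK a b))) /=.
by apply: eq_bigr => A _; rewrite /pweight card_imset//; exact: perm_inj.
Qed.

Variable p : R.
Local Notation x := (xi p).

Lemma xi_tperm a b i A : x i (tperm a b @: A)%SET = x (tperm a b i) A.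
Proof.
rewrite /xi; congr (_%:R - _); congr nat_of_bool.
rewrite -{1}(tpermK a b i) mem_imset//; exact: perm_inj.
Qed.

Hypothesis pE : N%:R * p = m%:R.

Lemma sum_xi A : #|A| = m -> \sum_i x i A = 0.
Proof.
move=> Am; rewrite /xi sumrB sumr_const card_ord -[p *+ N]mulr_natl pE.
by rewrite -natr_sum -big_mkcond sum1_card Am subrr.
Qed.

(** Under exchangeability the constraint that the centred labels sum to zero
    lowers the degree of a mixed moment by one, at the price of a factor of
    order 1/N. *)
Lemma exchange_moment T (phi : {set 'I_N} -> R) a :
  (forall b c A, b \notin T -> c \notin T -> phi (tperm b c @: A)%SET = phi A) ->
  a \notin T ->
  (N%:R - #|T|%:R) * E (fun A => phi A * x a A) =
  - \sum_(j in T) E (fun A => phi A * x j A).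
Proof.
move=> phiT aT.
have eqE b : b \notin T -> E (fun A => phi A * x b A) = E (fun A => phi A * x a A).
  move=> bT; rewrite -(pexp_tperm a b); apply: eq_fexp => A.
  by rewrite phiT// xi_tperm tpermR.
have : E (fun A => phi A * \sum_j x j A) = 0.
  rewrite (@eq_pexp _ (fun=> 0)); first by apply: big1 => A _; rewrite mulr0.
  by move=> A Am; rewrite sum_xi// mulr0.
have -> : E (fun A => phi A * \sum_j x j A) = \sum_j E (fun A => phi A * x j A).
  by rewrite -fexp_sum; apply: eq_fexp => A; rewrite mulr_sumr.
rewrite (bigID (fun j => j \in T)) /= => /eqP; rewrite addr_eq0 => /eqP ->.
rewrite opprK (eq_bigr _ eqE) sumr_const -[X in _ = X]mulr_natl; congr (_ * _).
have -> : N%:R = #|T|%:R + #|[predC T]|%:R :> R.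
  by rewrite -natrD cardC card_ord.
by rewrite [LHS]addrAC subrr add0r.
Qed.

(** The mixed moments of two, three and four distinct centred labels. *)
Definition rho2 : R := - (p * (1 - p)) / (N%:R - 1).
Definition rho3 : R := - (2 * (1 - 2 * p) * rho2) / (N%:R - 2).
Definition rho4 : R :=
  - (3 * (p * (1 - p) * rho2 + (1 - 2 * p) * rho3)) / (N%:R - 3).

Hypothesis N4 : (4 <= N)%N.

Let Nk (k : nat) : (k < 4)%N -> N%:R - k%:R != 0 :> R.
Proof.
move=> k4; rewrite -natrB; last by apply: leq_trans N4; exact: ltnW.
by rewrite pnatr_eq0 subn_eq0 -ltnNge; apply: leq_trans N4.
Qed.

Lemma pexp_xi a : E (x a) = 0.
Proof.
have := @exchange_moment finset.set0 (fun=> 1) a (fun _ _ _ _ _ => erefl).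
rewrite finset.in_set0 cards0 subr0 => /(_ isT); rewrite big_set0 oppr0.
move/eqP; rewrite mulf_eq0 -[N%:R]subr0 (negbTE (Nk (k := 0) _))//= => /eqP.
by under eq_fexp do rewrite mul1r.
Qed.

Lemma pexp_xi2 a b : a != b -> E (fun A => x a A * x b A) = rho2.
Proof.
move=> ab; have h := @exchange_moment [set a]%SET (x a) b.
apply: (mulfI (Nk (k := 1) isT)); rewrite cards1 in h.
rewrite h; last by rewrite inE eq_sym.
  rewrite big_set1 /rho2 mulrC divfK ?(Nk (k := 1))//; congr (- _).
  transitivity (E (fun A => p * (1 - p) + (1 - 2 * p) * x a A)).
    by apply: eq_fexp => A; rewrite -xi_sq expr2.
  by rewrite fexpD fexp_cst ?sum_pweight// fexpZ pexp_xi mulr0 addr0.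
by move=> c e A; rewrite !inE => ca ea; rewrite xi_tperm tpermD.
Qed.

Lemma pexp_xi3 a b c : a != b -> a != c -> b != c ->
  E (fun A => x a A * x b A * x c A) = rho3.
Proof.
move=> ab ac bc.
have h := @exchange_moment [set a; b]%SET (fun A => x a A * x b A) c.
have s2 u v : u != v -> E (fun A => x u A * x v A * x u A) = (1 - 2 * p) * rho2.
  move=> uv; transitivity (E (fun A => p * (1 - p) * x v A + (1 - 2 * p) * (x u A * x v A))).
    by apply: eq_fexp => A; have := xi_sq p u A; rewrite expr2 mulrAC => ->; ring.
  by rewrite fexpD !fexpZ pexp_xi pexp_xi2// mulr0 add0r.
apply: (mulfI (Nk (k := 2) isT)).
have c2 : #|[set a; b]%SET| = 2%N by rewrite cards2 ab.
rewrite c2 in h; rewrite h; last by rewrite !inE negb_or ![c == _]eq_sym ac bc.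
  rewrite big_setU1 ?inE//= big_set1 s2//.
  rewrite (@eq_fexp _ _ _ (fun A => x a A * x b A * x b A)
    (fun A => x b A * x a A * x b A)); last by move=> A; ring.
  rewrite s2 1?eq_sym// /rho3.
  by rewrite [RHS]mulrC divfK ?(Nk (k := 2))//; ring.
move=> u v A; rewrite !inE !negb_or => /andP[ua ub] /andP[va vb].
by rewrite !xi_tperm !tpermD.
Qed.

Lemma pexp_xi4 a b c e : a != b -> a != c -> a != e -> b != c -> b != e -> c != e ->
  E (fun A => x a A * x b A * x c A * x e A) = rho4.
Proof.
move=> ab ac ae bc be ce.
have h := @exchange_moment [set a; b; c]%SET (fun A => x a A * x b A * x c A) e.
have s3 u v w : u != v -> u != w -> v != w ->
    E (fun A => x u A * x v A * x w A * x u A) =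
    p * (1 - p) * rho2 + (1 - 2 * p) * rho3.
  move=> uv uw vw; transitivity (E (fun A => p * (1 - p) * (x v A * x w A) +
     (1 - 2 * p) * (x u A * x v A * x w A))).
    apply: eq_fexp => A; have := xi_sq p u A; rewrite expr2 => e1.
    rewrite (_ : x u A * x v A * x w A * x u A = (x u A * x u A) * (x v A * x w A)); last by ring.
    by rewrite e1; ring.
  by rewrite fexpD !fexpZ pexp_xi2// pexp_xi3.
apply: (mulfI (Nk (k := 3) isT)).
have c3 : #|[set a; b; c]%SET| = 3%N.
  by rewrite -finset.setUA cardsU1 cards2 !inE negb_or ab ac bc.
rewrite c3 in h; rewrite h; last by rewrite !inE !negb_or ![e == _]eq_sym ae be ce.
  rewrite -finset.setUA big_setU1 ?inE ?negb_or ?ab//= big_setU1 ?inE//= big_set1.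
  rewrite s3//.
  rewrite (@eq_fexp _ _ _ (fun A => x a A * x b A * x c A * x b A)
    (fun A => x b A * x a A * x c A * x b A)); last by move=> A; ring.
  rewrite (@eq_fexp _ _ _ (fun A => x a A * x b A * x c A * x c A)
    (fun A => x c A * x a A * x b A * x c A)); last by move=> A; ring.
  rewrite !s3//; try by rewrite eq_sym.
  by rewrite /rho4 [RHS]mulrC divfK ?(Nk (k := 3))//; ring.
move=> u v A; rewrite !inE !negb_or => /andP[/andP[ua ub] uc] /andP[/andP[va vb] vc].
by rewrite !xi_tperm !tpermD.
Qed.

End Uniform.

(** * Covariances under the permutation null distribution *)

Section Covariance.
Variables (R : realType) (N m : nat) (G : sgraph N) (p : R) (z : 'I_N -> R).
Variables (s v tau B eta : R).
Hypothesis bal : balanced G p z s v tau B eta.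
Hypothesis mN : (m <= N)%N.
Hypothesis pE : N%:R * p = m%:R.
Implicit Types (i j k l : 'I_N) (A : {set 'I_N}).
Local Notation E := (fexp (pweight R m)).
Local Notation x := (xi p).
Local Notation g := (adjR R G).
Local Notation n := (N%:R : R).
Local Notation r2 := (rho2 N p).
Local Notation r3 := (rho3 N p).
Local Notation r4 := (rho4 N p).
Local Notation c := (1 - 2 * p).

Let p01 := bal_p bal.
Let s0 := bal_s bal.
Let v0 := bal_v bal.
Let tau0 := bal_tau bal.
Let eta0 : 0 < eta. Proof. by case/andP: (bal_eta bal). Qed.
Let eta1 : eta <= 1. Proof. by case/andP: (bal_eta bal). Qed.
Let w1 := @sum_pweight R N m mN.

Let e2 : eta ^+ 2 <= 1. Proof. by rewrite expr_le1// ltW. Qed.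

Let n8 : 8 <= n := bal_N8 bal.

Let N4 : (4 <= N)%N. Proof. by rewrite -(ler_nat R); have := n8; lra. Qed.

Let n0 : 0 < n. Proof. by have := n8; lra. Qed.

Let nn0 : n != 0. Proof. by rewrite gt_eqF. Qed.

Let sn : s / n <= eta ^+ 2 / 4.
Proof. by rewrite ler_pdivrMr//; have := bal_sN bal; lra. Qed.

Let tt : 0 <= p * (1 - p) <= 1/4.
Proof.
rewrite -(bal_tau2 bal) sqr_ge0 /=.
by have := bal_tauhalf bal; have := tau0; nra.
Qed.

Lemma rho2_le : `|r2| <= 1 / (2 * n).
Proof.
case/andP: tt => t0 t1; have := n8 => h8.
rewrite /rho2 normrM normrN normfV (ger0_norm t0) ger0_norm; last by lra.
rewrite ler_pdivrMr; last by lra.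
apply: le_trans t1 _.
rewrite -subr_ge0 (_ : _ - _ = (n - 2) / (4 * n)); last by field; rewrite ?nn0.
by rewrite divr_ge0//; lra.
Qed.

Lemma c_le1 : `|c| <= 1.
Proof. by case/andP: p01 => p0 p1; rewrite ler_norml; apply/andP; split; lra. Qed.

Lemma rho3_le : `|r3| <= 2 / n ^+ 2.
Proof.
have h8 := n8; have h2 := rho2_le.
rewrite /rho3 normrM normrN normfV [`|n - 2|]ger0_norm; last by lra.
rewrite [`|2 * _ * _|]normrM [`|2 * _|]normrM (ger0_norm (_ : 0 <= 2))//.
have h : `|c| * `|r2| <= 1 / (2 * n).
  by apply: le_trans h2; rewrite ler_piMl// c_le1.
rewrite ler_pdivrMr; last by lra.
apply: (@le_trans _ _ (1 / n)).
  rewrite (_ : 1 / n = 2 * (1 / (2 * n))); last by field.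
  by lra.
rewrite -subr_ge0 (_ : _ - _ = (n - 4) / n ^+ 2); last by field; rewrite ?nn0.
by rewrite divr_ge0 ?sqr_ge0//; lra.
Qed.

Lemma rho4_le : `|r4| <= 2 / n ^+ 2.
Proof.
have h8 := n8; have h2 := rho2_le; have h3 := rho3_le.
case/andP: tt => t0 t1.
rewrite /rho4 normrM normrN normfV [`|n - 3|]ger0_norm; last by lra.
rewrite normrM (ger0_norm (_ : 0 <= 3))//.
rewrite ler_pdivrMr; last by lra.
have a1 : `|p * (1 - p) * r2| <= 1 / (8 * n).
  rewrite normrM (ger0_norm t0) (_ : 1 / (8 * n) = 1/4 * (1 / (2 * n))); last by field; rewrite ?nn0.
  by rewrite ler_pM.
have a2 : `|c * r3| <= 1 / (4 * n).
  rewrite normrM; apply: (@le_trans _ _ (2 / n ^+ 2)).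
    by apply: le_trans h3; rewrite ler_piMl// c_le1.
  rewrite -subr_ge0 (_ : _ - _ = (n - 8) / (4 * n ^+ 2)); last by field; rewrite ?nn0.
  by rewrite divr_ge0 ?mulr_ge0 ?sqr_ge0//; lra.
apply: (@le_trans _ _ (3 * (1 / (8 * n) + 1 / (4 * n)))).
  by rewrite ler_wpM2l//; apply: le_trans (ler_normD _ _) (lerD a1 a2).
rewrite -subr_ge0 (_ : _ - _ = (7 * n - 48) / (8 * n ^+ 2)); last by field; rewrite ?nn0.
by rewrite divr_ge0 ?mulr_ge0 ?sqr_ge0//; lra.
Qed.

Lemma pexp_Q : E (Qform G p) = s ^+ 2 * r2.
Proof.
rewrite /Qform fexpZ fexp_sum.
have -> : \sum_i E (fun A => x i A * Xnb G p i A) = \sum_i r2 * degR R G i.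
  apply: eq_bigr => i _.
  transitivity (E (fun A => \sum_j g i j * (x i A * x j A))).
    by apply: eq_fexp => A; rewrite mulr_sumr; apply: eq_bigr => j _; ring.
  rewrite fexp_sum mulr_sumr; apply: eq_bigr => j _; rewrite fexpZ.
  have [->|ij] := eqVneq i j; first by rewrite adjRii mulr0 mul0r.
  by rewrite (pexp_xi2 mN pE N4 ij) mulrC.
by rewrite -mulr_sumr sum_degR -(bal_s2 bal); field.
Qed.

Lemma pexp_L : E (Lform p z) = 0.
Proof.
rewrite fexp_sum big1// => i _.
by rewrite fexpZ (pexp_xi pE N4) mulr0.
Qed.

Lemma pexp_LL : E (fun A => Lform p z A ^+ 2) = (p * (1 - p) - r2) * v ^+ 2.
Proof.
transitivity (\sum_i \sum_j (z i * z j * r2 + (j == i)%:R * (z i * z j * (p * (1 - p) - r2)))).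
  transitivity (E (fun A => \sum_i \sum_j z i * z j * (x i A * x j A))).
    apply: eq_fexp => A; rewrite expr2 mulr_suml; apply: eq_bigr => i _.
    by rewrite mulr_sumr; apply: eq_bigr => j _; ring.
  rewrite fexp_sum; apply: eq_bigr => i _; rewrite fexp_sum; apply: eq_bigr => j _.
  rewrite fexpZ; have [->|ij] := eqVneq j i; last first.
    by rewrite mul0r addr0 (pexp_xi2 mN pE N4) 1?eq_sym.
  transitivity (z i * z i * E (fun A => p * (1 - p) + c * x i A)).
    by congr (_ * _); apply: eq_fexp => A; rewrite -expr2 xi_sq.
  by rewrite fexpD fexp_cst// fexpZ (pexp_xi pE N4) /=; ring.
under eq_bigr do rewrite big_split /=.
rewrite big_split /= (_ : \sum_i \sum_j z i * z j * r2 = 0); last first.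
  apply: big1 => i _; rewrite -mulr_suml -mulr_sumr (sum_z bal); ring.
rewrite add0r (bal_v2 bal) mulr_sumr; apply: eq_bigr => i _.
rewrite (bigD1 i)//= [X in _ + X]big1 ?eqxx; last first.
  by move=> j /negbTE ->; rewrite mul0r.
by rewrite /=; ring.
Qed.

Lemma pexp_QL : E (fun A => Qform G p A * Lform p z A) = (c * r2 - r3) * v ^+ 2.
Proof.
transitivity (1/2 * \sum_i \sum_j \sum_k g i j * z k *
   (r3 + ((k == i)%:R + (k == j)%:R) * (c * r2 - r3))).
  transitivity (E (fun A => 1/2 * \sum_i \sum_j \sum_k g i j * z k * (x i A * x j A * x k A))).
    apply: eq_fexp => A; rewrite /Qform -[LHS]mulrA; congr (_ * _).
    rewrite mulr_suml; apply: eq_bigr => i _.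
    rewrite [x i A * _]mulr_sumr mulr_suml; apply: eq_bigr => j _.
    by rewrite mulr_sumr; apply: eq_bigr => k _; ring.
  rewrite fexpZ; congr (_ * _); rewrite fexp_sum; apply: eq_bigr => i _.
  rewrite fexp_sum; apply: eq_bigr => j _; rewrite fexp_sum; apply: eq_bigr => k _.
  rewrite fexpZ; have [->|ij] := eqVneq i j; first by rewrite adjRii !mul0r.
  have s2 a b : a != b -> E (fun A => x a A * x b A * x a A) = c * r2.
    move=> ab; transitivity (E (fun A => p * (1 - p) * x b A + c * (x a A * x b A))).
      by apply: eq_fexp => A; have := xi_sq p a A; rewrite expr2 mulrAC => ->; ring.
    by rewrite fexpD !fexpZ (pexp_xi pE N4) (pexp_xi2 mN pE N4 ab); ring.
  congr (_ * _); have [->|ki] := eqVneq k i.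
    by rewrite (negbTE ij) s2//=; ring.
  have [->|kj] := eqVneq k j.
    rewrite (@eq_fexp _ _ _ (fun A => x i A * x j A * x j A)
      (fun A => x j A * x i A * x j A)); last by move=> A; ring.
    by rewrite s2 1?eq_sym//=; ring.
  rewrite eq_sym in ki; rewrite eq_sym in kj.
  by rewrite (pexp_xi3 mN pE N4 ij ki kj) /=; ring.
have -> : \sum_i \sum_j \sum_k g i j * z k *
   (r3 + ((k == i)%:R + (k == j)%:R) * (c * r2 - r3)) =
  \sum_i \sum_j (g i j * z i + g i j * z j) * (c * r2 - r3).
  apply: eq_bigr => i _; apply: eq_bigr => j _.
  transitivity (g i j * r3 * \sum_k z k + g i j * (c * r2 - r3) *
    (\sum_k (k == i)%:R * z k + \sum_k (k == j)%:R * z k)).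
    rewrite -big_split /= !mulr_sumr -big_split /=.
    by apply: eq_bigr => k _; ring.
  have pick a : \sum_k (k == a)%:R * z k = z a.
    rewrite (bigD1 a)//= big1 ?eqxx ?mul1r ?addr0// => k /negbTE ->.
    by rewrite mul0r.
  by rewrite (sum_z bal) !pick; ring.
under eq_bigr do rewrite -mulr_suml.
rewrite -mulr_suml.
have -> : \sum_i \sum_j (g i j * z i + g i j * z j) = 2 * v ^+ 2.
  under eq_bigr do rewrite big_split /=.
  rewrite big_split /= [X in _ + X]exchange_big /= -(sum_deg_z bal).
  rewrite -big_split mulr_sumr /=; apply: eq_bigr => i _.
  rewrite -!mulr_suml /degR (@eq_bigr _ _ _ _ _ _ (fun j => g j i) (fun j => g i j)).
    by ring.
  by move=> j _; exact: adjRC.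
by field.
Qed.

(** Up to order 1/N for each shared endpoint, and 1/N^2 in general, the moment
    is that of independent labels, which is zero unless the two pairs
    coincide. *)
Lemma pexp_pair i j k l : i != j -> k != l ->
  `|E (fun A => x i A * x j A * (x k A * x l A)) -
    (p * (1 - p)) ^+ 2 * ((k == i)%:R * (l == j)%:R + (k == j)%:R * (l == i)%:R)|
  <= n^-1 * ((k == i)%:R + (l == j)%:R + ((k == j)%:R + (l == i)%:R)) + 2 / n ^+ 2.
Proof.
move=> ij kl; have h8 := n8; have h2 := rho2_le; have h3 := rho3_le.
case/andP: tt => t0 t1.
have n20 : 0 <= 2 / n ^+ 2 by rewrite divr_ge0// sqr_ge0.
have ni0 : 0 <= n^-1 by rewrite invr_ge0.
have n2n : 2 / n ^+ 2 <= n^-1 / 4.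
  rewrite -subr_ge0 (_ : _ - _ = (n - 8) / (4 * n ^+ 2)); last by field; rewrite ?nn0.
  by rewrite divr_ge0 ?mulr_ge0 ?sqr_ge0//; lra.
have e1 : 1 / (2 * n) = n^-1 / 2 by field; rewrite ?nn0.
rewrite e1 in h2.
have same a b : a != b -> `|E (fun A => x a A * x b A * (x a A * x b A)) -
    (p * (1 - p)) ^+ 2| <= n^-1.
  move=> ab.
  have -> : E (fun A => x a A * x b A * (x a A * x b A)) =
    (p * (1 - p)) ^+ 2 + c ^+ 2 * r2.
    transitivity (E (fun A => (p * (1 - p)) ^+ 2 + (p * (1 - p) * c * x a A +
       p * (1 - p) * c * x b A + c ^+ 2 * (x a A * x b A)))).
      apply: eq_fexp => A; have ea := xi_sq p a A; have eb := xi_sq p b A.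
      rewrite (_ : x a A * x b A * _ = x a A ^+ 2 * x b A ^+ 2); last by ring.
      by rewrite ea eb; ring.
    by rewrite !fexpD fexp_cst// !fexpZ !(pexp_xi pE N4) (pexp_xi2 mN pE N4 ab); ring.
  rewrite addrAC subrr add0r normrM.
  have c2 : `|c ^+ 2| <= 1 by rewrite normrX expr_le1// c_le1.
  by have := ler_pM (normr_ge0 _) (normr_ge0 _) c2 h2; lra.
have one a b d : a != b -> a != d -> b != d ->
    `|E (fun A => x a A * x b A * (x a A * x d A))| <= n^-1.
  move=> ab ad bd.
  have -> : E (fun A => x a A * x b A * (x a A * x d A)) = p * (1 - p) * r2 + c * r3.
    transitivity (E (fun A => p * (1 - p) * (x b A * x d A) +
       c * (x a A * x b A * x d A))).
      apply: eq_fexp => A; have ea := xi_sq p a A.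
      rewrite (_ : x a A * x b A * _ = x a A ^+ 2 * (x b A * x d A)); last by ring.
      by rewrite ea; ring.
    by rewrite !fexpD !fexpZ (pexp_xi3 mN pE N4 ab ad bd) (pexp_xi2 mN pE N4 bd).
  apply: le_trans (ler_normD _ _) _.
  rewrite [`|_ * r2|]normrM [`|_ * r3|]normrM (ger0_norm t0).
  have := ler_pM (normr_ge0 _) (normr_ge0 _) c_le1 h3.
  have := ler_pM t0 (normr_ge0 _) t1 h2.
  by lra.
have re (f h : {set 'I_N} -> R) : f =1 h -> E f = E h by exact: eq_fexp.
have ji : j != i by rewrite eq_sym.
have [ki|ki] := eqVneq k i.
  rewrite ki in kl *; rewrite [l == i]eq_sym (negbTE ij) (negbTE kl).
  have [->|lj] := eqVneq l j; first by have := same i j ij; rewrite /= !mul0r !mulr1 addr0 mulr1; lra.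
  have := one i j l ij kl; rewrite [j == l]eq_sym => /(_ lj).
  by rewrite /= ?mulr0 ?mul0r ?addr0 ?mulr0 ?subr0; lra.
have [kj|kj] := eqVneq k j.
  rewrite kj in kl *; rewrite [l == j]eq_sym (negbTE kl).
  have [->|li] := eqVneq l i.
    rewrite (re _ (fun A => x i A * x j A * (x i A * x j A))); last by move=> A; ring.
    by have := same i j ij; rewrite /= !mul0r !mulr1 add0r mulr1; lra.
  rewrite (re _ (fun A => x j A * x i A * (x j A * x l A))); last by move=> A; ring.
  have := one j i l ji kl; rewrite [i == l]eq_sym => /(_ li).
  by rewrite /= ?mulr0 ?mul0r ?addr0 ?mulr0 ?subr0; lra.
rewrite /= !mul0r addr0 mulr0 subr0.
have [li|li] := eqVneq l i.
  rewrite li (negbTE ij).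
  rewrite (re _ (fun A => x i A * x j A * (x i A * x k A))); last by move=> A; ring.
  have := one i j k ij; rewrite ![_ == k]eq_sym => /(_ ki kj).
  by rewrite /=; lra.
have [lj|lj] := eqVneq l j.
  rewrite lj (re _ (fun A => x j A * x i A * (x j A * x k A))); last by move=> A; ring.
  have := one j i k ji; rewrite ![_ == k]eq_sym => /(_ kj ki).
  by rewrite /=; lra.
rewrite (re _ (fun A => x i A * x j A * x k A * x l A)); last by move=> A; ring.
rewrite (pexp_xi4 mN pE N4) 1?[i == k]eq_sym 1?[i == l]eq_sym 1?[j == k]eq_sym 1?[j == l]eq_sym//.
by rewrite /=; have := rho4_le; lra.
Qed.

(** Sum of [pexp_pair] over the pairs of edges: pairs with a common endpoint
    are counted by the squared degrees, and all of them by the fourth power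
    of [s]. *)
Lemma pexp_QQ :
  `|E (fun A => Qform G p A ^+ 2) - (p * (1 - p)) ^+ 2 * s ^+ 2|
  <= (\sum_i degR R G i ^+ 2) / n + 2 * s ^+ 4 / n ^+ 2.
Proof.
pose W i j k l := g i j * g k l.
have sW : \sum_i \sum_j \sum_k \sum_l W i j k l = 4 * s ^+ 4.
  transitivity ((\sum_i degR R G i) * (\sum_i degR R G i)).
    rewrite mulr_suml; apply: eq_bigr => i _; rewrite mulr_suml; apply: eq_bigr => j _.
    by rewrite mulr_sumr; apply: eq_bigr => k _; rewrite mulr_sumr.
  by rewrite sum_degR -(bal_s2 bal); ring.
have pick (f : 'I_N -> R) a : \sum_k (k == a)%:R * f k = f a.
  rewrite (bigD1 a)//= big1 ?eqxx ?mul1r ?addr0// => k /negbTE ->.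
  by rewrite mul0r.
have s2g : \sum_i \sum_j g i j = 2 * s ^+ 2 by rewrite (bal_s2 bal) -sum_degR.
(* the four ways in which two oriented edges may share a prescribed endpoint *)
have sS : \sum_i \sum_j \sum_k \sum_l W i j k l * (k == i)%:R = \sum_i degR R G i ^+ 2.
  apply: eq_bigr => i _; rewrite expr2 [in RHS]mulr_suml; apply: eq_bigr => j _.
  transitivity (\sum_k (k == i)%:R * (g i j * degR R G k)); last exact: pick.
  apply: eq_bigr => k _; rewrite !mulr_sumr; apply: eq_bigr => l _.
  by rewrite /W; ring.
have symk i j k l : W i j k l = W i j l k by rewrite /W (adjRC R G k l).
have symi i j k l : W i j k l = W j i k l by rewrite /W (adjRC R G i j).
have sS1 : \sum_i \sum_j \sum_k \sum_l W i j k l * (l == i)%:R = \sum_i degR R G i ^+ 2.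
  rewrite -sS; apply: eq_bigr => i _; apply: eq_bigr => j _; rewrite exchange_big /=.
  by apply: eq_bigr => k _; apply: eq_bigr => l _; rewrite symk.
have sS2 : \sum_i \sum_j \sum_k \sum_l W i j k l * (k == j)%:R = \sum_i degR R G i ^+ 2.
  rewrite -sS exchange_big; apply: eq_bigr => i _; apply: eq_bigr => j _.
  by apply: eq_bigr => k _; apply: eq_bigr => l _; rewrite symi.
have sS3 : \sum_i \sum_j \sum_k \sum_l W i j k l * (l == j)%:R = \sum_i degR R G i ^+ 2.
  rewrite -sS1 exchange_big; apply: eq_bigr => i _; apply: eq_bigr => j _.
  by apply: eq_bigr => k _; apply: eq_bigr => l _; rewrite symi.
have sD1 : \sum_i \sum_j \sum_k \sum_l W i j k l * ((k == i)%:R * (l == j)%:R) = 2 * s ^+ 2.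
  rewrite -s2g; apply: eq_bigr => i _; apply: eq_bigr => j _.
  transitivity (\sum_k (k == i)%:R * \sum_l (l == j)%:R * W i j k l).
    by apply: eq_bigr => k _; rewrite mulr_sumr; apply: eq_bigr => l _; ring.
  by rewrite pick pick /W -expr2 adjR_sq.
have sD2 : \sum_i \sum_j \sum_k \sum_l W i j k l * ((k == j)%:R * (l == i)%:R) = 2 * s ^+ 2.
  rewrite -sD1 exchange_big; apply: eq_bigr => i _; apply: eq_bigr => j _.
  by apply: eq_bigr => k _; apply: eq_bigr => l _; rewrite symi.
pose t := p * (1 - p).
have eQ : 4 * E (fun A => Qform G p A ^+ 2) =
   \sum_i \sum_j \sum_k \sum_l W i j k l * E (fun A => x i A * x j A * (x k A * x l A)).
  rewrite -fexpZ.
  transitivity (E (fun A => \sum_i \sum_j \sum_k \sum_l W i j k l * (x i A * x j A * (x k A * x l A)))).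
    apply: eq_fexp => A.
    have -> : 4 * Qform G p A ^+ 2 = (\sum_i x i A * Xnb G p i A) * (\sum_i x i A * Xnb G p i A).
      by rewrite /Qform; field.
    rewrite mulr_suml; apply: eq_bigr => i _.
    rewrite [x i A * _]mulr_sumr mulr_suml; apply: eq_bigr => j _.
    rewrite mulr_sumr; apply: eq_bigr => k _.
    by rewrite !mulr_sumr; apply: eq_bigr => l _; rewrite /W; ring.
  rewrite fexp_sum; apply: eq_bigr => i _; rewrite fexp_sum; apply: eq_bigr => j _.
  rewrite fexp_sum; apply: eq_bigr => k _; rewrite fexp_sum; apply: eq_bigr => l _.
  by rewrite fexpZ.
have eT : 4 * (t ^+ 2 * s ^+ 2) = \sum_i \sum_j \sum_k \sum_l W i j k l *
   (t ^+ 2 * ((k == i)%:R * (l == j)%:R + (k == j)%:R * (l == i)%:R)).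
  transitivity (t ^+ 2 * (\sum_i \sum_j \sum_k \sum_l W i j k l * ((k == i)%:R * (l == j)%:R)
    + \sum_i \sum_j \sum_k \sum_l W i j k l * ((k == j)%:R * (l == i)%:R))).
    by rewrite sD1 sD2; ring.
  rewrite -big_split mulr_sumr; apply: eq_bigr => i _ /=.
  rewrite -big_split mulr_sumr; apply: eq_bigr => j _ /=.
  rewrite -big_split mulr_sumr; apply: eq_bigr => k _ /=.
  rewrite -big_split mulr_sumr; apply: eq_bigr => l _ /=.
  by ring.
have eB : \sum_i \sum_j \sum_k \sum_l W i j k l *
    (n^-1 * ((k == i)%:R + (l == j)%:R + ((k == j)%:R + (l == i)%:R)) + 2 / n ^+ 2) =
    4 * ((\sum_i degR R G i ^+ 2) / n + 2 * s ^+ 4 / n ^+ 2).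
  transitivity (n^-1 * ((\sum_i \sum_j \sum_k \sum_l W i j k l * (k == i)%:R +
    \sum_i \sum_j \sum_k \sum_l W i j k l * (l == j)%:R) +
    (\sum_i \sum_j \sum_k \sum_l W i j k l * (k == j)%:R +
    \sum_i \sum_j \sum_k \sum_l W i j k l * (l == i)%:R)) +
    2 / n ^+ 2 * \sum_i \sum_j \sum_k \sum_l W i j k l).
    rewrite -!big_split !mulr_sumr -big_split; apply: eq_bigr => i _ /=.
    rewrite -!big_split !mulr_sumr -big_split; apply: eq_bigr => j _ /=.
    rewrite -!big_split !mulr_sumr -big_split; apply: eq_bigr => k _ /=.
    rewrite -!big_split !mulr_sumr -big_split; apply: eq_bigr => l _ /=.
    by ring.
  by rewrite sS sS1 sS2 sS3 sW; field.
rewrite -(ler_pM2l (_ : 0 < 4)) ?ltr0n// -eB -[X in X * `|_|]ger0_norm// -normrM.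
rewrite mulrBr eQ eT -sumrB; apply: le_trans (ler_norm_sum _ _ _) _; apply: ler_sum => i _.
rewrite -sumrB; apply: le_trans (ler_norm_sum _ _ _) _; apply: ler_sum => j _.
rewrite -sumrB; apply: le_trans (ler_norm_sum _ _ _) _; apply: ler_sum => k _.
rewrite -sumrB; apply: le_trans (ler_norm_sum _ _ _) _; apply: ler_sum => l _.
rewrite -mulrBr normrM ger0_norm; last by rewrite mulr_ge0 ?adjR_ge0.
have [ij|ij] := eqVneq i j; first by rewrite /W ij adjRii !mul0r.
have [kl|kl] := eqVneq k l; first by rewrite /W kl adjRii mulr0 !mul0r.
by rewrite ler_wpM2l ?mulr_ge0 ?adjR_ge0 ?pexp_pair.
Qed.

(** * Covariances of the standardised forms *)

Local Notation U := (Wq G p s tau).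
Local Notation V := (Wl p z v tau).

Let B1 : 1 <= B. Proof. by have := bal_B2 bal; lra. Qed.
Let Bpow (k : nat) : tau^-1 ^+ k <= B ^+ k.
Proof.
rewrite lerXn2r ?nnegrE ?invr_ge0 ?(ltW tau0)//; last exact: bal_B bal.
exact: le_trans B1.
Qed.
Let ti0 : 0 <= tau^-1. Proof. by rewrite invr_ge0 ltW. Qed.
Let ee : eta ^+ 2 <= eta. Proof. by rewrite expr2 ler_piMr// ltW. Qed.
Let tau_neq0 : tau != 0. Proof. by rewrite gt_eqF. Qed.
Let s_neq0 : s != 0. Proof. by rewrite gt_eqF. Qed.
Let v_neq0 : v != 0. Proof. by rewrite gt_eqF. Qed.

Let Bbound (k : nat) (y : R) : 0 <= y -> y <= eta -> tau^-1 ^+ k * y <= B ^+ k * eta.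
Proof.
move=> y0 ye; apply: ler_pM => //; first exact: exprn_ge0.
Qed.

Lemma mean_Wq : `|E U| <= B ^+ 2 * eta.
Proof.
rewrite fexpZ pexp_Q (_ : _ * _ = tau^-1 ^+ 2 * (s * r2)); last first.
  by field; rewrite tau_neq0 s_neq0.
rewrite normrM ger0_norm ?exprn_ge0//; apply: Bbound => //.
rewrite normrM (gtr0_norm s0); apply: le_trans ee.
apply: (@le_trans _ _ (s * (1 / (2 * n)))); first by rewrite ler_wpM2l ?rho2_le// ltW.
have -> : s * (1 / (2 * n)) = s / n / 2 by field.
by have := sn; have := sqr_ge0 eta; lra.
Qed.

Lemma var_Wq : `|E (fun A => (U A - E U) ^+ 2) - 1| <= B ^+ 4 * eta.
Proof.
have -> : E (fun A => (U A - E U) ^+ 2) = E (fun A => U A ^+ 2) - E U ^+ 2.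
  have -> : E (fun A => (U A - E U) ^+ 2) =
      E (fun A => U A ^+ 2) - 2 * E U * E U + E (fun _ : {set 'I_N} => E U ^+ 2).
    rewrite -fexpZ -fexpB -fexpD; apply: eq_fexp => A; ring.
  by rewrite fexp_cst//; ring.
have -> : E (fun A => U A ^+ 2) = tau^-1 ^+ 4 / s ^+ 2 * E (fun A => Qform G p A ^+ 2).
  by rewrite -fexpZ; apply: eq_fexp => A; rewrite /Wq; field; rewrite tau_neq0 s_neq0.
rewrite [E U]fexpZ pexp_Q.
have := pexp_QQ; set q := E _ => hq.
rewrite (_ : _ - _ - 1 = tau^-1 ^+ 4 * ((q - (p * (1 - p)) ^+ 2 * s ^+ 2) / s ^+ 2
   - (s * r2) ^+ 2)); last first.
  by rewrite -(bal_tau2 bal); field; rewrite tau_neq0 s_neq0.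
rewrite normrM ger0_norm ?exprn_ge0//; apply: Bbound => //.
apply: le_trans ee; apply: le_trans (ler_normB _ _) _.
have a1 : `|(q - (p * (1 - p)) ^+ 2 * s ^+ 2) / s ^+ 2| <=
    eta ^+ 2 * (s / n) + 2 * (s / n) ^+ 2.
  rewrite normrM normfV (ger0_norm (sqr_ge0 s)) ler_pdivrMr ?exprn_gt0//.
  apply: le_trans hq _.
  have h := ler_wpM2r (_ : 0 <= n^-1) (bal_deg bal); rewrite invr_ge0 in h.
  apply: (@le_trans _ _ (eta ^+ 2 * s ^+ 3 / n + 2 * s ^+ 4 / n ^+ 2)).
    by rewrite lerD2r h// ltW.
  by rewrite le_eqVlt; apply/orP; left; apply/eqP; field.
have a2 : `|(s * r2) ^+ 2| <= (s / n) ^+ 2.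
  rewrite normrX lerXn2r ?nnegrE ?divr_ge0 ?(ltW s0) ?(ltW n0)//.
  rewrite normrM (gtr0_norm s0) ler_wpM2l ?(ltW s0)//; apply: le_trans rho2_le _.
  by rewrite -subr_ge0 (_ : _ - _ = n^-1 / 2) ?divr_ge0 ?invr_ge0//; field.
have y0 : 0 <= s / n by rewrite divr_ge0// ltW.
have y1 := sn; have e20 := sqr_ge0 eta; have e21 := e2.
have y2 : (s / n) ^+ 2 <= s / n * (eta ^+ 2 / 4) by rewrite expr2 ler_wpM2l.
have y3 : s / n * eta ^+ 2 <= s / n by rewrite ler_piMr.
by lra.
Qed.

Lemma cov_Wq_Wl : `|E (fun A => (U A - E U) * V A)| <= B ^+ 3 * eta.
Proof.
have -> : E (fun A => (U A - E U) * V A) = E (fun A => U A * V A) - E U * E V.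
  by rewrite -fexpZ -fexpB; apply: eq_fexp => A; ring.
have -> : E V = 0 by rewrite fexpZ pexp_L mulr0.
rewrite mulr0 subr0.
have -> : E (fun A => U A * V A) = tau^-1 ^+ 3 / (s * v) * E (fun A => Qform G p A * Lform p z A).
  by rewrite -fexpZ; apply: eq_fexp => A; rewrite /Wq /Wl; field; rewrite tau_neq0 s_neq0 v_neq0.
rewrite pexp_QL (_ : _ / _ * _ = tau^-1 ^+ 3 * ((c * r2 - r3) * (v / s))); last first.
  by field; rewrite tau_neq0 s_neq0 v_neq0.
rewrite normrM ger0_norm ?exprn_ge0//; apply: Bbound => //.
have vs : `|v / s| <= eta * n.
  rewrite ger0_norm; last by rewrite divr_ge0// ltW.
  rewrite ler_pdivrMr//.
  rewrite -(@ler_pXn2r _ 2)// ?nnegrE ?mulr_ge0 ?(ltW v0) ?(ltW eta0) ?(ltW n0) ?(ltW s0)//.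
  apply: le_trans (bal_v2le bal) _.
  have -> : (eta * n * s) ^+ 2 = eta ^+ 2 * s ^+ 2 * n ^+ 2 by ring.
  rewrite (_ : eta ^+ 2 * s ^+ 3 = eta ^+ 2 * s ^+ 2 * s); last by ring.
  rewrite ler_wpM2l ?mulr_ge0 ?(ltW s0) ?(ltW eta0)//.
  have h : s <= eta ^+ 2 / 4 * n by rewrite -ler_pdivrMr.
  have := n8; have := e2; have := s0.
  have : eta ^+ 2 / 4 * n <= 1 / 4 * n by rewrite ler_wpM2r ?(ltW n0)//; have := e2; lra.
  by nra.
have rr : `|c * r2 - r3| <= 1 / n.
  apply: le_trans (ler_normB _ _) _.
  have h2 := rho2_le; have h3 := rho3_le; have h8 := n8.
  have h4 : `|c * r2| <= 1 / (2 * n).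
    by rewrite [`|_ * r2|]normrM; apply: le_trans h2; rewrite ler_piMl// c_le1.
  apply: le_trans (lerD h4 h3) _; rewrite -subr_ge0.
  rewrite (_ : _ - _ = (n - 4) / (2 * n ^+ 2)); last by field.
  by rewrite divr_ge0 ?mulr_ge0 ?sqr_ge0//; lra.
rewrite normrM.
have := ler_pM (normr_ge0 _) (normr_ge0 _) rr vs.
by rewrite (_ : 1 / n * (eta * n) = eta); last by field.
Qed.

Lemma var_Wl : `|E (fun A => V A ^+ 2) - 1| <= B ^+ 2 * eta.
Proof.
have -> : E (fun A => V A ^+ 2) = (tau * v) ^- 2 * E (fun A => Lform p z A ^+ 2).
  by rewrite -fexpZ; apply: eq_fexp => A; rewrite /Wl exprMn exprVn.
rewrite pexp_LL -(bal_tau2 bal).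
rewrite (_ : _ - 1 = - (tau^-1 ^+ 2 * r2)); last by field; rewrite tau_neq0 v_neq0.
rewrite normrN [`|_ * r2|]normrM ger0_norm ?exprn_ge0//; apply: Bbound => //.
apply: le_trans rho2_le _; apply: le_trans ee.
have s2 := bal_s2le bal; have y1 := sn.
have : 2 / n <= s / n by rewrite ler_wpM2r ?invr_ge0 ?(ltW n0).
rewrite (_ : 1 / (2 * n) = 2 / n / 4); last by field.
by have := sqr_ge0 eta; lra.
Qed.

End Covariance.

(** * The Laplace transform under independent labels *)

Lemma is_derive_fsum (R : realType) (T : finType) (F : T -> R -> R) (dF : T -> R)
    (t : R) :
  (forall x, is_derive t 1 (F x) (dF x)) ->
  is_derive t 1 (fun s => \sum_x F x s) (\sum_x dF x).
Proof.
move=> h; elim: (index_enum T) => [|x r IH].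
  rewrite big_nil (_ : (fun s => _) = fun=> 0); first exact: is_derive_fcst.
  by apply/funext => s; rewrite big_nil.
rewrite big_cons (_ : (fun s => _) = fun s => F x s + \sum_(y <- r) F y s).
  exact: is_derive_fadd.
by apply/funext => s; rewrite big_cons.
Qed.

Section Laplace.
Variables (R : realType) (N : nat) (G : sgraph N) (p : R) (z : 'I_N -> R).
Variables (s v tau B eta : R).
Hypothesis bal : balanced G p z s v tau B eta.
Implicit Types (i j k : 'I_N) (A : {set 'I_N}).
Local Notation E := (fexp (bweight p)).
Local Notation x := (xi p).
Local Notation U := (Wq G p s tau).
Local Notation V := (Wl p z v tau).

Let p01 := bal_p bal.
Let s0 := bal_s bal.
Let v0 := bal_v bal.
Let tau0 := bal_tau bal.
Let eta0 : 0 < eta. Proof. by case/andP: (bal_eta bal). Qed.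
Let eta1 : eta <= 1. Proof. by case/andP: (bal_eta bal). Qed.
Let w1 := sum_bweight N p.

(** The derivative in [a] of the product on the left is -1/2 times the quantity
    bounded by [stein_bound], and the product is 1 at [a = 0]. *)
Lemma bern_laplace (a : R) : 0 <= a ->
  `|(1 + a) * E (fun A => gauss a (U A) (V A)) - 1|
    <= a * ((850 + 5 * a) * B ^+ 8 * eta).
Proof.
move=> a0.
pose D (b : R) := - (1/2) * E (fun A =>
  ((1 + b) * (U A ^+ 2 + V A ^+ 2) - 2) * gauss b (U A) (V A)).
pose h (b : R) := \sum_A bweight p A * ((1 + b) * gauss b (U A) (V A)).
have dh (b : R) : is_derive b 1 h (D b).
  have dA A : is_derive b 1 (fun b : R => bweight p A * ((1 + b) * gauss b (U A) (V A)))
     (bweight p A * (gauss b (U A) (V A) - (1 + b) * gauss b (U A) (V A) *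
        (1/2 * (U A ^+ 2 + V A ^+ 2)))).
    have d1 := is_derive_aff 1 1 b.
    have d2 := is_derive_fexp (is_derive_fmul (is_derive_fcst (- (1/2)) b)
      (is_derive_fmul (is_derive_aff 0 1 b) (is_derive_fcst (U A ^+ 2 + V A ^+ 2) b))).
    have d3 := is_derive_fmul (is_derive_fcst (bweight p A) b) (is_derive_fmul d1 d2).
    have e : (fun s : R => bweight p A * ((1 + s * 1) *
       expR (- (1 / 2) * ((0 + s * 1) * (U A ^+ 2 + V A ^+ 2))))) =
      (fun b : R => bweight p A * ((1 + b) * gauss b (U A) (V A))).
      by apply/funext => t; rewrite /gauss !mulr1 add0r.
    rewrite -e; apply: is_derive_eq d3 _.
    by rewrite /gauss !mulr1 add0r; field.
  have := is_derive_fsum dA; rewrite -/h => hd; apply: is_derive_eq hd _.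
  rewrite /D -fexpZ; apply: eq_bigr => A _; congr (_ * _).
  by field.
have [b /andP[b0 ba]] := MVT_everywhere a0 dh.
have -> : h a = (1 + a) * E (fun A => gauss a (U A) (V A)) by rewrite -fexpZ.
have -> : h 0 = 1.
  rewrite -[RHS](fexp_cst w1 1); apply: eq_bigr => A _.
  by rewrite /gauss mul0r mulr0 expR0 addr0 mulr1.
rewrite subr0 => ->.
rewrite normrM (ger0_norm a0) mulrC ler_wpM2l// /D normrM.
have := stein_bound bal b0; set X := `|E _|.
have -> : `|- (1 / 2)| = 1 / 2 :> R by rewrite normrN ger0_norm// divr_ge0.
move=> hX; have B1 := bal_B2 bal.
have BE : 0 <= B ^+ 8 * eta by rewrite mulr_ge0 ?exprn_ge0 ?(ltW eta0)//; lra.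
have := ler_wpM2r BE (_ : 1700 + 9 * b <= 1700 + 10 * a).
have : 1700 + 9 * b <= 1700 + 10 * a by lra.
move=> h1 /(_ h1) h2.
by lra.
Qed.

(** * From independent labels to a fixed number of ones *)

(** Given the number of ones, independent labels are uniform. *)
Lemma bexp_mix (f : {set 'I_N} -> R) :
  E f = E (fun A => fexp (pweight R #|A|) f).
Proof.
have cardN A : (#|A| < N.+1)%N.
  by rewrite ltnS -[X in (_ <= X)%N](card_ord N) max_card.
rewrite /fexp (partition_big (fun A => inord #|A| : 'I_N.+1) xpredT)//=.
rewrite [RHS](partition_big (fun A => inord #|A| : 'I_N.+1) xpredT)//=.
apply: eq_bigr => k _.
have eP A : (inord #|A| == k :> 'I_N.+1) = (#|A| == k).
  by rewrite -(inj_eq val_inj) /= inordK.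
under eq_bigl do rewrite eP.
under [RHS]eq_bigl do rewrite eP.
pose w := p ^+ k * (1 - p) ^+ (N - k).
transitivity (w * \sum_(A : {set 'I_N} | #|A| == k) f A).
  by rewrite mulr_sumr; apply: eq_bigr => A /eqP Ak; rewrite /bweight Ak.
transitivity (\sum_(A : {set 'I_N} | #|A| == k) w * fexp (pweight R k) f); last first.
  by apply: eq_bigr => A /eqP Ak; rewrite /bweight Ak.
have -> : \sum_(A : {set 'I_N} | #|A| == k) w * fexp (pweight R k) f =
  \sum_(A in [set A : {set 'I_N} | #|A| == k]%SET) w * fexp (pweight R k) f.
  by apply: eq_bigl => A; rewrite inE.
rewrite sumr_const card_draws card_ord -[RHS]mulr_natl mulrCA; congr (_ * _).
rewrite -perm_expectE /perm_expect mulr_sumr; apply: eq_bigr => A _.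
by rewrite mulrC divfK// pnatr_eq0 -lt0n bin_gt0 -ltnS ltn_ord.
Qed.

(** A uniform set of [k.+1] nodes is a uniform set of [k] nodes together with
    a uniform node outside of it. *)
Lemma pexp_step (k : nat) (F : {set 'I_N} -> R) : (k < N)%N ->
  fexp (pweight R k.+1) F =
  (N%:R - k%:R)^-1 * fexp (pweight R k) (fun A => \sum_(i | i \notin A) F (i |: A)%SET).
Proof.
move=> kN.
pose S := \sum_(A : {set 'I_N}) (#|A| == k.+1)%:R * F A.
have eS : \sum_(A : {set 'I_N}) (#|A| == k)%:R * (\sum_(i | i \notin A) F (i |: A)%SET)
    = k.+1%:R * S.
  transitivity (\sum_i \sum_(A : {set 'I_N} | i \notin A) (#|A| == k)%:R * F (i |: A)%SET).
    rewrite (exchange_big_dep xpredT)//=; apply: eq_bigr => A _.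
    by rewrite mulr_sumr.
  transitivity (\sum_i \sum_(A : {set 'I_N} | i \in A) (#|A| == k.+1)%:R * F A).
    apply: eq_bigr => i _.
    rewrite [RHS](reindex_onto (fun A => i |: A) (fun A => A :\ i))%SET /=; last first.
      by move=> A iA; rewrite finset.setD1K.
    apply: eq_big => [A|A iA]; last by rewrite cardsU1 iA.
    rewrite finset.setU11 /=; apply/idP/idP => [iA|/eqP <-].
      by rewrite finset.setU1K.
    by rewrite !inE eqxx.
  rewrite (exchange_big_dep xpredT)//= /S mulr_sumr; apply: eq_bigr => A _.
  rewrite sumr_const -[LHS]mulr_natl mulrA; case: eqP => [->|_].
    by rewrite mulr1 mul1r.
  by rewrite mulr0 !mul0r mulr0.
have C0 (j : nat) : (j <= N)%N -> ('C(N, j))%:R != 0 :> R.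
  by move=> jN; rewrite pnatr_eq0 -lt0n bin_gt0.
have Nk : N%:R - k%:R != 0 :> R by rewrite subr_eq0 eqr_nat gtn_eqF.
have bin : k.+1%:R * ('C(N, k.+1))%:R = (N%:R - k%:R) * ('C(N, k))%:R :> R.
  by rewrite -natrB ?(ltnW kN)// -!natrM mul_bin_left.
have -> : fexp (pweight R k.+1) F = ('C(N, k.+1))%:R^-1 * S.
  by rewrite /S mulr_sumr; apply: eq_bigr => A _; rewrite /pweight; ring.
have -> : fexp (pweight R k) (fun A => \sum_(i | i \notin A) F (i |: A)%SET) =
   ('C(N, k))%:R^-1 * (k.+1%:R * S).
  by rewrite -eS mulr_sumr; apply: eq_bigr => A _; rewrite /pweight; ring.
have := C0 _ kN; have := C0 _ (ltnW kN); move: bin.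
set c1 := ('C(N, k.+1))%:R; set c0 := ('C(N, k))%:R => bin c00 c10.
have k0 : k.+1%:R != 0 :> R by rewrite pnatr_eq0.
by rewrite [RHS]mulrA -invfM -bin invfM mulrACA mulVf// mul1r.
Qed.

Let c1 : 0 <= 1 - p. Proof. by case/andP: p01; lra. Qed.

(** The conditional mean of an increment over the node to be added, split into
    its mean over all nodes and a correction in the centred labels. *)
Lemma sum_notin (h : 'I_N -> R) A :
  \sum_(i | i \notin A) h i = (1 - p) * \sum_i h i - \sum_i x i A * h i.
Proof.
rewrite big_mkcond mulr_sumr -sumrB; apply: eq_bigr => i _; rewrite /xi.
by case: (i \in A) => /=; ring.
Qed.

Lemma sum_xi_card A : \sum_i x i A = #|A|%:R - N%:R * p.
Proof.
rewrite /xi sumrB sumr_const card_ord -[p *+ N]mulr_natl.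
by rewrite -natr_sum -big_mkcond sum1_card.
Qed.

Let tau_neq0 : tau != 0. Proof. by rewrite gt_eqF. Qed.
Let s_neq0 : s != 0. Proof. by rewrite gt_eqF. Qed.
Let v_neq0 : v != 0. Proof. by rewrite gt_eqF. Qed.
Let N_neq0 : N%:R != 0 :> R. Proof. by rewrite gt_eqF// (bal_N0 bal). Qed.

Lemma sum_Xnb A : \sum_i Xnb G p i A =
  tau * v * V A + 2 * s ^+ 2 / N%:R * (#|A|%:R - N%:R * p).
Proof.
rewrite -sum_xi_card.
have -> : \sum_i Xnb G p i A = \sum_j degR R G j * x j A.
  rewrite exchange_big; apply: eq_bigr => j _; rewrite -mulr_suml; congr (_ * _).
  by apply: eq_bigr => i _; exact: adjRC.
rewrite mulr_sumr (_ : tau * v * V A = Lform p z A); last first.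
  by rewrite /Wl mulrA mulfV ?mul1r// mulf_neq0.
rewrite -big_split; apply: eq_bigr => j _ /=.
by rewrite (bal_z bal); ring.
Qed.

(** Adding a node at random pulls both forms towards zero, up to terms that are
    small compared with the number of nodes. *)
Lemma drift_q A : \sum_(i | i \notin A) Yq G p s tau i A =
  (1 - p) * (v / (tau * s) * V A + 2 * s / (N%:R * tau ^+ 2) * (#|A|%:R - N%:R * p))
  - 2 * U A.
Proof.
rewrite sum_notin -mulr_sumr sum_Xnb.
have -> : \sum_i x i A * Yq G p s tau i A = 2 * U A.
  rewrite /Wq /Qform !mulr_sumr; apply: eq_bigr => i _; rewrite /Yq.
  by field; rewrite tau_neq0 s_neq0.
by field; rewrite tau_neq0 s_neq0 N_neq0.
Qed.

Lemma drift_l A : \sum_(i | i \notin A) Yl z v tau i = - V A.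
Proof.
rewrite sum_notin -mulr_sumr (sum_z bal) !mulr0 sub0r; congr (- _).
by rewrite /Wl /Lform mulr_sumr; apply: eq_bigr => i _; rewrite /Yl; ring.
Qed.

(** The labels are centred at [p], which differs from the proportion [k / N] of
    ones; the last term is the bias that this causes. *)
Lemma pexp_Xnb_sq (k : nat) i : (k <= N)%N ->
  fexp (pweight R k) (fun A => Xnb G p i A ^+ 2) <= degR R G i +
   degR R G i ^+ 2 * (1 / (2 * N%:R) + ((k%:R - N%:R * p) / N%:R) ^+ 2).
Proof.
move=> kN.
have n8 := bal_N8 bal.
have N4 : (4 <= N)%N by rewrite -(ler_nat R); lra.
pose p' : R := k%:R / N%:R.
have pE : N%:R * p' = k%:R by rewrite mulrC divfK.
pose de := p' - p.
have dE : (k%:R - N%:R * p) / N%:R = de by rewrite /de /p'; field.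
have sh j A : x j A = xi p' j A + de by rewrite /xi /de; ring.
have rho : `|rho2 N p'| <= 1 / (2 * N%:R).
  have p'0 : 0 <= p' by rewrite divr_ge0 ?ler0n.
  have p'1 : p' <= 1 by rewrite ler_pdivrMr ?(bal_N0 bal)// mul1r ler_nat.
  have t0 : 0 <= p' * (1 - p') by rewrite mulr_ge0// subr_ge0.
  rewrite /rho2 normrM normrN normfV (ger0_norm t0) ger0_norm; last by lra.
  rewrite ler_pdivrMr; last by lra.
  apply: (@le_trans _ _ (1/4)); first by have := sqr_ge0 (p' - 1/2); nra.
  rewrite -subr_ge0 (_ : _ - _ = (N%:R - 2) / (4 * N%:R)); last by field.
  by rewrite divr_ge0//; lra.
set rr := 1 / _ + _.
have rr0 : 0 <= rr.
  by rewrite /rr addr_ge0 ?sqr_ge0// divr_ge0// mulr_ge0 ?ler0n.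
have pair j l : fexp (pweight R k) (fun A => x j A * x l A) <= rr + (l == j)%:R.
  have [->|lj] := eqVneq l j.
    rewrite -[leLHS]add0r lerD//= -[leRHS](fexp_cst (sum_pweight R kN)).
    apply: ler_fexp => [A|A]; first exact: pweight_ge0.
    by rewrite -expr2 -real_normK ?num_real// expr_le1// xi_norm.
  rewrite addr0.
  have -> : fexp (pweight R k) (fun A => x j A * x l A) = rho2 N p' + de ^+ 2.
    rewrite (@eq_fexp _ _ _ _ (fun A => xi p' j A * xi p' l A +
      (de * xi p' j A + de * xi p' l A + de ^+ 2))); last first.
      by move=> A; rewrite !sh; ring.
    rewrite !fexpD !fexpZ !(pexp_xi pE N4) fexp_cst ?sum_pweight//.
    by rewrite (pexp_xi2 kN pE N4) 1?eq_sym// !mulr0 !add0r.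
  by rewrite /rr dE lerD2r; apply: le_trans rho; exact: ler_norm.
have -> : fexp (pweight R k) (fun A => Xnb G p i A ^+ 2) = \sum_j \sum_l
    adjR R G i j * adjR R G i l * fexp (pweight R k) (fun A => x j A * x l A).
  transitivity (fexp (pweight R k) (fun A => \sum_j \sum_l
      adjR R G i j * adjR R G i l * (x j A * x l A))).
    apply: eq_fexp => A; rewrite expr2 mulr_suml; apply: eq_bigr => j _.
    by rewrite mulr_sumr; apply: eq_bigr => l _; ring.
  rewrite fexp_sum; apply: eq_bigr => j _; rewrite fexp_sum.
  by apply: eq_bigr => l _; rewrite fexpZ.
apply: (@le_trans _ _ (\sum_j \sum_l adjR R G i j * adjR R G i l * (rr + (l == j)%:R))).
  apply: ler_sum => j _; apply: ler_sum => l _.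
  by rewrite ler_wpM2l ?pair// mulr_ge0 ?adjR_ge0.
rewrite le_eqVlt; apply/orP; left; apply/eqP.
have -> : degR R G i ^+ 2 * rr = \sum_j \sum_l adjR R G i j * (adjR R G i l * rr).
  rewrite expr2 -mulrA {1}/degR mulr_suml; apply: eq_bigr => j _.
  by rewrite /degR mulr_suml mulr_sumr.
rewrite addrC [X in _ + X]/degR -big_split /=; apply: eq_bigr => j _.
transitivity (\sum_l adjR R G i j * (adjR R G i l * rr) +
   \sum_l (l == j)%:R * (adjR R G i j * adjR R G i l)).
  by rewrite -big_split; apply: eq_bigr => l _ /=; ring.
congr (_ + _); rewrite (bigD1 j)//= [X in _ + X]big1 ?eqxx.
  by rewrite mul1r addr0 -expr2 adjR_sq.
by move=> l /negbTE ->; rewrite mul0r.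
Qed.

End Laplace.

(** * Adding one node to the label set *)

Section Transfer.
Variables (R : realType) (N : nat) (G : sgraph N) (p : R) (z : 'I_N -> R).
Variables (s v tau B eta : R).
Hypothesis bal : balanced G p z s v tau B eta.
Variable a : R.
Hypothesis a0 : 0 <= a.
Implicit Types (i j : 'I_N) (A : {set 'I_N}).
Local Notation E := (fexp (bweight p)).
Local Notation x := (xi p).
Local Notation U := (Wq G p s tau).
Local Notation V := (Wl p z v tau).
Local Notation n := (N%:R : R).
Local Notation f := (fun A => gauss a (U A) (V A)).
Local Notation M k := (fexp (pweight R k) f).

Let p01 := bal_p bal.
Let s0 := bal_s bal.
Let v0 := bal_v bal.
Let tau0 := bal_tau bal.
Let eta0 : 0 < eta. Proof. by case/andP: (bal_eta bal). Qed.
Let eta1 : eta <= 1. Proof. by case/andP: (bal_eta bal). Qed.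
Let w0 (A : {set 'I_N}) := @bweight_ge0 R N p A p01.
Let w1 := sum_bweight N p.
Let tau_neq0 : tau != 0. Proof. by rewrite gt_eqF. Qed.
Let s_neq0 : s != 0. Proof. by rewrite gt_eqF. Qed.
Let v_neq0 : v != 0. Proof. by rewrite gt_eqF. Qed.
Let n0 : 0 < n. Proof. exact: bal_N0 bal. Qed.
Let N_neq0 : n != 0. Proof. by rewrite gt_eqF. Qed.
Let ti0 : 0 < tau^-1. Proof. by rewrite invr_gt0. Qed.

(** Second-order Taylor expansion of the test function at the added node. The
    first-order terms add up to the drift; it is of degree two in the forms
    and the exponential makes it bounded. *)
Lemma flip_bound A :
  `|\sum_(i | i \notin A) (f (i |: A)%SET - f A)| <=
   v / (tau * s) + (a + 2) * (s / (n * tau ^+ 2) * `|#|A|%:R - n * p|) + 4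
   + 3 * a * (tau^-1 ^+ 2 + tau^-1 ^+ 4 / s ^+ 2 * \sum_i Xnb G p i A ^+ 2).
Proof.
pose Y i := Yq G p s tau i A; pose Z i := Yl z v tau i.
have fU i : i \notin A -> f (i |: A)%SET = gauss a (U A + Y i) (V A + Z i).
  move=> iA; rewrite /Wq QformU1// /Wl LformU1//.
  by rewrite /Y /Z /Yq /Yl !mulrDr.
rewrite (eq_bigr (fun i => (gauss a (U A + Y i) (V A + Z i) - f A +
  a * (U A * Y i + V A * Z i) * f A) - a * (U A * Y i + V A * Z i) * f A)); last first.
  by move=> i iA; rewrite fU//; ring.
rewrite sumrB addrC; apply: le_trans (ler_normD _ _) _; apply: lerD; last first.
  apply: le_trans (ler_norm_sum _ _ _) _.
  apply: (@le_trans _ _ (\sum_i 3 * a * (Y i ^+ 2 + Z i ^+ 2))).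
    rewrite big_mkcond; apply: ler_sum => i _; case: ifP => _.
      exact: gauss_taylor.
    by rewrite mulr_ge0 ?addr_ge0 ?sqr_ge0// mulr_ge0.
  rewrite -mulr_sumr big_split /= ler_wpM2l ?mulr_ge0//.
  have -> : \sum_i Z i ^+ 2 = tau^-1 ^+ 2.
    transitivity ((tau * v) ^- 2 * \sum_i z i ^+ 2).
      by rewrite mulr_sumr; apply: eq_bigr => i _; rewrite /Z /Yl exprMn exprVn.
    by rewrite -(bal_v2 bal); field; rewrite tau_neq0 v_neq0.
  rewrite addrC lerD2l le_eqVlt; apply/orP; left; apply/eqP.
  rewrite mulr_sumr; apply: eq_bigr => i _; rewrite /Y /Yq.
  by field; rewrite tau_neq0 s_neq0.
have dY : \sum_(i | i \notin A) Y i = _ := drift_q bal A.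
have dZ : \sum_(i | i \notin A) Z i = _ := drift_l bal A.
clearbody Y Z.
rewrite normrN -mulr_suml -mulr_sumr big_split /= -!mulr_sumr dY dZ.
set de := #|A|%:R - n * p.
have [h _] := gauss_decay a0 (U A) (V A).
have g0 := gauss_gt0 a (U A) (V A); have g1 := gauss_le1 a0 (U A) (V A).
move: h g0 g1; set g := gauss _ _ _; move: (U A) (V A) => u w h g0 g1.
have ag : 0 <= a * g by rewrite mulr_ge0// ltW.
have uw : `|a * g * (u * w)| <= 1.
  have q1 := mulr_ge0 ag (sqr_ge0 (u - w)); have q2 := mulr_ge0 ag (sqr_ge0 (u + w)).
  rewrite sqrrB in q1; rewrite sqrrD in q2.
  by rewrite ler_norml; apply/andP; split; lra.
have u1 : `|a * g * u| <= (a + 2) / 2.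
  have q1 := mulr_ge0 ag (sqr_ge0 (u - 1)); have q2 := mulr_ge0 ag (sqr_ge0 (u + 1)).
  have q3 := mulr_ge0 ag (sqr_ge0 w); have q4 := ler_wpM2l a0 g1.
  rewrite sqrrB in q1; rewrite sqrrD in q2.
  by rewrite ler_norml; apply/andP; split; lra.
have u2 : `|a * g * (2 * u ^+ 2 + w ^+ 2)| <= 4.
  have q1 := mulr_ge0 ag (sqr_ge0 u); have q2 := mulr_ge0 ag (sqr_ge0 w).
  by rewrite ler_norml; apply/andP; split; lra.
have -> : a * (u * ((1 - p) * (v / (tau * s) * w + 2 * s / (n * tau ^+ 2) * de) - 2 * u) + w * - w) * g
  = (1 - p) * (v / (tau * s)) * (a * g * (u * w)) +
    (1 - p) * (2 * s / (n * tau ^+ 2) * de) * (a * g * u) -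
    a * g * (2 * u ^+ 2 + w ^+ 2) by ring.
have /andP[q0 q1] : 0 <= 1 - p <= 1 by case/andP: p01; lra.
have vt : 0 <= v / (tau * s) by rewrite divr_ge0 ?mulr_ge0// ltW.
have st : 0 <= s / (n * tau ^+ 2) by rewrite divr_ge0 ?mulr_ge0 ?exprn_ge0// ltW.
apply: le_trans (ler_normB _ _) (lerD _ u2); apply: le_trans (ler_normD _ _) (lerD _ _).
  rewrite normrM (ger0_norm (mulr_ge0 q0 vt)) -[leRHS]mulr1.
  exact: ler_pM (mulr_ge0 q0 vt) (normr_ge0 _) (ler_piMl vt q1) uw.
rewrite normrM [leRHS](_ : _ = 2 * s / (n * tau ^+ 2) * `|de| * ((a + 2) / 2)); last first.
  by field; rewrite N_neq0 tau_neq0.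
apply: ler_pM => //.
have st2 : 0 <= 2 * s / (n * tau ^+ 2) by rewrite -mulrA mulr_ge0.
rewrite normrM (ger0_norm q0) normrM (ger0_norm st2) ler_piMl// mulr_ge0//.
Qed.

Definition step_err (k : nat) : R :=
  v / (tau * s) + (a + 2) * (s / (n * tau ^+ 2) * `|k%:R - n * p|) + 4
   + 3 * a * (tau^-1 ^+ 2 + tau^-1 ^+ 4 / s ^+ 2 * (2 * s ^+ 2 +
      (\sum_i degR R G i ^+ 2) * (1 / (2 * n) + ((k%:R - n * p) / n) ^+ 2))).

Lemma step_bound (k : nat) : (k < N)%N ->
  `|M k.+1 - M k| <= (n - k%:R)^-1 * step_err k.
Proof.
move=> kN.
have nk : 0 < n - k%:R by rewrite subr_gt0 ltr_nat.
have pw0 A : 0 <= pweight R k A := pweight_ge0 R k A.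
have -> : M k.+1 - M k = (n - k%:R)^-1 *
    fexp (pweight R k) (fun A => \sum_(i | i \notin A) (f (i |: A)%SET - f A)).
  rewrite pexp_step// (_ : M k = (n - k%:R)^-1 *
    fexp (pweight R k) (fun A => \sum_(i | i \notin A) f A)).
    rewrite -mulrBr -fexpB; congr (_ * _); apply: eq_fexp => A.
    by rewrite sumrB.
  rewrite (@eq_pexp _ _ _ (fun A => \sum_(i | i \notin A) f A) (fun A => (n - k%:R) * f A)).
    by rewrite fexpZ mulrA mulVf ?mul1r// gt_eqF.
  move=> A Ak; rewrite sumr_const -[LHS]mulr_natl; congr (_ * _).
  have -> : n = #|A|%:R + #|[predC A]|%:R by rewrite -natrD cardC card_ord.
  by rewrite -Ak addrAC subrr add0r.
rewrite normrM ger0_norm ?invr_ge0 ?(ltW nk)// ler_wpM2l ?invr_ge0 ?(ltW nk)//.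
apply: le_trans (ler_norm_fexp pw0 _) _.
apply: le_trans (ler_fexp pw0 flip_bound) _.
rewrite !fexpD !fexpZ fexpD !fexpZ !fexp_cst ?sum_pweight ?(ltnW kN)//.
rewrite (@eq_pexp _ _ _ (fun A => `|#|A|%:R - n * p|) (fun=> `|k%:R - n * p|)); last first.
  by move=> A ->.
rewrite fexp_cst ?sum_pweight ?(ltnW kN)// /step_err lerD2l.
rewrite ler_wpM2l ?mulr_ge0// lerD2l ler_wpM2l ?divr_ge0 ?sqr_ge0 ?exprn_ge0 ?(ltW ti0)//.
rewrite fexp_sum.
have -> : 2 * s ^+ 2 = \sum_i degR R G i by rewrite sum_degR (bal_s2 bal).
rewrite mulr_suml -big_split; apply: ler_sum => i _ /=.
exact: (pexp_Xnb_sq bal i (ltnW kN)).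
Qed.

Variable m : nat.
Hypothesis mN : (m <= N)%N.
Hypothesis pE : n * p = m%:R.
Variable h : R.
Hypothesis h1 : 1 <= h.

Let nu : R := Num.sqrt n.
Let nu0 : 0 < nu. Proof. by rewrite sqrtr_gt0. Qed.
Let nu2 : nu ^+ 2 = n. Proof. by rewrite sqr_sqrtr// ltW. Qed.
Let nu_neq0 : nu != 0. Proof. by rewrite gt_eqF. Qed.
Let B2 : 2 <= B := bal_B2 bal.
Let B1 : 1 <= B. Proof. by have := B2; lra. Qed.
Let B0 : 0 <= B. Proof. by have := B2; lra. Qed.
Let h0 : 0 <= h. Proof. by have := h1; lra. Qed.
Let Bpow (k : nat) : tau^-1 ^+ k <= B ^+ k.
Proof. by rewrite lerXn2r ?nnegrE ?(ltW ti0)//; exact: bal_B bal. Qed.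
Let e2 : eta ^+ 2 <= 1. Proof. by rewrite expr_le1// ltW. Qed.
Let sn : s / n <= eta ^+ 2 / 4.
Proof. by rewrite ler_pdivrMr//; have := bal_sN bal; lra. Qed.
Let sn0 : 0 <= s / n. Proof. by rewrite divr_ge0// ltW. Qed.

Let nui : nu^-1 <= eta ^+ 2 / 2.
Proof.
rewrite -(@ler_pXn2r _ 2)// ?nnegrE ?invr_ge0 ?(ltW nu0) ?divr_ge0 ?sqr_ge0//.
rewrite exprVn nu2 -[leLHS]mul1r ler_pdivrMr//.
have := bal_sN bal; have := bal_sbig bal; have := e2; have := sqr_ge0 eta.
move=> a1 a2 a3 a4; have := ler_wpM2l a1 a4; rewrite expr2 mulrA; lra.
Qed.

Let vs : v / (s * nu) <= eta ^+ 2 / 2.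
Proof.
have snu : 0 < s * nu by rewrite mulr_gt0.
rewrite -(@ler_pXn2r _ 2)// ?nnegrE ?divr_ge0 ?(ltW v0) ?(ltW snu) ?sqr_ge0//.
apply: (@le_trans _ _ (eta ^+ 2 * (s / n))); last first.
  have -> : (eta ^+ 2 / 2) ^+ 2 = eta ^+ 2 * (eta ^+ 2 / 4) by field.
  by rewrite ler_wpM2l ?sqr_ge0.
have -> : (v / (s * nu)) ^+ 2 = v ^+ 2 / (s ^+ 2 * n).
  by rewrite -nu2; field; rewrite s_neq0 nu_neq0.
rewrite ler_pdivrMr ?mulr_gt0 ?exprn_gt0//; apply: le_trans (bal_v2le bal) _.
by rewrite le_eqVlt; apply/orP; left; apply/eqP; field.
Qed.

(* a bound for one step within [h] times the square root of N of the mean *)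
Let S0 : R := 2 * B ^+ 2 / n * (v / s * B + (a + 2) * B ^+ 2 * (h * nu * (s / n))
  + 4 + 12 * a * B ^+ 4 * h ^+ 2).

(** Within the window a positive proportion of the nodes remains to be added,
    so that the average over these nodes costs at most [2 * B ^+ 2 / N]. *)
Lemma step_unif (k : nat) : (k < N)%N -> `|k%:R - n * p| <= h * nu ->
  h * nu <= n / (2 * B ^+ 2) -> `|M k.+1 - M k| <= S0.
Proof.
move=> kN kw hw; apply: le_trans (step_bound kN) _.
have nk : 0 < n - k%:R by rewrite subr_gt0 ltr_nat.
have BB : 0 < B ^+ 2 by rewrite exprn_gt0//; have := B2; lra.
have q1 : 1 / B ^+ 2 <= 1 - p.
  apply: (@le_trans _ _ (tau ^+ 2)).
    rewrite ler_pdivrMr// -exprMn exprn_ege1//.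
    by have := ler_wpM2l (ltW tau0) (bal_B bal); rewrite mulfV.
  by rewrite (bal_tau2 bal); case/andP: p01 => p0 p1; nra.
have nk2 : n / (2 * B ^+ 2) <= n - k%:R.
  have := ler_wpM2l (ltW n0) q1.
  rewrite (_ : n * (1 / B ^+ 2) = 2 * (n / (2 * B ^+ 2))); last first.
    by field; rewrite gt_eqF//; have := B2; lra.
  by move: kw; rewrite ler_norml => /andP[_]; lra.
rewrite /S0; apply: ler_pM.
- by rewrite invr_ge0 ltW.
- rewrite -(pmulr_rge0 _ (_ : 0 < (n - k%:R)^-1)) ?invr_gt0//.
  exact: le_trans (normr_ge0 _) (step_bound kN).
- have n2 : 0 < n / (2 * B ^+ 2) by rewrite divr_gt0// mulr_gt0.
  have -> : 2 * B ^+ 2 / n = (n / (2 * B ^+ 2))^-1 by rewrite invf_div.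
  by rewrite lef_pV2 ?posrE.
rewrite /step_err; apply: lerD; [apply: lerD => //; apply: lerD|].
- rewrite (_ : v / (tau * s) = v / s * tau^-1); last by field; rewrite tau_neq0 s_neq0.
  by apply: ler_wpM2l (bal_B bal); rewrite divr_ge0 ?ltW.
- rewrite -[leRHS]mulrA ler_wpM2l ?addr_ge0//.
  rewrite (_ : s / (n * tau ^+ 2) = tau^-1 ^+ 2 * (s / n)); last by field; rewrite tau_neq0 N_neq0.
  have kk : s / n * `|k%:R - n * p| <= h * nu * (s / n) by rewrite mulrC ler_wpM2r.
  rewrite -[leLHS]mulrA; apply: ler_pM (Bpow 2) kk; first exact: sqr_ge0.
  by rewrite mulr_ge0.
- rewrite (_ : 12 * a * B ^+ 4 * h ^+ 2 = 3 * a * (4 * (B ^+ 4 * h ^+ 2))); last by ring.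
  rewrite ler_wpM2l ?mulr_ge0//.
  have hh : 1 <= h ^+ 2 by rewrite exprn_ege1.
  have B24 : B ^+ 2 <= B ^+ 4 by rewrite ler_weXn2l.
  have B4 : 0 <= B ^+ 4 by rewrite exprn_ge0.
  have B4h : B ^+ 4 <= B ^+ 4 * h ^+ 2 by rewrite ler_peMr.
  have Y : (2 * s ^+ 2 + (\sum_i degR R G i ^+ 2) * (1 / (2 * n) + ((k%:R - n * p) / n) ^+ 2))
     / s ^+ 2 <= 2 + h ^+ 2.
    rewrite ler_pdivrMr ?exprn_gt0// [leRHS]mulrDl lerD2l.
    have kk : ((k%:R - n * p) / n) ^+ 2 <= h ^+ 2 / n.
      rewrite exprMn exprVn ler_pdivrMr ?exprn_gt0//.
      have -> : h ^+ 2 / n * n ^+ 2 = (h * nu) ^+ 2 by rewrite exprMn nu2; field.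
      by rewrite -real_normK ?num_real// lerXn2r ?nnegrE ?mulr_ge0// ltW.
    apply: (@le_trans _ _ (eta ^+ 2 * s ^+ 3 * (2 * h ^+ 2 / n))).
      apply: ler_pM (bal_deg bal) _.
      - by apply: sumr_ge0 => i _; exact: sqr_ge0.
      - by rewrite addr_ge0 ?sqr_ge0// divr_ge0// mulr_ge0// ltW.
      have : 1 / (2 * n) <= h ^+ 2 / n.
        rewrite (_ : 1 / (2 * n) = (1/2) / n); last by field.
        by rewrite ler_wpM2r ?invr_ge0 ?(ltW n0)//; lra.
      by lra.
    have -> : eta ^+ 2 * s ^+ 3 * (2 * h ^+ 2 / n) = h ^+ 2 * s ^+ 2 * (eta ^+ 2 * (2 * (s / n))).
      by field.
    apply: ler_piMr; first by rewrite mulr_ge0 ?sqr_ge0.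
    by have := ler_piMl sn0 e2; have := sn; have := e2; lra.
  have T : tau^-1 ^+ 4 / s ^+ 2 * (2 * s ^+ 2 + (\sum_i degR R G i ^+ 2) *
     (1 / (2 * n) + ((k%:R - n * p) / n) ^+ 2)) <= B ^+ 4 * (2 + h ^+ 2).
    rewrite -mulrA [_^-1 * _]mulrC; apply: ler_pM (Bpow 4) Y.
      by rewrite exprn_ge0// ltW.
    apply: divr_ge0 (sqr_ge0 _); apply: addr_ge0; first by rewrite mulr_ge0 ?sqr_ge0.
    apply: mulr_ge0; first by apply: sumr_ge0 => i _; exact: sqr_ge0.
    by apply: addr_ge0 (sqr_ge0 _); rewrite divr_ge0// mulr_ge0// ltW.
  by have := Bpow 2; lra.
Qed.

(** About the square root of N steps are made, each of them of size
    [S0]. *)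
Lemma step_total : h * nu * S0 <= (6 + 13 * a) * B ^+ 6 * h ^+ 3 * eta ^+ 2.
Proof.
have -> : h * nu * S0 = 2 * B ^+ 2 * (h * B * (v / (s * nu)) +
   (a + 2) * B ^+ 2 * h ^+ 2 * (s / n) + 4 * (h * nu^-1) + 12 * a * B ^+ 4 * h ^+ 3 * nu^-1).
  by rewrite /S0 -nu2; field; rewrite s_neq0 nu_neq0.
have -> : (6 + 13 * a) * B ^+ 6 * h ^+ 3 * eta ^+ 2 =
   2 * B ^+ 2 * ((3 + 13 / 2 * a) * (B ^+ 4 * h ^+ 3) * eta ^+ 2) by field.
apply: ler_wpM2l; first by rewrite mulr_ge0 ?exprn_ge0.
have P0 : 0 <= B ^+ 4 * h ^+ 3 by rewrite mulr_ge0 ?exprn_ge0.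
have pw (y : R) (i k : nat) : 1 <= y -> (i <= k)%N -> y ^+ i <= y ^+ k.
  by move=> y1 ik; rewrite ler_weXn2l.
have B24 : B ^+ 2 <= B ^+ 4 by exact: pw.
have B14 : B <= B ^+ 4 by have := pw B 1%N 4%N B1 isT; rewrite expr1.
have h13 : h <= h ^+ 3 by have := pw h 1%N 3%N h1 isT; rewrite expr1.
have h23 : h ^+ 2 <= h ^+ 3 by exact: pw.
have b1 : h * B <= B ^+ 4 * h ^+ 3 by rewrite mulrC; exact: ler_pM.
have b2 : B ^+ 2 * h ^+ 2 <= B ^+ 4 * h ^+ 3.
  by apply: ler_pM => //; exact: exprn_ge0.
have b3 : h <= B ^+ 4 * h ^+ 3.
  by rewrite -[leLHS]mul1r; apply: ler_pM => //; exact: exprn_ege1.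
have e20 := sqr_ge0 eta.
have snu0 : 0 <= s * nu by rewrite mulr_ge0// ltW.
have c1 : h * B * (v / (s * nu)) <= (B ^+ 4 * h ^+ 3) * (eta ^+ 2 / 2).
  exact: ler_pM (mulr_ge0 h0 B0) (divr_ge0 (ltW v0) snu0) b1 vs.
have c2 : B ^+ 2 * h ^+ 2 * (s / n) <= (B ^+ 4 * h ^+ 3) * (eta ^+ 2 / 4).
  exact: ler_pM (mulr_ge0 (sqr_ge0 _) (sqr_ge0 _)) sn0 b2 sn.
have nui0 : 0 <= nu^-1 by rewrite invr_ge0 ltW.
have c3 : h * nu^-1 <= (B ^+ 4 * h ^+ 3) * (eta ^+ 2 / 2).
  exact: ler_pM h0 nui0 b3 nui.
have c4 : B ^+ 4 * h ^+ 3 * nu^-1 <= (B ^+ 4 * h ^+ 3) * (eta ^+ 2 / 2).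
  exact: ler_wpM2l.
have c2' := ler_wpM2l (addr_ge0 a0 (ler0n R 2)) c2; have c4' := ler_wpM2l a0 c4.
have q0 : 0 <= B ^+ 4 * h ^+ 3 * eta ^+ 2 by rewrite mulr_ge0.
have q1 : 0 <= a * (B ^+ 4 * h ^+ 3 * eta ^+ 2) by rewrite mulr_ge0.
lra.
Qed.

Let S0_ge0 : 0 <= S0.
Proof.
have B40 : 0 <= B ^+ 4 by rewrite exprn_ge0.
have vs0 : 0 <= v / s by rewrite divr_ge0 ?ltW.
rewrite /S0; apply: mulr_ge0; first by rewrite mulr_ge0 ?mulr_ge0 ?invr_ge0 ?(ltW n0).
apply: addr_ge0; last by rewrite !mulr_ge0.
apply: addr_ge0 (ler0n _ 4); apply: addr_ge0; first by rewrite mulr_ge0.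
apply: mulr_ge0; first by rewrite mulr_ge0 ?exprn_ge0// addr_ge0.
by rewrite !mulr_ge0// ltW.
Qed.

Lemma window_up (t : nat) : (m + t <= N)%N -> t%:R <= h * nu ->
  h * nu <= n / (2 * B ^+ 2) -> `|M (m + t) - M m| <= t%:R * S0.
Proof.
move=> tN th hw; elim: t tN th => [|t IH] tN th.
  by rewrite addn0 subrr normr0 mul0r.
have tN' : (m + t < N)%N by rewrite -addnS.
have th' : t%:R <= h * nu by apply: le_trans th; rewrite ler_nat.
have := IH (ltnW tN') th'; rewrite addnS => IH1.
have st := @step_unif (m + t) tN'; rewrite pE natrD addrAC subrr add0r in st.
have {}st := st _ hw; rewrite ger0_norm ?ler0n// in st.
rewrite -[_ - M m](subrKA (M (m + t))); apply: le_trans (ler_normD _ _) _.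
by have := st th'; rewrite -[t.+1%:R]natr1; lra.
Qed.

Lemma window_down (t : nat) : (t <= m)%N -> t%:R <= h * nu ->
  h * nu <= n / (2 * B ^+ 2) -> `|M (m - t) - M m| <= t%:R * S0.
Proof.
move=> tN th hw; elim: t tN th => [|t IH] tN th.
  by rewrite subn0 subrr normr0 mul0r.
have th' : t%:R <= h * nu by apply: le_trans th; rewrite ler_nat.
have := IH (ltnW tN) th'.
have mt : (m - t = (m - t.+1).+1)%N by rewrite subnSK.
rewrite mt => IH1.
have kN : (m - t.+1 < N)%N by rewrite -mt; apply: leq_trans mN; exact: leq_subr.
have st := @step_unif (m - t.+1) kN; rewrite pE natrB// addrAC subrr add0r in st.
rewrite normrN ger0_norm ?ler0n// in st.
rewrite -[_ - M m](subrKA (M (m - t.+1).+1)); apply: le_trans (ler_normD _ _) _.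
by have := st th hw; rewrite distrC -[t.+1%:R]natr1; lra.
Qed.

Let f01 (A : {set 'I_N}) : 0 <= f A <= 1.
Proof. by rewrite (ltW (gauss_gt0 _ _ _)) gauss_le1. Qed.

Let M01 (k : nat) : (k <= N)%N -> 0 <= M k <= 1.
Proof.
move=> kN; apply/andP; split.
  by apply: fexp_ge0 => A; [exact: pweight_ge0|case/andP: (f01 A)].
rewrite -[leRHS](fexp_cst (sum_pweight R kN)); apply: ler_fexp => A.
  exact: pweight_ge0.
by case/andP: (f01 A).
Qed.

(** Chebyshev's inequality confines the number of ones to a window of width
    [h] standard deviations around its mean, in which the step bounds add up
    to a negligible amount. *)
Lemma transfer :
  `|E f - M m| <= (6 + 13 * a) * B ^+ 6 * h ^+ 3 * eta ^+ 2 + 1 / h ^+ 2.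
Proof.
set K := (6 + 13 * a) * B ^+ 6 * h ^+ 3 * eta ^+ 2.
have h00 : 0 < h by have := h1; lra.
have Kpos : 0 <= K.
  rewrite /K; apply: mulr_ge0 (sqr_ge0 _).
  apply: mulr_ge0 (exprn_ge0 _ h0); apply: mulr_ge0 (exprn_ge0 _ B0).
  by rewrite addr_ge0// mulr_ge0.
have diff1 (k : nat) : (k <= N)%N -> `|M k - M m| <= 1.
  move=> kN; have /andP[k0 k1] := M01 kN; have /andP[l0 l1] := M01 mN.
  by rewrite ler_norml; apply/andP; split; lra.
have in_window (k : nat) : (k <= N)%N -> `|k%:R - m%:R| <= h * nu -> `|M k - M m| <= K.
  move=> kN kw; have [hw|hw] := leP (h * nu) (n / (2 * B ^+ 2)).
    apply: le_trans step_total; apply: (@le_trans _ _ (`|k%:R - m%:R| * S0)); last first.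
      exact: ler_wpM2r.
    have [mk|km] := leqP m k.
      rewrite -natrB// normr_nat in kw *.
      by have := @window_up (k - m); rewrite subnKC//; apply.
    rewrite distrC -natrB ?(ltnW km)// normr_nat in kw *.
    by have := @window_down (m - k); rewrite subKn ?(ltnW km)//; apply=> //; exact: leq_subr.
  (* the window is then so wide that the bound is trivial *)
  apply: le_trans (diff1 k kN) _.
  have BB : 0 < B ^+ 2 by rewrite exprn_gt0//; have := B2; lra.
  have : 1 <= B ^+ 2 * h * eta ^+ 2.
    have {}hw : n < h * nu * (2 * B ^+ 2) by rewrite -ltr_pdivrMr// mulr_gt0.
    have {}hw : nu < h * (2 * B ^+ 2).
      by rewrite -(ltr_pM2r nu0) -expr2 nu2; lra.
    have : nu * nu^-1 <= h * (2 * B ^+ 2) * (eta ^+ 2 / 2).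
      by apply: ler_pM nui; rewrite ?invr_ge0 ltW.
    by rewrite mulfV//; lra.
  have e6 : B ^+ 2 * h * eta ^+ 2 <= B ^+ 6 * h ^+ 3 * eta ^+ 2.
    rewrite ler_wpM2r ?sqr_ge0// ler_pM ?exprn_ge0//; first by rewrite ler_weXn2l.
    by rewrite -[leLHS]expr1 ler_weXn2l.
  move=> q; rewrite /K.
  have q2 : 1 <= B ^+ 6 * h ^+ 3 * eta ^+ 2 by exact: le_trans e6.
  have q3 : 0 <= a * (B ^+ 6 * h ^+ 3 * eta ^+ 2) by rewrite mulr_ge0//; lra.
  by lra.
have all_k (k : nat) : (k <= N)%N -> `|M k - M m| <= K + (k%:R - n * p) ^+ 2 / (h ^+ 2 * n).
  move=> kN; rewrite pE; have [kw|kw] := leP `|k%:R - m%:R| (h * nu).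
    apply: le_trans (in_window k kN kw) _; rewrite lerDl divr_ge0 ?sqr_ge0//.
    by rewrite mulr_ge0 ?sqr_ge0// ltW.
  apply: le_trans (diff1 k kN) _.
  have : 1 <= (k%:R - m%:R) ^+ 2 / (h ^+ 2 * n).
    rewrite ler_pdivlMr ?mulr_gt0 ?exprn_gt0// mul1r -nu2 -exprMn.
    rewrite -[leRHS]real_normK ?num_real// lerXn2r ?nnegrE ?mulr_ge0 ?(ltW nu0)//.
    exact: ltW.
  by have := Kpos; lra.
have cardN A : (#|A| <= N)%N by rewrite -[X in (_ <= X)%N](card_ord N) max_card.
rewrite bexp_mix -[M m](fexp_cst w1) -fexpB.
apply: le_trans (ler_norm_fexp w0 _) _.
apply: le_trans (ler_fexp w0 (fun A => all_k _ (cardN A))) _.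
rewrite fexpD fexp_cst// lerD2l.
rewrite (@eq_fexp _ _ _ _ (fun A => (h ^+ 2 * n)^-1 * (\sum_i 1 * x i A) ^+ 2)); last first.
  by move=> A; under eq_bigr do rewrite mul1r; rewrite (sum_xi_card p) mulrC.
have hN : E (fun A => (\sum_i 1 * x i A) ^+ 2) <= n.
  apply: le_trans (linear_sq p01 (fun=> 1)) _.
  by under eq_bigr do rewrite expr1n; rewrite sumr_const card_ord.
rewrite fexpZ; rewrite (_ : 1 / h ^+ 2 = (h ^+ 2 * n)^-1 * n); last first.
  by field; rewrite N_neq0 gt_eqF.
by rewrite ler_wpM2l// invr_ge0 mulr_ge0 ?sqr_ge0// ltW.
Qed.

End Transfer.

(** * The generalised edge-count statistic *)

(** The inverse is given by Cramer's rule. *)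
Lemma quad_form_invmx2 (R : fieldType) (M : 'M[R]_2) (w : 'rV[R]_2) :
  let D := M 0 0 * M 1 1 - M 0 1 * M 1 0 in D != 0 ->
  (w *m invmx M *m w^T) 0 0 =
  (M 1 1 * w 0 0 ^+ 2 - (M 0 1 + M 1 0) * (w 0 0 * w 0 1) + M 0 0 * w 0 1 ^+ 2) / D.
Proof.
move=> D D0.
pose C : 'M[R]_2 := \matrix_(i, j) (D^-1 *
  (if i == 0 then if j == 0 then M 1 1 else - M 0 1
   else if j == 0 then - M 1 0 else M 0 0)).
have two (F : 'I_2 -> R) : \sum_j F j = F 0 + F 1.
  by rewrite big_ord_recl big_ord1; congr (_ + F _); apply: val_inj.
have ord2 (i : 'I_2) : i = 0 \/ i = 1.
  by case: i => [[|[|]]] // h; [left|right]; apply: val_inj.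
have MC : M *m C = 1%:M.
  apply/matrixP => i j; rewrite !mxE two !mxE.
  by case: (ord2 i) => ->; case: (ord2 j) => ->; rewrite /= /D; field.
have [Mu _] := mulmx1_unit MC.
have -> : invmx M = C.
  by rewrite -[RHS]mul1mx -(mulVmx Mu) -mulmxA MC mulmx1.
by rewrite !mxE two !mxE !two !mxE /= /D; field.
Qed.

(** A relative error on the exponent only causes an absolute error: the
    exponential absorbs the factor [y]. *)
Lemma expR_close (R : realType) (k x y l : R) : 0 <= k -> 0 <= y -> 0 <= l <= 1/2 ->
  `|x - y| <= l * y -> `|expR (- (1/2) * (k * x)) - expR (- (1/2) * (k * y))| <= 2 * l.
Proof.
move=> k0 y0 /andP[l0 l1] xy.
have xy' := xy; move: xy'; rewrite ler_norml => /andP[xl xu].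
have ly : l * y <= 1/2 * y by rewrite ler_wpM2r.
have half (u w : R) : y / 2 <= u -> u <= w -> w - u <= l * y ->
    `|expR (- (1/2) * (k * u)) - expR (- (1/2) * (k * w))| <= 2 * l.
  move=> yu uw wu.
  have ku : 0 <= k * (w - u) by rewrite mulr_ge0// subr_ge0.
  have -> : - (1/2) * (k * w) = - (1/2) * (k * u) + - (1/2 * (k * (w - u))) by ring.
  rewrite expRD -{1}[expR (- (1/2) * (k * u))]mulr1 -mulrBr.
  have e1 := expR_ge1Dx (- (1/2 * (k * (w - u)))).
  have e2 : expR (- (1/2 * (k * (w - u)))) <= 1.
    by rewrite -[leRHS]expR0 ler_expR; lra.
  rewrite normrM (ger0_norm (expR_ge0 _)) ger0_norm; last by lra.
  have [d _] := expR_decay (divr_ge0 (mulr_ge0 k0 y0) (ler0n R 2)).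
  have eu : expR (- (1/2) * (k * u)) <= expR (- (1/2) * (k * y / 2)).
    rewrite ler_expR; have := ler_wpM2l k0 yu; lra.
  have b : 1 - expR (- (1/2 * (k * (w - u)))) <= l * (k * y / 2).
    have := ler_wpM2l k0 wu; lra.
  have b0 : 0 <= 1 - expR (- (1/2 * (k * (w - u)))) by lra.
  apply: le_trans (ler_pM (expR_ge0 _) b0 eu b) _.
  by have := ler_wpM2l l0 d; lra.
have [xley|yltx] := leP x y; first by apply: half; lra.
by rewrite distrC; apply: half; lra.
Qed.

Section Statistic.
Variables (R : realType) (N m : nat) (G : sgraph N) (p : R) (z : 'I_N -> R).
Variables (s v tau B eta : R).
Hypothesis bal : balanced G p z s v tau B eta.
Hypothesis mN : (m <= N)%N.
Hypothesis pE : N%:R * p = m%:R.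
Implicit Types (i j k l : 'I_N) (A : {set 'I_N}).
Local Notation E := (fexp (pweight R m)).
Local Notation x := (xi p).
Local Notation U := (Wq G p s tau).
Local Notation V := (Wl p z v tau).

Let s0 := bal_s bal.
Let v0 := bal_v bal.
Let tau0 := bal_tau bal.
Let eta0 : 0 < eta. Proof. by case/andP: (bal_eta bal). Qed.
Let eta1 : eta <= 1. Proof. by case/andP: (bal_eta bal). Qed.
Let w0 A : 0 <= pweight R m A := pweight_ge0 R m A.
Let w1 := @sum_pweight R N m mN.
Let tau_neq0 : tau != 0. Proof. by rewrite gt_eqF. Qed.
Let s_neq0 : s != 0. Proof. by rewrite gt_eqF. Qed.
Let v_neq0 : v != 0. Proof. by rewrite gt_eqF. Qed.

Lemma sum_deg_xi A : #|A| = m -> \sum_j degR R G j * x j A = Lform p z A.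
Proof.
move=> Am.
transitivity (Lform p z A + 2 * s ^+ 2 / N%:R * \sum_j x j A).
  rewrite mulr_sumr -big_split; apply: eq_bigr => j _ /=.
  by rewrite (bal_z bal); ring.
by rewrite (sum_xi pE Am) mulr0 addr0.
Qed.

(** The indicators of both samples have the form [b * xi p i A + c], with
    [b = 1] for the first sample and [b = -1] for the second. *)
Lemma shifted_form A (b c : R) : #|A| = m -> b ^+ 2 = 1 ->
  \sum_i \sum_k adjR R G i k * ((b * x i A + c) * (b * x k A + c)) =
  2 * (Qform G p A + b * c * Lform p z A + c ^+ 2 * s ^+ 2).
Proof.
move=> Am b2.
have eL := sum_deg_xi Am.
have eX : \sum_i Xnb G p i A = Lform p z A.
  rewrite -eL exchange_big; apply: eq_bigr => k _; rewrite -mulr_suml; congr (_ * _).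
  by apply: eq_bigr => i _; exact: adjRC.
transitivity (b ^+ 2 * (\sum_i x i A * Xnb G p i A) + b * c * (\sum_i degR R G i * x i A)
  + b * c * (\sum_i Xnb G p i A) + c ^+ 2 * \sum_i degR R G i).
  rewrite !mulr_sumr -!big_split; apply: eq_bigr => i _ /=.
  transitivity (b ^+ 2 * x i A * Xnb G p i A + b * c * x i A * degR R G i +
    b * c * Xnb G p i A + c ^+ 2 * degR R G i); last by ring.
  rewrite {1 2}/Xnb /degR !mulr_sumr -!big_split; apply: eq_bigr => k _ /=.
  by ring.
by rewrite b2 eL eX sum_degR -(bal_s2 bal) /Qform; field.
Qed.

Lemma edge_count0 A : #|A| = m ->
  edge_count R G 0 A = Qform G p A + p * Lform p z A + p ^+ 2 * s ^+ 2.
Proof.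
move=> Am; apply: (mulfI (_ : 2 != 0 :> R)); first by rewrite pnatr_eq0.
rewrite edge_countE (_ : p * _ = 1 * p * Lform p z A); last by rewrite mul1r.
rewrite -(shifted_form p Am (expr1n _ 2)); apply: eq_bigr => i _; apply: eq_bigr => k _.
by rewrite /sample /= /xi; congr (_ * _); ring.
Qed.

Lemma edge_count1 A : #|A| = m ->
  edge_count R G 1 A = Qform G p A - (1 - p) * Lform p z A + (1 - p) ^+ 2 * s ^+ 2.
Proof.
move=> Am; apply: (mulfI (_ : 2 != 0 :> R)); first by rewrite pnatr_eq0.
rewrite edge_countE (_ : - (_ * Lform p z A) = -1 * (1 - p) * Lform p z A); last by ring.
rewrite -(shifted_form (1 - p) Am (etrans (sqrrN 1) (expr1n R 2))).
apply: eq_bigr => i _; apply: eq_bigr => k _; rewrite /sample /= !inE /xi.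
by congr (_ * _); case: (i \in A); case: (k \in A) => /=; ring.
Qed.

Let u A := U A - E U.
Let al := tau ^+ 2 * s.
Let be := tau * v.
Let c11 := E (fun A => u A ^+ 2).
Let c12 := E (fun A => u A * V A).
Let c22 := E (fun A => V A ^+ 2).

Let EV0 : E V = 0.
Proof. by rewrite fexpZ (pexp_L bal pE) mulr0. Qed.

Let centered (b c : R) (f : {set 'I_N} -> R) :
  (forall A, #|A| = m -> f A = Qform G p A + b * Lform p z A + c) ->
  forall A, #|A| = m -> f A - E f = al * u A + b * be * V A.
Proof.
move=> hf A Am.
have QU B' : Qform G p B' = al * U B'.
  by rewrite /Wq mulrA mulfV ?mul1r// mulf_neq0// expf_neq0.
have LV B' : Lform p z B' = be * V B'.
  by rewrite /Wl mulrA mulfV ?mul1r// mulf_neq0.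
have -> : E f = al * E U + c.
  rewrite (@eq_pexp _ _ _ f (fun A => al * U A + (b * be * V A + c))); last first.
    by move=> B' B'm; rewrite hf// QU LV; ring.
  rewrite fexpD fexpD fexp_cst//.
  by rewrite (fexpZ _ al U) (fexpZ _ (b * be) V) EV0 mulr0 add0r.
by rewrite hf// QU LV /u; ring.
Qed.

Let cc0 A : #|A| = m -> centered_count R m G 0 A = al * u A + p * be * V A.
Proof.
move=> Am; rewrite /centered_count perm_expectE.
apply: (centered (c := p ^+ 2 * s ^+ 2)) => // B' B'm; exact: edge_count0.
Qed.

Let cc1 A : #|A| = m -> centered_count R m G 1 A = al * u A - (1 - p) * be * V A.
Proof.
move=> Am; rewrite /centered_count perm_expectE -[- (_ * V A)]mulNr -[- (_ * be)]mulNr.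
apply: (centered (c := (1 - p) ^+ 2 * s ^+ 2)) => // B' B'm.
by rewrite edge_count1// mulNr.
Qed.

(** In the basis of the two standardised forms the quadratic form of the
    inverse covariance matrix is unchanged, since the two bases differ by an
    invertible linear map. *)
Lemma Sstat_forms A : #|A| = m -> c11 * c22 - c12 ^+ 2 != 0 ->
  Sstat R m G A = (c22 * u A ^+ 2 - 2 * c12 * (u A * V A) + c11 * V A ^+ 2)
     / (c11 * c22 - c12 ^+ 2).
Proof.
move=> Am D0.
have al0 : al != 0 by rewrite mulf_neq0// expf_neq0.
have be0 : be != 0 by rewrite mulf_neq0.
have cov (b c : R) (f h : {set 'I_N} -> R) :
    (forall A, #|A| = m -> f A = al * u A + b * be * V A) ->
    (forall A, #|A| = m -> h A = al * u A + c * be * V A) ->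
    perm_expect m (fun A => f A * h A) =
    al ^+ 2 * c11 + (b + c) * al * be * c12 + b * c * be ^+ 2 * c22.
  move=> hf hh; rewrite perm_expectE.
  rewrite (@eq_pexp _ _ _ _ (fun A => al ^+ 2 * (u A ^+ 2) +
    (b + c) * al * be * (u A * V A) + b * c * be ^+ 2 * (V A ^+ 2))); last first.
    by move=> B' B'm; rewrite hf// hh//; ring.
  by rewrite !fexpD (fexpZ _ _ (fun A => u A ^+ 2)) (fexpZ _ _ (fun A => u A * V A))
    (fexpZ _ _ (fun A => V A ^+ 2)).
have cc1' A' : #|A'| = m -> centered_count R m G 1 A' = al * u A' + - (1 - p) * be * V A'.
  by move=> Am'; rewrite cc1// !mulNr.
have S00 : SigmaR R m G 0 0 = al ^+ 2 * c11 + (p + p) * al * be * c12 + p * p * be ^+ 2 * c22.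
  by rewrite mxE; apply: cov => A' ?; exact: cc0.
have S01 : SigmaR R m G 0 1 = al ^+ 2 * c11 + (p + - (1 - p)) * al * be * c12 + p * - (1 - p) * be ^+ 2 * c22.
  by rewrite mxE; apply: cov => A' ?; [exact: cc0|exact: cc1'].
have S10 : SigmaR R m G 1 0 = al ^+ 2 * c11 + (- (1 - p) + p) * al * be * c12 + - (1 - p) * p * be ^+ 2 * c22.
  by rewrite mxE; apply: cov => A' ?; [exact: cc1'|exact: cc0].
have S11 : SigmaR R m G 1 1 = al ^+ 2 * c11 + (- (1 - p) + - (1 - p)) * al * be * c12
    + - (1 - p) * - (1 - p) * be ^+ 2 * c22.
  by rewrite mxE; apply: cov => A' ?; exact: cc1'.
have detE : SigmaR R m G 0 0 * SigmaR R m G 1 1 - SigmaR R m G 0 1 * SigmaR R m G 1 0 =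
    (al * be) ^+ 2 * (c11 * c22 - c12 ^+ 2).
  by rewrite S00 S01 S10 S11; ring.
rewrite /Sstat quad_form_invmx2; last first.
  by rewrite detE mulf_neq0// expf_neq0// mulf_neq0.
rewrite detE S00 S01 S10 S11 !mxE cc0// cc1//.
by field; rewrite D0 al0 be0.
Qed.

Hypothesis Beta : B ^+ 4 * eta <= 1 / 8.

Let B1 : 1 <= B. Proof. by have := bal_B2 bal; lra. Qed.
Let th := B ^+ 4 * eta.
Let th0 : 0 <= th.
Proof. by rewrite /th mulr_ge0 ?exprn_ge0 ?(ltW eta0)//; have := B1; lra. Qed.
Let Ble (k : nat) : (k <= 4)%N -> B ^+ k * eta <= th.
Proof. by move=> k4; rewrite ler_wpM2r ?(ltW eta0)// ler_weXn2l. Qed.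

(** The covariance matrix of the standardised forms is close to the
    identity. *)
Lemma Sstat_close A : #|A| = m ->
  `|Sstat R m G A - (u A ^+ 2 + V A ^+ 2)| <= 3 * th * (u A ^+ 2 + V A ^+ 2).
Proof.
move=> Am.
have b11 : `|c11 - 1| <= th := var_Wq bal mN pE.
have b12 : `|c12| <= th := le_trans (cov_Wq_Wl bal mN pE) (Ble (k := 3) isT).
have b22 : `|c22 - 1| <= th := le_trans (var_Wl bal mN pE) (Ble (k := 2) isT).
have t0 := th0; have t8 : th <= 1/8 := Beta.
have SE := Sstat_forms Am; move: b11 b12 b22 SE; move: (Sstat _ _ _ _) => S.
move: c11 c12 c22 => a b c; move: (u A) (V A) => x1 x2; move: th t0 t8 => t t0 t8.
rewrite !ler_norml => /andP[a1 a2] /andP[b1 b2] /andP[c1 c2] SE.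
have bb : b ^+ 2 <= t / 8 by nra.
have b20 := sqr_ge0 b.
have D1 : 3/4 <= a * c - b ^+ 2 by nra.
have D0 : 0 < a * c - b ^+ 2 by lra.
rewrite SE ?gt_eqF//; set D := a * c - b ^+ 2 in D0 D1 *.
rewrite (_ : _ / D - _ = ((c - D) * x1 ^+ 2 - b * (2 * (x1 * x2)) + (a - D) * x2 ^+ 2) / D);
  last by field; rewrite gt_eqF.
have cD : `|c - D| <= 5/4 * t by rewrite ler_norml /D; apply/andP; split; nra.
have aD : `|a - D| <= 5/4 * t by rewrite ler_norml /D; apply/andP; split; nra.
have y10 := sqr_ge0 x1; have y20 := sqr_ge0 x2.
have xx : `|2 * (x1 * x2)| <= x1 ^+ 2 + x2 ^+ 2.
  have p1 := sqr_ge0 (x1 - x2); have p2 := sqr_ge0 (x1 + x2).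
  rewrite sqrrB in p1; rewrite sqrrD in p2.
  by rewrite ler_norml; apply/andP; split; lra.
rewrite -ler_norml normrM normfV (gtr0_norm D0) ler_pdivrMr//.
have b' : `|b| <= t by rewrite ler_norml b1.
have n1 : `|(c - D) * x1 ^+ 2| <= 5/4 * t * x1 ^+ 2.
  by rewrite normrM (ger0_norm y10) ler_wpM2r.
have n2 : `|(a - D) * x2 ^+ 2| <= 5/4 * t * x2 ^+ 2.
  by rewrite normrM (ger0_norm y20) ler_wpM2r.
have n3 : `|b * (2 * (x1 * x2))| <= t * (x1 ^+ 2 + x2 ^+ 2).
  by rewrite normrM ler_pM.
apply: le_trans (ler_normD _ _) _; apply: le_trans (lerD (ler_normB _ _) n2) _.
have ty : 0 <= t * (x1 ^+ 2 + x2 ^+ 2) by rewrite mulr_ge0// addr_ge0.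
have := ler_wpM2l ty D1; lra.
Qed.

Lemma Sstat_ge0 A : #|A| = m -> 0 <= Sstat R m G A.
Proof.
move=> Am; have := Sstat_close Am; rewrite ler_norml => /andP[h _].
have y0 : 0 <= u A ^+ 2 + V A ^+ 2 by rewrite addr_ge0 ?sqr_ge0.
have t8 : 3 * th <= 1/2 by have := Beta; rewrite -/th; lra.
by have := ler_wpM2r y0 t8; lra.
Qed.

(** Four replacements: the statistic by the squared norm of the centred forms,
    these by the uncentred ones, the labels by independent ones, and finally
    the limit. *)
Lemma perm_laplace (k h : R) : 0 <= k -> 1 <= h ->
  `|perm_expect m (fun A => expR (- (1/2) * (k * Sstat R m G A))) - (1 + k)^-1|
  <= 900 * (1 + k) ^+ 2 * (B ^+ 8 * h ^+ 3) * eta + 1 / h ^+ 2.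
Proof.
move=> k0 h1; rewrite perm_expectE.
have t8 : th <= 1/8 := Beta.
have t0 := th0.
pose gS A := expR (- (1/2) * (k * Sstat R m G A)).
pose gu A := gauss k (u A) (V A); pose gU A := gauss k (U A) (V A).
have e1 : `|E gS - E gu| <= 6 * th.
  rewrite -fexpB.
  rewrite (@eq_pexp _ _ _ _ (fun A => if #|A| == m then gS A - gu A else 0)); last first.
    by move=> A ->; rewrite eqxx.
  apply: le_trans (ler_norm_fexp w0 _) _.
  rewrite -[leRHS](fexp_cst w1); apply: (ler_fexp w0) => A.
  case: eqP => [Am|_]; last by rewrite normr0 mulr_ge0.
  rewrite (_ : 6 * th = 2 * (3 * th)); last by ring.
  apply: expR_close => //; first by rewrite addr_ge0 ?sqr_ge0.
    by apply/andP; split; lra.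
  exact: Sstat_close.
have e2 : `|E gu - E gU| <= (4 * k + 2) * th.
  rewrite -fexpB; apply: le_trans (ler_norm_fexp w0 _) _.
  rewrite -[leRHS](fexp_cst w1); apply: (ler_fexp w0) => A.
  have := gauss_taylor k0 (U A) (V A) (- E U) 0.
  rewrite -/(u A) addr0 -/(gu A) -/(gU A) mulr0 addr0 expr0n addr0 sqrrN => ht.
  have mU : `|E U| <= th := le_trans (mean_Wq bal mN pE) (Ble (k := 2) isT).
  have [hd _] := gauss_decay k0 (U A) (V A).
  have g0 := gauss_gt0 k (U A) (V A); have g1 := gauss_le1 k0 (U A) (V A).
  rewrite -/(gU A) in hd g0 g1.
  have kg : 0 <= k * gU A by rewrite mulr_ge0// ltW.
  have ug : `|k * gU A * U A| <= (k + 2) / 2.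
    have q1 := mulr_ge0 kg (sqr_ge0 (U A - 1)); have q2 := mulr_ge0 kg (sqr_ge0 (U A + 1)).
    have q3 := mulr_ge0 kg (sqr_ge0 (V A)); have q4 := ler_wpM2l k0 g1.
    rewrite sqrrB in q1; rewrite sqrrD in q2.
    by rewrite ler_norml; apply/andP; split; lra.
  have EU2 : E U ^+ 2 <= th.
    rewrite -real_normK ?num_real// expr2; apply: le_trans (ler_pM _ _ mU (le_trans mU t8)) _ => //.
    by lra.
  have lin : `|k * (U A * - E U) * gU A| <= (k + 2) / 2 * th.
    rewrite (_ : _ * gU A = - (k * gU A * U A * E U)); last by ring.
    by rewrite normrN normrM ler_pM.
  have -> : gu A - gU A = (gu A - gU A + k * (U A * - E U) * gU A) - k * (U A * - E U) * gU A by ring.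
  apply: le_trans (ler_normB _ _) _; apply: le_trans (lerD ht lin) _.
  have := ler_wpM2l k0 EU2; have := mulr_ge0 k0 t0; lra.
have h0 : 0 <= h by lra.
have e3 := transfer bal k0 mN pE h1.
have e4 := bern_laplace bal k0.
set F := fexp (bweight p) _ in e3 e4.
have k1 : 0 < 1 + k by lra.
have e4' : `|F - (1 + k)^-1| <= k * ((850 + 5 * k) * B ^+ 8 * eta).
  apply: le_trans e4; rewrite (_ : (1 + k) * F - 1 = (1 + k) * (F - (1 + k)^-1)); last first.
    by field; rewrite gt_eqF.
  by rewrite normrM (gtr0_norm k1) ler_peMl//; lra.
have -> : E gS - (1 + k)^-1 = (E gS - E gu) + (E gu - E gU) + (E gU - F) + (F - (1 + k)^-1) by ring.
apply: le_trans (ler_normD _ _) _; apply: le_trans (lerD (ler_normD _ _) e4') _.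
apply: le_trans (lerD (lerD (ler_normD _ _) (lexx _)) (lexx _)) _.
rewrite [`|E gU - F|]distrC.
apply: le_trans (lerD (lerD (lerD e1 e2) e3) (lexx _)) _.
have ee : eta ^+ 2 <= eta by rewrite expr2 ler_piMr// ltW.
have h3 : 1 <= h ^+ 3 by rewrite exprn_ege1.
have BB : 0 <= B by have := B1; lra.
pose W := B ^+ 8 * h ^+ 3 * eta.
have W1 : th <= W.
  rewrite /th /W ler_wpM2r ?(ltW eta0)// -[leLHS]mulr1 ler_pM ?exprn_ge0//.
  by rewrite ler_weXn2l.
have W2 : B ^+ 6 * h ^+ 3 * eta ^+ 2 <= W.
  rewrite /W; apply: ler_pM => //; rewrite ?mulr_ge0 ?exprn_ge0 ?(ltW eta0)//.
  by rewrite ler_wpM2r ?exprn_ge0// ler_weXn2l.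
have W3 : B ^+ 8 * eta <= W.
  by rewrite /W ler_wpM2r ?(ltW eta0)// ler_peMr ?exprn_ge0.
have kW1 := ler_wpM2l k0 W1; have kW2 := ler_wpM2l k0 W2; have kW3 := ler_wpM2l k0 W3.
have kkW3 := ler_wpM2l k0 kW3.
have W0 : 0 <= W by lra.
have kW0 : 0 <= k * W by rewrite mulr_ge0.
have kkW0 : 0 <= k * (k * W) by rewrite mulr_ge0.
rewrite (_ : 900 * (1 + k) ^+ 2 * (B ^+ 8 * h ^+ 3) * eta =
  900 * W + 1800 * (k * W) + 900 * (k * (k * W))); last by rewrite /W; ring.
by lra.
Qed.

End Statistic.

(** * The Laplace transform of the chi-squared law *)

Section ChiSquared.
Variable R : realType.
Local Notation leb := (@lebesgue_measure R).
Local Notation gam := (normal_prob (0 : R) 1).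
Local Notation gam2 := (gam \x gam)%E.

(** Change of variables to the density, by the Radon-Nikodym theorem. *)
Lemma integral_normal_prob f : measurable_fun setT f -> gam.-integrable setT f ->
  (\int[gam]_x f x = \int[leb]_x (f x * (normal_pdf 0 1 x)%:E))%E.
Proof.
move=> mf intf; have dom := normal_prob_dominates (0 : R) 1.
rewrite -(Radon_Nikodym_change_of_variables dom)//=.
apply: ae_eq_integral => //.
- exact: emeasurable_funM.
- apply: emeasurable_funM => //=.
  by apply/measurable_EFinP; exact: measurable_normal_pdf.
- apply: ae_eqe_mul2l => /=.
  rewrite Radon_NikodymE//=.
  case: cid => /= h [h1 h2 h3].
  apply: integral_ae_eq => //=.
  + by apply/measurable_EFinP; exact: measurable_normal_pdf.
  + by move=> E _ mE; rewrite -h3.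
Qed.

Lemma measurable_laplace (k : R) :
  measurable_fun setT (fun x : R => expR (- (1/2) * (k * x ^+ 2))).
Proof.
apply: measurableT_comp => //; apply: measurable_funM => //.
by apply: measurable_funM => //; exact: measurable_funX.
Qed.

Lemma laplace_le1 (k y : R) : 0 <= k -> 0 <= y -> expR (- (1/2) * (k * y)) <= 1.
Proof.
move=> k0 y0; rewrite -[leRHS]expR0 ler_expR.
by have := mulr_ge0 k0 y0; lra.
Qed.

(** Multiplying a centred Gaussian density by a Gaussian function gives a
    multiple of another centred Gaussian density. *)
Lemma laplace_normal (k : R) : 0 <= k ->
  (\int[gam]_x (expR (- (1/2) * (k * x ^+ 2)))%:E = ((Num.sqrt (1 + k))^-1)%:E)%E.
Proof.
move=> k0; have k1 : 0 < 1 + k by lra.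
have sk : 0 < Num.sqrt (1 + k) by rewrite sqrtr_gt0.
pose sg := (Num.sqrt (1 + k))^-1.
have sg0 : 0 < sg by rewrite invr_gt0.
have sg2 : sg ^+ 2 = (1 + k)^-1 by rewrite exprVn sqr_sqrtr// ltW.
rewrite integral_normal_prob; last 2 first.
- by apply/measurable_EFinP; exact: measurable_laplace.
- apply: measurable_bounded_integrable => //.
  - exact: fin_num_fun_lty.
  - exact: measurable_laplace.
  - exists 1; split => // M M1 x _ /=.
    rewrite ger0_norm ?expR_ge0//; apply: le_trans (ltW M1).
    by apply: laplace_le1 => //; exact: sqr_ge0.
transitivity (\int[leb]_x (sg%:E * (normal_pdf 0 sg x)%:E))%E; last first.
  rewrite integralZl//; last exact: integrable_normal_pdf.
  by rewrite integral_normal_pdf mule1.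
apply: eq_integral => x _; rewrite -!EFinM; congr (_%:E).
rewrite !normal_pdfE ?oner_eq0 ?gt_eqF// /normal_peak /normal_fun.
rewrite expr1n [1 * pi]mul1r sg2 subr0.
have -> : Num.sqrt ((1 + k)^-1 * pi *+ 2) = sg * Num.sqrt (pi *+ 2) :> R.
  rewrite -mulrnAr sqrtrM ?invr_ge0 ?(ltW k1)// sqrtrV//; exact: ltW.
have cancel (c b : R) : c != 0 -> sg * ((sg * c)^-1 * b) = c^-1 * b.
  by move=> c0; field; rewrite c0 gt_eqF.
rewrite cancel; last by rewrite gt_eqF// sqrtr_gt0 mulrn_wgt0// pi_gt0.
rewrite [LHS]mulrCA; congr (_ * _); rewrite -expRD; congr expR.
by field; rewrite gt_eqF.
Qed.

Definition sqnorm (z : R * R) : R := z.1 ^+ 2 + z.2 ^+ 2.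

Lemma measurable_sqnorm : measurable_fun setT sqnorm.
Proof.
by apply: measurable_funD; apply: measurable_funX;
  [exact: measurable_fst|exact: measurable_snd].
Qed.

Lemma measurable_laplace2 (k : R) :
  measurable_fun setT (fun z : R * R => expR (- (1/2) * (k * sqnorm z))).
Proof.
apply: measurableT_comp => //; apply: measurable_funM => //.
by apply: measurable_funM => //; exact: measurable_sqnorm.
Qed.

Lemma sqnorm_ge0 z : 0 <= sqnorm z.
Proof. by rewrite addr_ge0// sqr_ge0. Qed.

(** With [k] a natural number, these are the moments of the uniform law on the
    unit interval: under this law [exp (- z / 2)] is uniform. *)
Lemma laplace_chi2 (k : R) : 0 <= k ->
  (\int[gam2]_z (expR (- (1/2) * (k * sqnorm z)))%:E = ((1 + k)^-1)%:E)%E.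
Proof.
move=> k0.
rewrite fubini_tonelli1 /=; last 2 first.
- apply: measurableT_comp; [exact: EFin_measurable|exact: measurable_laplace2].
- by move=> z; rewrite lee_fin expR_ge0.
have k1 : 0 < 1 + k by lra.
set r := (Num.sqrt (1 + k))^-1.
transitivity (\int[gam]_x ((expR (- (1/2) * (k * x ^+ 2)))%:E * r%:E))%E.
  apply: eq_integral => x _; rewrite /fubini_F /= muleC -laplace_normal//.
  rewrite muleC -ge0_integralZl//; last first.
    by apply/measurable_EFinP; exact: measurable_laplace.
  apply: eq_integral => y _; rewrite -EFinM -expRD; congr (expR _)%:E.
  by rewrite /sqnorm /=; ring.
rewrite ge0_integralZr//; last 2 first.
- by apply/measurable_EFinP; exact: measurable_laplace.
- by rewrite lee_fin /r invr_ge0 sqrtr_ge0.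
rewrite laplace_normal// -EFinM -invfM -expr2 sqr_sqrtr//; exact: ltW.
Qed.

End ChiSquared.

(** * From Laplace transforms to distribution functions *)

(** The polynomial is the Bernstein polynomial of a step function: its value
    at [u] is the probability that a binomial proportion with success rate [u]
    exceeds the step. *)
Lemma soft_threshold (R : realType) (c2 c eps : R) : c2 < c -> 0 < eps ->
  exists P : {poly R}, forall u, 0 <= u <= 1 ->
    [/\ 0 <= P.[u] <= 1, c <= u -> 1 - eps <= P.[u] & u <= c2 -> P.[u] <= eps].
Proof.
move=> cc eps0.
pose ga := (c - c2) / 2; have ga0 : 0 < ga by rewrite divr_gt0// subr_gt0.
pose K := (Num.bound (1 / (ga ^+ 2 * eps))).+1.
have K0 : 0 < K%:R :> R by rewrite ltr0n.
have KB : 1 / (K%:R * ga ^+ 2) <= eps.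
  have ge0 : 0 < ga ^+ 2 * eps by rewrite mulr_gt0 ?exprn_gt0.
  have := archi_boundP (divr_ge0 ler01 (ltW ge0)).
  rewrite ltr_pdivrMr// => h.
  rewrite ler_pdivrMr; last by rewrite mulr_gt0// exprn_gt0.
  apply: le_trans (ltW h) _; rewrite [leRHS](_ : _ = K%:R * (ga ^+ 2 * eps)); last by ring.
  by rewrite ler_wpM2r ?(ltW ge0)// ler_nat.
pose t := (c + c2) / 2.
pose I (A : {set 'I_K}) : R := (t * K%:R <= #|A|%:R)%R%:R.
pose P : {poly R} :=
  \sum_(A : {set 'I_K}) I A *: ('X ^+ #|A| * (1 - 'X) ^+ (K - #|A|)%N).
exists P => u u01.
have -> : P.[u] = fexp (bweight u) I.
  rewrite horner_sum; apply: eq_bigr => A _.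
  by rewrite hornerZ hornerM !horner_exp hornerX hornerD hornerN hornerX hornerC mulrC.
have w0 (A : {set 'I_K}) := @bweight_ge0 R K u A u01.
have w1 := sum_bweight K u.
have cheb : fexp (bweight u) (fun A : {set 'I_K} => (#|A|%:R - K%:R * u) ^+ 2) <= K%:R.
  rewrite (@eq_fexp _ _ _ _ (fun A => (\sum_i 1 * xi u i A) ^+ 2)); last first.
    by move=> A; under eq_bigr do rewrite mul1r; rewrite sum_xi_card.
  apply: le_trans (linear_sq u01 (fun=> 1)) _.
  by under eq_bigr do rewrite expr1n; rewrite sumr_const card_ord.
have I01 A : 0 <= I A <= 1.
  by rewrite /I; case: (t * K%:R <= _); rewrite /= ?ler01 ?lexx ?ler01.
have tail (J : {set 'I_K} -> R) :
    (forall A, J A <= (#|A|%:R - K%:R * u) ^+ 2 / (K%:R * ga) ^+ 2) ->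
    fexp (bweight u) J <= eps.
  move=> hJ; apply: le_trans KB; apply: le_trans (ler_fexp w0 hJ) _.
  rewrite (@eq_fexp _ _ _ _ (fun A : {set 'I_K} => (K%:R * ga) ^- 2 * (#|A|%:R - K%:R * u) ^+ 2)); last first.
    by move=> A; rewrite mulrC.
  rewrite fexpZ; have h := ler_wpM2l (_ : 0 <= (K%:R * ga) ^- 2) cheb.
  rewrite invr_ge0 sqr_ge0 in h; apply: le_trans (h isT) _.
  by rewrite le_eqVlt; apply/orP; left; apply/eqP; field; rewrite !gt_eqF.
have far (y : R) : (K%:R * ga) ^+ 2 <= y ^+ 2 -> 1 <= y ^+ 2 / (K%:R * ga) ^+ 2.
  by move=> h; rewrite ler_pdivlMr ?mul1r// exprn_gt0// mulr_gt0.
have Kg : 0 <= K%:R * ga by rewrite mulr_ge0// ltW.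
split.
- apply/andP; split; first by apply: fexp_ge0 => // A; case/andP: (I01 A).
  by rewrite -[leRHS](fexp_cst w1); apply: ler_fexp => // A; case/andP: (I01 A).
- move=> cu; suff : fexp (bweight u) (fun A : {set 'I_K} => 1 - I A) <= eps.
    by rewrite fexpB fexp_cst//; lra.
  apply: tail => A; rewrite /I; have [_|h] := leP (t * K%:R) #|A|%:R.
    by rewrite subrr divr_ge0 ?sqr_ge0.
  rewrite subr0; apply: far; rewrite -[leRHS]sqrrN lerXn2r ?nnegrE//.
    have : K%:R * u >= t * K%:R by rewrite mulrC ler_wpM2l ?(ltW K0)// /t; lra.
    by lra.
  have := ler_wpM2l (ltW K0) (_ : t + ga <= u); rewrite mulrDr => /(_ _).
  have : t + ga <= u by rewrite /t /ga; lra.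
  by move=> h1 /(_ h1); lra.
- move=> uc; apply: tail => A; rewrite /I; have [h|_] := leP (t * K%:R) #|A|%:R; last first.
    by rewrite divr_ge0 ?sqr_ge0.
  apply: far; rewrite lerXn2r ?nnegrE//.
    have : K%:R * u <= t * K%:R by rewrite mulrC ler_wpM2r ?(ltW K0)// /t; lra.
    by lra.
  have := ler_wpM2l (ltW K0) (_ : u + ga <= t); rewrite mulrDr => /(_ _).
  have : u + ga <= t by rewrite /t /ga; lra.
  by move=> h1 /(_ h1); lra.
Qed.

Section LimitLaw.
Variable R : realType.
Local Notation gam := (normal_prob (0 : R) 1).
Local Notation gam2 := (gam \x gam)%E.

Definition chi2_cdf (x : R) : R := fine (chi2_2 `]-oo, x]%classic).

(** The integral of [P] over the unit interval, term by term. *)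
Definition unif_int (P : {poly R}) : R := \sum_(i < size P) P`_i * (1 + i%:R)^-1.

Lemma expR_pow (y : R) (i : nat) : expR (- (1/2) * y) ^+ i = expR (- (1/2) * (i%:R * y)).
Proof. by rewrite -expRM_natl; congr expR; ring. Qed.

Lemma gam2_setT : gam2 setT = 1%E.
Proof.
rewrite -setXTT product_measure1E// -[RHS]mule1.
by rewrite -{1}(probability_setT gam) -(probability_setT gam).
Qed.

Lemma integrable_laplace2 (k : R) : 0 <= k ->
  gam2.-integrable setT (fun z => (expR (- (1/2) * (k * sqnorm z)))%:E).
Proof.
move=> k0; apply: measurable_bounded_integrable => //.
- by have := gam2_setT; rewrite /= => ->; rewrite ltry.
- exact: measurable_laplace2.
- exists 1; split => // M M1 z _ /=.
  rewrite ger0_norm ?expR_ge0//; apply: le_trans (ltW M1).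
  by apply: laplace_le1 => //; exact: sqnorm_ge0.
Qed.

Lemma poly_laplaceE (P : {poly R}) (y : R) :
  P.[expR (- (1/2) * y)] = \sum_(i < size P) P`_i * expR (- (1/2) * (i%:R * y)).
Proof. by rewrite horner_coef; apply: eq_bigr => i _; rewrite expR_pow. Qed.

Lemma integrable_poly (P : {poly R}) :
  gam2.-integrable setT (fun z => (P.[expR (- (1/2) * sqnorm z)])%:E).
Proof.
under eq_fun do rewrite poly_laplaceE -sumEFin.
apply: integrable_sum => // i _.
under eq_fun do rewrite EFinM.
by apply: integrableZl => //; exact: integrable_laplace2.
Qed.

Lemma integral_poly (P : {poly R}) :
  (\int[gam2]_z (P.[expR (- (1/2) * sqnorm z)])%:E = (unif_int P)%:E)%E.
Proof.
under eq_integral do rewrite poly_laplaceE -sumEFin.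
rewrite integral_sum//; last first.
  move=> i; under eq_fun do rewrite EFinM.
  by apply: integrableZl => //; exact: integrable_laplace2.
rewrite /unif_int -sumEFin; apply: eq_bigr => i _.
under eq_integral do rewrite EFinM.
rewrite integralZl//; last exact: integrable_laplace2.
by rewrite laplace_chi2// EFinM.
Qed.

Lemma measurable_ball_sqnorm (x : R) : measurable [set z | sqnorm z <= x]%classic.
Proof.
have -> : [set z | sqnorm z <= x]%classic = (setT `&` @sqnorm R @^-1` `]-oo, x])%classic.
  by rewrite setTI; apply/seteqP; split => z /=; rewrite in_itv.
exact: (@measurable_sqnorm R measurableT).
Qed.

Lemma chi2_cdfE (x : R) : gam2 [set z | sqnorm z <= x]%classic = (chi2_cdf x)%:E.
Proof.
rewrite /chi2_cdf /chi2_2 /pushforward fineK.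
  by congr (gam2 _); apply/seteqP; split => z /=; rewrite in_itv.
set S := (X in gam2 X).
have mS : measurable S.
  have -> : S = [set z | sqnorm z <= x]%classic.
    by apply/seteqP; split => z /=; rewrite /S /= in_itv.
  exact: measurable_ball_sqnorm.
rewrite ge0_fin_numE ?measure_ge0//; apply: (@le_lt_trans _ _ (gam2 setT)).
  by apply: le_measure => //; rewrite inE.
by rewrite gam2_setT ltry.
Qed.

Let step_fun (x : R) (z : R * R) : R := (sqnorm z <= x)%R%:R.

Let step_funE x : step_fun x = \1_([set z | sqnorm z <= x]%classic).
Proof.
apply/funext => z; rewrite /step_fun indicE; congr (nat_of_bool _)%:R.
by apply/idP/idP; rewrite inE.
Qed.

Let measurable_step x : measurable_fun setT (step_fun x).
Proof. by rewrite step_funE; apply: measurable_indic; exact: measurable_ball_sqnorm. Qed.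

Let step_integrable (x e : R) :
  gam2.-integrable setT (fun z => (step_fun x z + e)%:E).
Proof.
apply: measurable_bounded_integrable => //.
- by have := gam2_setT; rewrite /= => ->; rewrite ltry.
- by apply: measurable_funD => //; exact: measurable_step.
- exists (1 + `|e|); split => // M M1 z _ /=; apply: le_trans (ltW M1).
  apply: le_trans (ler_normD _ _) _; rewrite lerD2r /step_fun.
  by case: (sqnorm z <= x); rewrite /= ?normr1 ?normr0 ?ler01.
Qed.

Let step_int (x e : R) :
  (\int[gam2]_z (step_fun x z + e)%:E = (chi2_cdf x + e)%:E)%E.
Proof.
have i0 (y : R) : gam2.-integrable setT (fun z => (step_fun y z)%:E).
  have -> : (fun z => (step_fun y z)%:E) = (fun z => (step_fun y z + 0)%:E).
    by apply/funext => z; rewrite addr0.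
  exact: step_integrable.
have ie : gam2.-integrable setT (fun=> e%:E).
  apply: measurable_bounded_integrable => //.
    by have := gam2_setT; rewrite /= => ->; rewrite ltry.
  by exists `|e|; split => // M M1 z _ /=; exact: ltW.
under eq_integral do rewrite EFinD.
rewrite integralD//= EFinD -chi2_cdfE; congr (_ + _)%E.
  by rewrite step_funE integral_indic ?setIT//; exact: measurable_ball_sqnorm.
by rewrite integral_cst//= gam2_setT mule1.
Qed.

Let w01 (z : R * R) : 0 <= expR (- (1/2) * sqnorm z) <= 1.
Proof.
rewrite expR_ge0 -[X in _ <= X]expR0 ler_expR.
by have := sqnorm_ge0 z; lra.
Qed.

(** The polynomial is compared with the indicator of the event that the squared
    norm is at most [x], transported to the unit interval. *)
Lemma unif_int_le (P : {poly R}) (x eps : R) :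
  (forall u, 0 <= u <= 1 -> P.[u] <= 1 /\ (u <= expR (- (1/2) * x) -> P.[u] <= eps)) ->
  0 <= eps -> unif_int P <= chi2_cdf x + eps.
Proof.
move=> hP e0; rewrite -lee_fin -integral_poly -step_int.
apply: le_integral => //; first exact: integrable_poly.
move=> z _; rewrite lee_fin /step_fun; have [h1 h2] := hP _ (w01 z).
case: (leP (sqnorm z) x) => [_|xz] /=; first by lra.
by rewrite add0r; apply: h2; rewrite ler_expR; lra.
Qed.

Lemma unif_int_ge (P : {poly R}) (x eps : R) :
  (forall u, 0 <= u <= 1 -> 0 <= P.[u] /\ (expR (- (1/2) * x) <= u -> 1 - eps <= P.[u])) ->
  0 <= eps -> chi2_cdf x - eps <= unif_int P.
Proof.
move=> hP e0; rewrite -lee_fin -integral_poly -step_int.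
apply: le_integral => //; first exact: integrable_poly.
move=> z _; rewrite lee_fin /step_fun; have [h1 h2] := hP _ (w01 z).
case: (leP (sqnorm z) x) => [zx|_] /=; last by lra.
by apply: h2; rewrite ler_expR; lra.
Qed.

Lemma cvg_fsum (I : Type) (r : seq I) (f : I -> nat -> R) (l : I -> R) :
  (forall i, (f i N @[N --> \oo] --> l i)%classic) ->
  ((\sum_(i <- r) f i N) @[N --> \oo] --> \sum_(i <- r) l i)%classic.
Proof.
move=> h; elim: r => [|i r IH].
  rewrite big_nil (_ : (fun N => _) = fun=> 0); first exact: cvg_cst.
  by apply/funext => N; rewrite big_nil.
rewrite big_cons (_ : (fun N => _) = fun N => f i N + \sum_(j <- r) f j N).
  exact: cvgD.
by apply/funext => N; rewrite big_cons.
Qed.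

(** Since [exp (- S / 2)] takes values in the unit interval, its law is
    determined by its moments; here they converge to those of the uniform law,
    and Bernstein polynomials turn this into convergence of the distribution
    functions. *)
Lemma laplace_cvg_in_law (F : nat -> R -> R)
    (w S : forall N, {set 'I_N} -> R) :
  (forall N A, 0 <= w N A) -> (forall N, \sum_A w N A = 1) ->
  (\forall N \near \oo, forall A, w N A != 0 -> 0 <= S N A)%classic ->
  (forall k : nat,
    (fexp (w N) (fun A => expR (- (1/2) * (k%:R * S N A))) @[N --> \oo]
      --> ((1 + k%:R)^-1 : R))%classic) ->
  (forall N x, F N x = fexp (w N) (fun A => (S N A <= x)%R%:R)) ->
  cvg_in_law F (@chi2_2 R).
Proof.
move=> w0 w1 hS hL hF.
change (forall x : R, {for x, continuous chi2_cdf} ->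
  (F N x @[N --> \oo] --> chi2_cdf x)%classic).
move=> x cx.
have cvgP (P : {poly R}) :
    (fexp (w N) (fun A => P.[expR (- (1/2) * S N A)]) @[N --> \oo] --> unif_int P)%classic.
  rewrite (_ : (fun N => _) = fun N => \sum_(i < size P) P`_i *
    fexp (w N) (fun A => expR (- (1/2) * (i%:R * S N A)))); last first.
    apply/funext => N.
    transitivity (fexp (w N) (fun A => \sum_(i < size P) P`_i * expR (- (1/2) * (i%:R * S N A)))).
      by apply: eq_fexp => A; exact: poly_laplaceE.
    by rewrite fexp_sum; apply: eq_bigr => i _; rewrite fexpZ.
  by apply: cvg_fsum => i; apply: cvgM; [exact: cvg_cst | exact: hL].
apply/cvgrPdist_le => e e0.
have e6 : 0 < e / 4 by rewrite divr_gt0.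
have [de de0 hde] : exists2 de : R, 0 < de &
    forall y, `|y - x| <= de -> `|chi2_cdf y - chi2_cdf x| <= e / 4.
  move/cvgrPdist_le: cx => /(_ _ e6) [r r0 hr].
  exists (r / 2); first by rewrite divr_gt0.
  move=> y yx; rewrite distrC; apply: hr => /=; rewrite distrC.
  by apply: le_lt_trans yx _; rewrite ltr_pdivrMr// ltr_pMr// ltr1n.
have expm (y y' : R) : y < y' -> expR (- (1/2) * y') < expR (- (1/2) * y).
  by move=> yy; rewrite ltr_expR; lra.
have lesupp N (f g : {set 'I_N} -> R) : (forall A, w N A != 0 -> 0 <= S N A) ->
    (forall A, 0 <= S N A -> f A <= g A) -> fexp (w N) f <= fexp (w N) g.
  move=> S0 fg; apply: ler_sum => A _; have [->|wA] := eqVneq (w N A) 0.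
    by rewrite !mul0r.
  by rewrite ler_wpM2l ?w0//; apply: fg; exact: S0.
have U01 (y : R) : 0 <= y -> 0 <= expR (- (1/2) * y) <= 1.
  by move=> y0; rewrite expR_ge0 -[X in _ <= X]expR0 ler_expR; lra.
have [P1 hP1] := soft_threshold (expm x (x + de) ltac:(lra)) e6.
have [P2 hP2] := soft_threshold (expm (x - de) x ltac:(lra)) e6.
have [E1 E1cvg l1] : exists2 E1 : nat -> R, (E1 N @[N --> \oo] --> unif_int P1)%classic &
    forall N, (forall A, w N A != 0 -> 0 <= S N A) -> F N x <= E1 N + e / 4.
  exists (fun N => fexp (w N) (fun A => P1.[expR (- (1/2) * S N A)])); first exact: cvgP.
  move=> N S0.
  have -> : fexp (w N) (fun A => P1.[expR (- (1/2) * S N A)]) + e / 4 =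
      fexp (w N) (fun A => P1.[expR (- (1/2) * S N A)] + e / 4).
    by rewrite fexpD (fexp_cst (w1 N)).
  rewrite hF; apply: lesupp S0 _ => A SA.
  have [/andP[p0 p1] p2 p3] := hP1 _ (U01 _ SA).
  case: (leP (S N A) x) => [Sx|_] /=; last by lra.
  have h : expR (- (1/2) * x) <= expR (- (1/2) * S N A) by rewrite ler_expR; lra.
  by have := p2 h; lra.
have [E2 E2cvg l2] : exists2 E2 : nat -> R, (E2 N @[N --> \oo] --> unif_int P2)%classic &
    forall N, (forall A, w N A != 0 -> 0 <= S N A) -> E2 N - e / 4 <= F N x.
  exists (fun N => fexp (w N) (fun A => P2.[expR (- (1/2) * S N A)])); first exact: cvgP.
  move=> N S0.
  have -> : fexp (w N) (fun A => P2.[expR (- (1/2) * S N A)]) - e / 4 =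
      fexp (w N) (fun A => P2.[expR (- (1/2) * S N A)] - e / 4).
    by rewrite fexpB (fexp_cst (w1 N)).
  rewrite hF; apply: lesupp S0 _ => A SA.
  have [/andP[p0 p1] p2 p3] := hP2 _ (U01 _ SA).
  case: (leP (S N A) x) => [_|Sx] /=; first by lra.
  have h : expR (- (1/2) * S N A) <= expR (- (1/2) * x) by rewrite ler_expR; lra.
  by have := p3 h; lra.
have u1 : unif_int P1 <= chi2_cdf (x + de) + e / 4.
  by apply: unif_int_le (ltW e6) => u u01; have [/andP[]] := hP1 u u01.
have u2 : chi2_cdf (x - de) - e / 4 <= unif_int P2.
  by apply: unif_int_ge (ltW e6) => u u01; have [/andP[]] := hP2 u u01.
have d1 : `|chi2_cdf (x + de) - chi2_cdf x| <= e / 4.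
  by apply: hde; rewrite addrAC subrr add0r ger0_norm// ltW.
have d2 : `|chi2_cdf (x - de) - chi2_cdf x| <= e / 4.
  by apply: hde; rewrite addrAC subrr add0r normrN ger0_norm// ltW.
have bound N : (forall A, w N A != 0 -> 0 <= S N A) ->
    `|unif_int P1 - E1 N| <= e / 4 -> `|unif_int P2 - E2 N| <= e / 4 ->
    `|chi2_cdf x - F N x| <= e.
  move=> S0; have := l1 N S0; have := l2 N S0.
  move: d1 d2 u1 u2; move: (chi2_cdf _) (chi2_cdf _) (chi2_cdf _) (F N x) (E1 N) (E2 N).
  move: (unif_int P1) (unif_int P2) => a b c1 c2 c3 f f1 f2.
  rewrite !ler_norml => /andP[? ?] /andP[? ?] ? ? ? ? /andP[? ?] /andP[? ?].
  by apply/andP; split; lra.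
move/cvgrPdist_le : E1cvg => /(_ _ e6) near1.
move/cvgrPdist_le : E2cvg => /(_ _ e6) near2.
near=> N.
by apply: bound; near: N.
Unshelve. all: by end_near. Qed.

End LimitLaw.

(** * Asymptotics *)

(** This exponent is where the square roots [s] and [v] come from. *)
Lemma powR_three_halves (R : realType) (x : R) : 0 <= x ->
  x `^ (3 / 2) = Num.sqrt x ^+ 3.
Proof.
move=> x0; rewrite (_ : 3 / 2 = 2^-1 * 3%:R); last by rewrite mulrC.
by rewrite powRrM powR12_sqrt// powR_mulrn// sqrtr_ge0.
Qed.

Lemma is_littleo_le (R : realType) (a b : nat -> R) (e : R) :
  is_littleo a b -> (forall N, 0 <= b N) -> 0 < e ->
  (\forall N \near \oo, 0 < b N /\ a N <= e * b N)%classic.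
Proof.
move=> [bn0 ab] b0 e0; move/cvgrPdist_le: ab => /(_ _ e0) near1.
near=> N.
have bN : 0 < b N.
  by rewrite lt_neqAle b0 andbT eq_sym; near: N.
split=> //; have : `|0 - a N / b N| <= e by near: N.
rewrite sub0r normrN ler_norml => /andP[_].
by rewrite ler_pdivrMr.
Unshelve. all: by end_near. Qed.

(** Expanding the square, the diagonal terms give the sum weighted by the
    degrees; so the condition on pairs of neighbours controls the neighbourhood
    sums. *)
Lemma nbr_sum (R : realType) (N : nat) (G : sgraph N) (z : 'I_N -> R) :
  \sum_j (\sum_i adjR R G j i * z i) ^+ 2 =
  \sum_i degR R G i * z i ^+ 2 +
  \sum_i \sum_(j in neighbours G i) \sum_(k in neighbours G i | j != k) z j * z k.
Proof.
have sw : \sum_i degR R G i * z i ^+ 2 = \sum_j \sum_i adjR R G j i * z i ^+ 2.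
  rewrite exchange_big; apply: eq_bigr => i _; rewrite -mulr_suml; congr (_ * _).
  by apply: eq_bigr => j _; exact: adjRC.
rewrite sw -big_split; apply: eq_bigr => i _ /=.
rewrite expr2 mulr_suml.
have -> : \sum_(j in neighbours G i) \sum_(k in neighbours G i | j != k) z j * z k =
    \sum_j \sum_(k | k != j) adjR R G i j * z j * (adjR R G i k * z k).
  rewrite big_mkcond; apply: eq_bigr => j _; rewrite inE /adjR.
  case: (G i j) => /=; last by rewrite big1// => k _; rewrite !mul0r.
  rewrite big_mkcond [RHS]big_mkcond; apply: eq_bigr => k _; rewrite inE eq_sym.
  by case: (G i k); case: (_ != _) => //=; rewrite ?mul1r ?mul0r ?mulr0.
rewrite -big_split; apply: eq_bigr => j _ /=.
rewrite mulr_sumr (bigD1 j)//=; congr (_ + _).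
by rewrite -{3}(adjR_sq R G i j); ring.
Qed.

Section Main.
Variables (R : realType) (m n : nat -> nat).
Hypothesis hN : forall N : nat, N = (m N + n N)%N.
Variable r : R.
Hypotheses (hr0 : 0 < r) (hr1 : r < 1).
Hypothesis hm : ((m N)%:R / N%:R @[N --> \oo] --> r)%classic.
Variable G : forall N : nat, sgraph N.
Hypothesis h1a : is_littleo
       (fun N => \sum_(i < N) #|edges_at (G N) i|%:R ^+ 2)
       (fun N => #|edges (G N)|%:R `^ (3 / 2) : R).
Hypothesis h1b : is_littleo
       (fun N => #|squares (G N)|%:R)
       (fun N => #|edges (G N)|%:R ^+ 2 : R).
Hypothesis h2a : is_littleo
       (fun N => \sum_(i < N) `|cdeg (G N) R i| ^+ 3)
       (fun N => VG (G N) R `^ (3 / 2)).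
Hypothesis h2b : is_littleo
       (fun N => \sum_(i < N) cdeg (G N) R i ^+ 3)
       (fun N => VG (G N) R * Num.sqrt #|edges (G N)|%:R).
Hypothesis h2c : is_littleo
       (fun N => \sum_(i < N) \sum_(j in neighbours (G N) i)
          \sum_(k in neighbours (G N) i | j != k)
            cdeg (G N) R j * cdeg (G N) R k)
       (fun N => #|edges (G N)|%:R * VG (G N) R).

Let p N : R := (m N)%:R / N%:R.
Let s N : R := Num.sqrt #|edges (G N)|%:R.
Let v N : R := Num.sqrt (VG (G N) R).
Let tau N : R := Num.sqrt (p N * (1 - p N)).
Let B : R := (Num.sqrt (r * (1 - r) / 2))^-1.

Let mN N : (m N <= N)%N. Proof. by rewrite {2}(hN N) leq_addr. Qed.

Let p01 N : 0 <= p N <= 1.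
Proof.
rewrite /p divr_ge0 ?ler0n//=; case: N => [|N]; first by rewrite invr0 mulr0 ler01.
by rewrite ler_pdivrMr ?ltr0n// mul1r ler_nat mN.
Qed.

Let VG_ge0 N : 0 <= VG (G N) R.
Proof. by apply: sumr_ge0 => i _; exact: sqr_ge0. Qed.

Let rr0 : 0 < r * (1 - r). Proof. by rewrite mulr_gt0// subr_gt0. Qed.

Let B0 : 0 < B.
Proof. by rewrite /B invr_gt0 sqrtr_gt0 divr_gt0. Qed.

Let near_p : (\forall N \near \oo, r * (1 - r) / 2 <= p N * (1 - p N))%classic.
Proof.
have : (p N * (1 - p N) @[N --> \oo] --> r * (1 - r))%classic.
  by apply: cvgM => //; apply: cvgB => //; exact: cvg_cst.
move/cvgrPdist_le => /(_ (r * (1 - r) / 2)) h.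
near=> N.
have : `|r * (1 - r) - p N * (1 - p N)| <= r * (1 - r) / 2.
  by near: N; apply: h; rewrite divr_gt0.
by rewrite ler_norml => /andP[_]; lra.
Unshelve. all: by end_near. Qed.

(** Half of the limit of [p * (1 - p)] gives the constant [B]. The neighbourhood
    sums require most care: their diagonal part is the sum of the cubes of the
    centred degrees plus a term in the mean degree, which is small against
    the number of edges. *)
Lemma eventually_balanced (eta : R) : 0 < eta <= 1 ->
  (\forall N \near \oo,
    balanced (G N) (p N) (cdeg (G N) R) (s N) (v N) (tau N) B eta)%classic.
Proof.
move=> /[dup] eta01 /andP[eta0 eta1].
have ee : 0 < eta ^+ 2 by rewrite exprn_gt0.
have ee4 : 0 < eta ^+ 2 / 4 by rewrite divr_gt0.
have n1a := is_littleo_le h1a (fun N => powR_ge0 _ _) ee.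
have n1b := is_littleo_le h1b (fun N => sqr_ge0 _) ee.
have n2a := is_littleo_le h2a (fun N => powR_ge0 _ _) ee.
have n2b := is_littleo_le h2b (fun N => mulr_ge0 (VG_ge0 N) (sqrtr_ge0 _)) ee4.
have n2c := is_littleo_le h2c (fun N => mulr_ge0 (ler0n _ _) (VG_ge0 N)) ee4.
have nN : (\forall N \near \oo, 2 / N%:R <= eta ^+ 2 / 2 :> R)%classic.
  near=> N.
  have N4 : 4 / eta ^+ 2 <= N%:R by near: N; exact: nbhs_infty_ger.
  have N0 : 0 < N%:R :> R by apply: lt_le_trans N4; rewrite divr_gt0.
  rewrite ler_pdivrMr//; move: N4; rewrite ler_pdivrMr//; lra.
near=> N.
have [b1 a1] : 0 < (#|edges (G N)|%:R : R) `^ (3 / 2) /\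
  \sum_(i < N) #|edges_at (G N) i|%:R ^+ 2 <= eta ^+ 2 * #|edges (G N)|%:R `^ (3 / 2).
  by near: N.
have [b2 a2] : 0 < (#|edges (G N)|%:R : R) ^+ 2 /\
  #|squares (G N)|%:R <= eta ^+ 2 * #|edges (G N)|%:R ^+ 2 by near: N.
have [b3 a3] : 0 < VG (G N) R `^ (3 / 2) /\
  \sum_(i < N) `|cdeg (G N) R i| ^+ 3 <= eta ^+ 2 * VG (G N) R `^ (3 / 2) by near: N.
have [b4 a4] : 0 < VG (G N) R * Num.sqrt #|edges (G N)|%:R /\
  \sum_(i < N) cdeg (G N) R i ^+ 3 <=
    eta ^+ 2 / 4 * (VG (G N) R * Num.sqrt #|edges (G N)|%:R) by near: N.
have [b5 a5] : 0 < #|edges (G N)|%:R * VG (G N) R /\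
  \sum_(i < N) \sum_(j in neighbours (G N) i)
          \sum_(k in neighbours (G N) i | j != k)
            cdeg (G N) R j * cdeg (G N) R k <=
    eta ^+ 2 / 4 * (#|edges (G N)|%:R * VG (G N) R) by near: N.
have aN : 2 / N%:R <= eta ^+ 2 / 2 :> R by near: N.
have ap : r * (1 - r) / 2 <= p N * (1 - p N) by near: N.
have e0 : 0 < #|edges (G N)|%:R :> R.
  by rewrite lt_neqAle ler0n andbT; apply: contraTneq b2 => <-; rewrite expr0n ltxx.
have V0 : 0 < VG (G N) R by rewrite -(pmulr_rgt0 _ e0).
have s2 : s N ^+ 2 = #|edges (G N)|%:R by rewrite sqr_sqrtr ?ler0n.
have v2 : v N ^+ 2 = VG (G N) R by rewrite sqr_sqrtr// ltW.
have s1 : 1 <= s N.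
  rewrite -(@ler_pXn2r _ 2)// ?nnegrE ?sqrtr_ge0// expr1n s2.
  by rewrite ler1n -(ltr0n R).
have zE i : cdeg (G N) R i = degR R (G N) i - 2 * s N ^+ 2 / N%:R.
  by rewrite s2 -edges_atE.
rewrite -v2 in a4 b4 a5 b5 V0; rewrite -/(s N) in a4 b4; rewrite -s2 in a2 a5 b5 e0.
rewrite !powR_three_halves ?ler0n// ?VG_ge0// -/(s N) -/(v N) in a1 a3.
have pp : 0 < p N * (1 - p N) by apply: lt_le_trans ap; rewrite divr_gt0.
split => //.
- by rewrite sqrtr_gt0 -s2.
- by rewrite sqrtr_gt0 -v2.
- by rewrite sqrtr_gt0.
- by rewrite lef_pV2 ?posrE ?sqrtr_gt0 ?divr_gt0// ler_sqrt// ltW.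
- by rewrite sqr_sqrtr// ltW.
- apply: le_trans a1; apply: ler_sum => i _; by rewrite edges_atE.
- by rewrite (_ : s N ^+ 4 = (s N ^+ 2) ^+ 2) // -exprM.
- rewrite nbr_sum.
  have -> : \sum_i degR R (G N) i * cdeg (G N) R i ^+ 2 =
    \sum_i cdeg (G N) R i ^+ 3 + 2 / N%:R * s N ^+ 2 * v N ^+ 2.
    rewrite v2 /VG mulr_sumr -big_split; apply: eq_bigr => i _ /=.
    by rewrite [in degR _ _ _ * _](_ : degR R (G N) i = cdeg (G N) R i + 2 * s N ^+ 2 / N%:R);
      [ring | rewrite zE; ring].
  have q1 : v N ^+ 2 * s N <= v N ^+ 2 * s N ^+ 2.
    by rewrite ler_wpM2l ?sqr_ge0// expr2 ler_peMl ?sqrtr_ge0.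
  have q2 : 2 / N%:R * (s N ^+ 2 * v N ^+ 2) <= eta ^+ 2 / 2 * (s N ^+ 2 * v N ^+ 2).
    by rewrite ler_wpM2r// mulr_ge0 ?sqr_ge0.
  have q3 := ler_wpM2l (ltW ee4) q1.
  by lra.
Unshelve. all: by end_near. Qed.

(** In [perm_laplace] the width [h] is chosen first, to make the Chebyshev term
    small, and then [eta]. *)
Lemma Sstat_laplace (k : nat) :
  (fexp (pweight R (m N)) (fun A => expR (- (1/2) * (k%:R * Sstat R (m N) (G N) A)))
     @[N --> \oo] --> ((1 + k%:R)^-1 : R))%classic.
Proof.
apply/cvgrPdist_le => e e0.
pose h : R := 1 + 2 / e.
have h1 : 1 <= h by rewrite lerDl divr_ge0// ltW.
have hh : 1 / h ^+ 2 <= e / 2.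
  have h0 : 0 < h by lra.
  rewrite ler_pdivrMr ?exprn_gt0//; apply: (@le_trans _ _ (e / 2 * h)).
    have -> : e / 2 * h = e / 2 + 1 by rewrite /h; field; rewrite gt_eqF.
    by rewrite lerDr divr_ge0// ltW.
  by rewrite ler_wpM2l ?divr_ge0 ?(ltW e0)// expr2 ler_peMr//; lra.
pose C : R := 900 * (1 + k%:R) ^+ 2 * (B ^+ 8 * h ^+ 3).
have k1 : 0 < 1 + k%:R :> R by rewrite addrC natr1 ltr0n.
have C0 : 0 < C.
  apply: mulr_gt0; last by rewrite mulr_gt0 ?exprn_gt0//; lra.
  by apply: mulr_gt0; [lra | rewrite exprn_gt0].
have B40 : 0 < B ^+ 4 by rewrite exprn_gt0.
pose eta : R := Num.min (Num.min 1 (e / 2 / C)) (1 / 8 / B ^+ 4).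
have eta0 : 0 < eta by rewrite !lt_min ltr01 !divr_gt0.
have eta1 : eta <= 1 by rewrite !ge_min lexx.
have etaC : C * eta <= e / 2.
  by rewrite mulrC -ler_pdivlMr// !ge_min lexx !orbT.
have etaB : B ^+ 4 * eta <= 1 / 8.
  by rewrite mulrC -ler_pdivlMr// !ge_min lexx !orbT.
have nb := @eventually_balanced eta (introT andP (conj eta0 eta1)).
near=> N.
have bal : balanced (G N) (p N) (cdeg (G N) R) (s N) (v N) (tau N) B eta by near: N.
have pE : N%:R * p N = (m N)%:R by rewrite mulrC divfK// gt_eqF// (bal_N0 bal).
have := perm_laplace bal (mN N) pE etaB (ler0n R k) h1.
rewrite perm_expectE distrC -/C => hl.
by apply: le_trans hl _; lra.
Unshelve. all: by end_near. Qed.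

End Main.

Theorem theorem1 (R : realType) (m n : nat -> nat)
    (hN : forall N : nat, N = (m N + n N)%N)
    (r : R) (hr0 : 0 < r) (hr1 : r < 1)
    (hm : ((m N)%:R / N%:R @[N --> \oo] --> r)%classic)
    (G : forall N : nat, sgraph N)
    (h1a : is_littleo
       (fun N => \sum_(i < N) #|edges_at (G N) i|%:R ^+ 2)
       (fun N => #|edges (G N)|%:R `^ (3 / 2) : R))
    (h1b : is_littleo
       (fun N => #|squares (G N)|%:R)
       (fun N => #|edges (G N)|%:R ^+ 2 : R))
    (h2a : is_littleo
       (fun N => \sum_(i < N) `|cdeg (G N) R i| ^+ 3)
       (fun N => VG (G N) R `^ (3 / 2)))
    (h2b : is_littleo
       (fun N => \sum_(i < N) cdeg (G N) R i ^+ 3)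
       (fun N => VG (G N) R * Num.sqrt #|edges (G N)|%:R))
    (h2c : is_littleo
       (fun N => \sum_(i < N) \sum_(j in neighbours (G N) i)
          \sum_(k in neighbours (G N) i | j != k)
            cdeg (G N) R j * cdeg (G N) R k)
       (fun N => #|edges (G N)|%:R * VG (G N) R)) :
  cvg_in_law (fun N => Sstat_cdf (m N) (G N)) (@chi2_2 R).
Proof.
have mN N : (m N <= N)%N by rewrite {2}(hN N) leq_addr.
apply: (@laplace_cvg_in_law R _ (fun N => pweight R (m N)) (fun N => Sstat R (m N) (G N))).
- by move=> N A; exact: pweight_ge0.
- by move=> N; exact: sum_pweight.
- pose B : R := (Num.sqrt (r * (1 - r) / 2))^-1.
  have B0 : 0 < B by rewrite invr_gt0 sqrtr_gt0 divr_gt0// mulr_gt0// subr_gt0.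
  have B40 : 0 < B ^+ 4 by rewrite exprn_gt0.
  pose eta : R := Num.min 1 (1 / 8 / B ^+ 4).
  have eta0 : 0 < eta by rewrite lt_min ltr01 !divr_gt0.
  have eta1 : eta <= 1 by rewrite ge_min lexx.
  have etaB : B ^+ 4 * eta <= 1 / 8 by rewrite mulrC -ler_pdivlMr// ge_min lexx orbT.
  have := eventually_balanced hN hr0 hr1 hm h1a h1b h2a h2b h2c (introT andP (conj eta0 eta1)).
  apply: filterS => N bal A wA.
  have pE : N%:R * ((m N)%:R / N%:R) = (m N)%:R :> R.
    by rewrite mulrC divfK// gt_eqF// (bal_N0 bal).
  apply: (Sstat_ge0 bal (mN N) pE etaB).
  by apply/eqP; apply: contraNT wA => /negbTE Am; rewrite /pweight Am mul0r.
- by move=> k; exact: (Sstat_laplace hN hr0 hr1 hm h1a h1b h2a h2b h2c).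
- by move=> N x; rewrite /Sstat_cdf /perm_prob perm_expectE.
Qed.
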